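(* The general solution $f(\lambda,\mu)=\sum_{k,l\ge0}\alpha_{kl}\lambda^k\mu^l\in\mathbb{C}[[\lambda,\mu]]$ with $\alpha_{kl}=\alpha_{lk}$ of the equation $$f(\lambda,\mu)+e^{\mu}f(\mu,-\lambda-\mu)+e^{-\lambda}f(\lambda,-\lambda-\mu)=\frac{1}{\lambda+\mu}\left(\frac{e^{\mu}-1}{\mu}+\frac{e^{-\lambda}-1}{\lambda}\right)$$ is $f=\mathrm{Even}(f)+\mathrm{Odd}(f)$ with $$1+\lambda\mu\cdot \mathrm{Even}\bigl(f(\lambda,\mu)\bigr)=\frac{e^{\lambda+\mu}-e^{-\lambda-\mu}}{2(\lambda+\mu)}\left(\frac{2\omega}{e^{\omega}-e^{-\omega}}+\sum_{n=3}^{\infty}h_n(\lambda,\mu)\right),$$ $$\mathrm{Odd}\bigl(f(\lambda,\mu)\bigr)=\frac{e^{\lambda+\mu}-e^{-\lambda-\mu}}{2}\left(\sum_{n=0}^{\infty}\tilde\beta_{n0}\,\omega^{2n}+\sum_{n=3}^{\infty}\tilde h_n(\lambda,\mu)\right),$$ where $\omega=\sqrt{\lambda^2+\lambda\mu+\mu^2}$ and, for $n\ge3$, $$h_n(\lambda,\mu)=\sum_{k=1}^{\lfloor n/3\rfloor}\beta_{nk}\lambda^{2k}\mu^{2k}(\lambda+\mu)^{2k}\omega^{2n-6k},\qquad \tilde h_n(\lambda,\mu)=\sum_{k=1}^{\lfloor n/3\rfloor}\tilde\beta_{nk}\lambda^{2k}\mu^{2k}(\lambda+\mu)^{2k}\omega^{2n-6k}.$$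 Here $\tilde\beta_{n0}\in\mathbb{C}$ ($n\ge0$) and $\beta_{nk},\tilde\beta_{nk}\in\mathbb{C}$ ($n\ge 3$, $1\le k\le\lfloor n/3\rfloor$) are free parameters: every choice of them gives a solution, and every solution arises in this way. In particular, for any Drinfeld associator $\Phi=\exp(\varphi)$, if $\bar\varphi=\sum_{k,l\ge0}\alpha_{kl}[a^kb^lab]$ is the image of $\varphi$ in $\widehat{\bar L}_3$, then $$\alpha_{2k,0}=\frac{2^{2k+1}B_{2k+2}}{(2k+2)!}\qquad\text{for every }k\ge0.$$
   Context: For $f\in\mathbb{C}[[\lambda,\mu]]$: $\mathrm{Even}(f)(\lambda,\mu)=\frac{f(\lambda,\mu)+f(-\lambda,-\mu)}2$ and $\mathrm{Odd}(f)(\lambda,\mu)=\frac{f(\lambda,\mu)-f(-\lambda,-\mu)}2$. Only even powers of $\omega$ occur (in particular $\frac{2\omega}{e^\omega-e^{-\omega}}$ is a power series in $\omega^2$). Bernoulli numbers: $\sum_{n\ge0}\frac{B_n}{n!}x^n=\frac{x}{e^x-1}$. For $n\ge2$ let $A_n$ (resp. $L_n$) be the associative (resp. Lie) algebra over $\mathbb{C}$ generated by $t^{ij}=t^{ji}$, $1\le i\neq j\le n$, with relations $[t^{ij},t^{kl}]=0$ for pairwise distinct $i,j,k,l$ and $[t^{ij},t^{jk}]=[t^{jk},t^{ki}]=[t^{ki},t^{ij}]$ for pairwise distinct $i,j,k$, graded by $\deg t^{ij}=1$; $\hat A_n,\hat L_n$ are the degree completions. $\bar L_3=L_3/\bigl[[L_3,L_3],[L_3,L_3]\bigr]$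 with completion $\widehat{\bar L}_3$. Write $a=t^{12}$, $b=t^{23}$, $c=t^{13}$, and $[x_1x_2\ldots x_k]=[x_1,[x_2,[\ldots,x_k]\ldots]]$, so $[a^kb^lab]=\mathrm{ad}_a^k\,\mathrm{ad}_b^l[a,b]$. A Drinfeld associator is an element $\Phi=\Phi(a,b)\in\hat A_3$, a series in $a,b$, such that (1) $\Phi(a,b)\Phi(b,a)=1$; (2) (hexagon) $\exp(b+c)=\Phi(c,a)\exp(c)\Phi(c,b)^{-1}\exp(b)\Phi(a,b)$ in $\hat A_3$; (3) (pentagon) $\Phi(t^{23},t^{34})\,\Phi(t^{12}+t^{13},t^{24}+t^{34})\,\Phi(t^{12},t^{23})=\Phi(t^{12},t^{23}+t^{24})\,\Phi(t^{13}+t^{23},t^{34})$ in $\hat A_4$; (4) $\Phi(a,0)=\Phi(0,b)=1$; (5) $\Phi=\exp(\varphi)$ for some $\varphi\in\hat L_3$ (a Lie series in $a,b$). *)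

(* Defs.v *)
From HB Require Import structures.
From mathcomp Require Import all_boot all_algebra.
From mathcomp Require Import boolp classical_sets reals.
From mathcomp.real_closed Require Export complex.
From mathcomp Require Export all_boot all_algebra reals.

Set Implicit Arguments.
Unset Strict Implicit.
Unset Printing Implicit Defensive.

Import GRing.Theory.
Local Open Scope ring_scope.

(* f i j is the coefficient of lambda^i mu^j. *)
Definition series2 (K : Type) := nat -> nat -> K.

HB.instance Definition _ (K : Type) := gen_eqMixin (series2 K).
HB.instance Definition _ (K : Type) := gen_choiceMixin (series2 K).

Section Series2Ring.
Variable K : comNzRingType.
Implicit Types f g h : series2 K.

Definition s2add f g : series2 K := fun i j => f i j + g i j.
Definition s2opp f : series2 K := fun i j => - f i j.
Definition s2zero : series2 K := fun _ _ => 0.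
Definition s2one : series2 K := fun i j => ((i == 0) && (j == 0))%N%:R.
Definition s2mul f g : series2 K := fun i j =>
  \sum_(a < i.+1) \sum_(b < j.+1) f a b * g (i - a)%N (j - b)%N.
Definition s2scale (c : K) f : series2 K := fun i j => c * f i j.

Lemma s2P f g : (forall i j, f i j = g i j) -> f = g.
Proof. by move=> e; apply/funext => i; apply/funext => j. Qed.

Fact s2addA : associative s2add.
Proof. by move=> f g h; apply/s2P => i j; rewrite /s2add addrA. Qed.
Fact s2addC : commutative s2add.
Proof. by move=> f g; apply/s2P => i j; rewrite /s2add addrC. Qed.
Fact s2add0 : left_id s2zero s2add.
Proof. by move=> f; apply/s2P => i j; rewrite /s2add add0r. Qed.
Fact s2addN : left_inverse s2zero s2opp s2add.
Proof. by move=> f; apply/s2P => i j; rewrite /s2add addNr. Qed.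

HB.instance Definition _ :=
  GRing.isZmodule.Build (series2 K) s2addA s2addC s2add0 s2addN.

Let trunc N f : {poly {poly K}} := \poly_(i < N) \poly_(j < N) f i j.

Let coef_trunc N f i j : (i < N)%N -> (j < N)%N -> (trunc N f)`_i`_j = f i j.
Proof. by move=> iN jN; rewrite coef_poly iN coef_poly jN. Qed.

Let coef_s2mul (p q : {poly {poly K}}) f g i j :
    (forall a b, (a <= i)%N -> (b <= j)%N -> p`_a`_b = f a b) ->
    (forall a b, (a <= i)%N -> (b <= j)%N -> q`_a`_b = g a b) ->
  (p * q)`_i`_j = s2mul f g i j.
Proof.
move=> pf qg; rewrite coefM coef_sum; apply: eq_bigr => a _.
rewrite coefM; apply: eq_bigr => b _.
by rewrite pf ?qg ?leq_subr // -ltnS ltn_ord.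
Qed.

Let coef_truncM f g i j N a b : (i + j < N)%N -> (a <= i)%N -> (b <= j)%N ->
  (trunc N f * trunc N g)`_a`_b = s2mul f g a b.
Proof.
move=> ijN ai bj; apply: coef_s2mul => c d ca db; apply: coef_trunc.
- exact: leq_ltn_trans (leq_trans (leq_trans ca ai) (leq_addr j i)) ijN.
- exact: leq_ltn_trans (leq_trans (leq_trans db bj) (leq_addl i j)) ijN.
- exact: leq_ltn_trans (leq_trans (leq_trans ca ai) (leq_addr j i)) ijN.
- exact: leq_ltn_trans (leq_trans (leq_trans db bj) (leq_addl i j)) ijN.
Qed.

Let coef_trunc_le f i j a b : (a <= i)%N -> (b <= j)%N ->
  (trunc (i + j).+1 f)`_a`_b = f a b.
Proof.
move=> ai bj; apply: coef_trunc; rewrite ltnS.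
  exact: leq_trans ai (leq_addr _ _).
exact: leq_trans bj (leq_addl _ _).
Qed.

Fact s2mulA : associative s2mul.
Proof.
move=> f g h; apply/s2P => i j; pose T := trunc (i + j).+1.
rewrite -(@coef_s2mul (T f) (T g * T h)); first last.
- by move=> a b; apply: coef_truncM.
- by move=> a b; apply: coef_trunc_le.
rewrite -(@coef_s2mul (T f * T g) (T h)) ?mulrA //.
- by move=> a b; apply: coef_truncM.
- by move=> a b; apply: coef_trunc_le.
Qed.
Fact s2mulC : commutative s2mul.
Proof.
move=> f g; apply/s2P => i j; pose T := trunc (i + j).+1.
rewrite -(@coef_s2mul (T f) (T g)); first last.
- by move=> a b; apply: coef_trunc_le.
- by move=> a b; apply: coef_trunc_le.
rewrite [T f * T g]mulrC.
by apply: coef_s2mul => a b; apply: coef_trunc_le.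
Qed.
Fact s2mul1 : left_id s2one s2mul.
Proof.
move=> f; apply/s2P => i j; rewrite /s2mul /s2one.
rewrite big_ord_recl [X in _ + X]big1 => [|a _]; last first.
  by apply: big1 => b _; rewrite mul0r.
rewrite big_ord_recl [X in _ + X + _]big1 => [|a _]; last by rewrite mul0r.
by rewrite mul1r !subn0 !addr0.
Qed.
Fact s2mulD : left_distributive s2mul s2add.
Proof.
move=> f g h; apply/s2P => i j; rewrite /s2add /s2mul -big_split.
apply: eq_bigr => a _; rewrite -big_split; apply: eq_bigr => b _.
by rewrite mulrDl.
Qed.
Fact s2one_neq0 : s2one != 0.
Proof.
apply/eqP => /(congr1 (fun f : series2 K => f 0%N 0%N)) /eqP.
by rewrite /s2one /= oner_eq0.
Qed.

HB.instance Definition _ := GRing.Zmodule_isComNzRing.Build (series2 K)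
  s2mulA s2mulC s2mul1 s2mulD s2one_neq0.

Fact s2scaleA (c d : K) f : s2scale c (s2scale d f) = s2scale (c * d) f.
Proof. by apply/s2P => i j; rewrite /s2scale mulrA. Qed.
Fact s2scale1 : left_id 1 s2scale.
Proof. by move=> f; apply/s2P => i j; rewrite /s2scale mul1r. Qed.
Fact s2scaleDr : right_distributive s2scale +%R.
Proof. by move=> c f g; apply/s2P => i j; rewrite /s2scale mulrDr. Qed.
Fact s2scaleDl f : {morph s2scale^~ f : c d / c + d}.
Proof. by move=> c d; apply/s2P => i j; rewrite /s2scale mulrDl. Qed.

HB.instance Definition _ := GRing.Zmodule_isLmodule.Build K (series2 K)
  s2scaleA s2scale1 s2scaleDr s2scaleDl.

End Series2Ring.

Section Series2.
Variable K : fieldType.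
Implicit Types (f g x y : series2 K) (F : nat -> series2 K).

Definition lam : series2 K := fun i j => ((i == 1) && (j == 0))%N%:R.
Definition mu : series2 K := fun i j => ((i == 0) && (j == 1))%N%:R.

(* The sum of all F n, for families such that F n has order at least n in
   (lambda, mu): only F 0, ..., F (i + j) contribute in bidegree (i, j). *)
Definition s2sum F : series2 K := fun i j => \sum_(n < (i + j).+1) F n i j.

(* f(x, y), for x and y without constant term. *)
Definition s2comp f x y : series2 K :=
  s2sum (fun n => \sum_(k < n.+1) f k (n - k)%N *: (x ^+ k * y ^+ (n - k))).

(* The exponential of x, for x without constant term. *)
Definition s2exp x : series2 K := s2sum (fun n => (n`!%:R)^-1 *: x ^+ n).

(* The quotient f / g: K[[lambda, mu]] is a domain, so for g != 0 there is at
   most one h with h * g = f; the value is the junk 0 if there is none. *)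
Definition s2div f g : series2 K := xget 0 [set h | h * g = f]%classic.

Definition Even f : series2 K := 2^-1 *: (f + s2comp f (- lam) (- mu)).
Definition Odd f : series2 K := 2^-1 *: (f - s2comp f (- lam) (- mu)).

(* x / (e^x - 1), with x = lambda, is the generating series of B_n / n!. *)
Definition bernoulli (n : nat) : K :=
  n`!%:R * s2div lam (s2exp lam - 1) n 0%N.

Definition omega2 : series2 K := lam ^+ 2 + lam * mu + mu ^+ 2.

(* 2w / (e^w - e^-w) is an even series in w: its coefficients are computed with
   w = lambda, then w^2 is replaced by omega^2. *)
Definition omega_over_sinh : series2 K :=
  s2sum (fun n =>
    s2div (2 *: lam) (s2exp lam - s2exp (- lam)) n.*2 0%N *: omega2 ^+ n).

Definition f_equation f : Prop :=
  f + s2exp mu * s2comp f mu (- lam - mu)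
    + s2exp (- lam) * s2comp f lam (- lam - mu)
  = s2div (s2div (s2exp mu - 1) mu + s2div (s2exp (- lam) - 1) lam)
          (lam + mu).

(* For k <= n %/ 3 the exponent n - 3 * k is not truncated, and
   omega2 ^+ (n - 3 * k) is omega^(2n - 6k). *)
Definition h_poly (beta : nat -> nat -> K) (n : nat) : series2 K :=
  \sum_(1 <= k < (n %/ 3).+1)
    beta n k *: (lam ^+ (2 * k) * mu ^+ (2 * k) * (lam + mu) ^+ (2 * k)
                 * omega2 ^+ (n - 3 * k)).

(* beta is only used at (n, k) with n >= 3 and 1 <= k <= n %/ 3; betat is used
   there and at all (n, 0).  The sums over n >= 3 are reindexed by n.+3. *)
Definition general_solution (beta betat : nat -> nat -> K) f : Prop :=
  1 + lam * mu * Even f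
    = s2div (s2exp (lam + mu) - s2exp (- lam - mu)) (2 *: (lam + mu))
      * (omega_over_sinh + s2sum (fun n => h_poly beta n.+3))
  /\ Odd f
    = 2^-1 *: (s2exp (lam + mu) - s2exp (- lam - mu))
      * (s2sum (fun n => betat n 0%N *: omega2 ^+ n)
         + s2sum (fun n => h_poly betat n.+3)).

End Series2.

(* Noncommutative power series: F w is the coefficient of the word w. *)
Definition ncseries (K X : Type) := seq X -> K.

HB.instance Definition _ (K X : Type) := gen_eqMixin (ncseries K X).
HB.instance Definition _ (K X : Type) := gen_choiceMixin (ncseries K X).

Section NcSeriesRing.
Variables (K : comNzRingType) (X : Type).
Implicit Types F G H : ncseries K X.

Definition ncadd F G : ncseries K X := fun w => F w + G w.
Definition ncopp F : ncseries K X := fun w => - F w.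
Definition nczero : ncseries K X := fun _ => 0.
Definition ncone : ncseries K X := fun w => (nilp w)%:R.
Definition ncmul F G : ncseries K X := fun w =>
  \sum_(i < (size w).+1) F (take i w) * G (drop i w).
Definition ncscale (c : K) F : ncseries K X := fun w => c * F w.

Fact ncaddA : associative ncadd.
Proof. by move=> F G H; apply/funext => w; rewrite /ncadd addrA. Qed.
Fact ncaddC : commutative ncadd.
Proof. by move=> F G; apply/funext => w; rewrite /ncadd addrC. Qed.
Fact ncadd0 : left_id nczero ncadd.
Proof. by move=> F; apply/funext => w; rewrite /ncadd add0r. Qed.
Fact ncaddN : left_inverse nczero ncopp ncadd.
Proof. by move=> F; apply/funext => w; rewrite /ncadd addNr. Qed.

HB.instance Definition _ :=
  GRing.isZmodule.Build (ncseries K X) ncaddA ncaddC ncadd0 ncaddN.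

Fact ncmulDl : left_distributive ncmul ncadd.
Proof.
move=> F G H; apply/funext => w; rewrite /ncadd /ncmul -big_split.
by apply: eq_bigr => i _; rewrite mulrDl.
Qed.
Fact ncmulDr : right_distributive ncmul ncadd.
Proof.
move=> F G H; apply/funext => w; rewrite /ncadd /ncmul -big_split.
by apply: eq_bigr => i _; rewrite mulrDr.
Qed.

Let ncmul_nil F G : ncmul F G [::] = F [::] * G [::].
Proof. by rewrite /ncmul big_ord_recl big_ord0 addr0. Qed.

Let ncmul_cons F G x w :
  ncmul F G (x :: w)
  = F [::] * G (x :: w) + ncmul (fun v => F (x :: v)) G w.
Proof. by rewrite {1}/ncmul big_ord_recl. Qed.

Let ncmul_scale (c : K) F G w :
  ncmul (ncscale c F) G w = c * ncmul F G w.
Proof. by rewrite /ncmul mulr_sumr; apply: eq_bigr => i _; rewrite mulrA. Qed.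

Fact ncmulA : associative ncmul.
Proof.
move=> F G H; apply/funext => w; elim: w F G H => [|x w IHw] F G H.
  by rewrite !ncmul_nil mulrA.
rewrite [LHS]ncmul_cons IHw [RHS]ncmul_cons ncmul_nil ncmul_cons.
rewrite mulrDr mulrA -addrA; congr (_ + _).
have -> : (fun v => ncmul F G (x :: v))
    = ncadd (ncscale (F [::]) (fun v => G (x :: v)))
            (ncmul (fun v => F (x :: v)) G).
  by apply/funext => v; rewrite ncmul_cons.
by rewrite ncmulDl [RHS]/ncadd ncmul_scale.
Qed.
Fact ncmul1l : left_id ncone ncmul.
Proof.
move=> F; apply/funext => w; rewrite /ncmul big_ord_recl big1 => [|i _].
  by rewrite take0 drop0 mul1r addr0.
by case: w i => [[]//|x w] i; rewrite /= mul0r.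
Qed.
Fact ncmul1r : right_id ncone ncmul.
Proof.
move=> F; apply/funext => w; rewrite /ncmul big_ord_recr big1 => [|i _] /=.
  by rewrite take_size drop_size mulr1 add0r.
by rewrite /ncone /nilp size_drop subn_eq0 leqNgt ltn_ord mulr0.
Qed.
Fact ncone_neq0 : ncone != 0.
Proof.
apply/eqP => /(congr1 (fun F : ncseries K X => F [::])) /eqP.
by rewrite /ncone /= oner_eq0.
Qed.

HB.instance Definition _ := GRing.Zmodule_isNzRing.Build (ncseries K X)
  ncmulA ncmul1l ncmul1r ncmulDl ncmulDr ncone_neq0.

Fact ncscaleA (c d : K) F : ncscale c (ncscale d F) = ncscale (c * d) F.
Proof. by apply/funext => w; rewrite /ncscale mulrA. Qed.
Fact ncscale1 : left_id 1 ncscale.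
Proof. by move=> F; apply/funext => w; rewrite /ncscale mul1r. Qed.
Fact ncscaleDr : right_distributive ncscale +%R.
Proof. by move=> c F G; apply/funext => w; rewrite /ncscale mulrDr. Qed.
Fact ncscaleDl F : {morph ncscale^~ F : c d / c + d}.
Proof. by move=> c d; apply/funext => w; rewrite /ncscale mulrDl. Qed.

HB.instance Definition _ := GRing.Zmodule_isLmodule.Build K (ncseries K X)
  ncscaleA ncscale1 ncscaleDr ncscaleDl.

End NcSeriesRing.

Section NcSeries.
Variables (K : fieldType) (X : eqType).
Implicit Types F G x y : ncseries K X.

Definition ncmonom (u : seq X) : ncseries K X := fun w => (w == u)%:R.

Definition ncdegpart (d : nat) F : ncseries K X :=
  fun w => if size w == d then F w else 0.

(* As s2sum: for families such that F n has no words of length < n. *)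
Definition ncsum (F : nat -> ncseries K X) : ncseries K X :=
  fun w => \sum_(n < (size w).+1) F n w.

(* For x without constant term. *)
Definition ncexp x : ncseries K X := ncsum (fun n => (n`!%:R)^-1 *: x ^+ n).

(* For F with constant term 1. *)
Definition ncinv F : ncseries K X := ncsum (fun n => (1 - F) ^+ n).

(* Phi(x, y) for a series Phi in the letters a = false and b = true, and for x
   and y without constant term. *)
Definition ncsubst2 (Phi : ncseries K bool) x y : ncseries K X :=
  ncsum (fun n => \sum_(w : n.-tuple bool)
    Phi w *: \prod_(e <- w) (if e then y else x)).

End NcSeries.

Inductive lie_expr (K X : Type) : Type :=
| LVar of X
| LZero
| LAdd of lie_expr K X & lie_expr K X
| LScale of K & lie_expr K X
| LBr of lie_expr K X & lie_expr K X.
Arguments LVar {K X}.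
Arguments LZero {K X}.

Section LieAlgebras.
Variable K : fieldType.

Definition LSub X (x y : lie_expr K X) := LAdd x (LScale (-1) y).

Fixpoint lie_subst X Y (s : X -> lie_expr K Y) (e : lie_expr K X) :
    lie_expr K Y :=
  match e with
  | LVar x => s x
  | LZero => LZero
  | LAdd e1 e2 => LAdd (lie_subst s e1) (lie_subst s e2)
  | LScale c e1 => LScale c (lie_subst s e1)
  | LBr e1 e2 => LBr (lie_subst s e1) (lie_subst s e2)
  end.

Inductive lie_homog X : nat -> lie_expr K X -> Prop :=
| homog_var x : lie_homog 1 (LVar x)
| homog_zero d : lie_homog d LZero
| homog_add d x y : lie_homog d x -> lie_homog d y -> lie_homog d (LAdd x y)
| homog_scale d c x : lie_homog d x -> lie_homog d (LScale c x)
| homog_br d1 d2 x y :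
    lie_homog d1 x -> lie_homog d2 y -> lie_homog (d1 + d2) (LBr x y).

(* Equality in the Lie algebra over K generated by X with relations r = 0 for
   all r such that rel r. *)
Inductive lie_eq X (rel : lie_expr K X -> Prop) :
    lie_expr K X -> lie_expr K X -> Prop :=
| lie_refl x : lie_eq rel x x
| lie_sym x y : lie_eq rel x y -> lie_eq rel y x
| lie_trans x y z : lie_eq rel x y -> lie_eq rel y z -> lie_eq rel x z
| lie_congr_add x x' y y' :
    lie_eq rel x x' -> lie_eq rel y y' -> lie_eq rel (LAdd x y) (LAdd x' y')
| lie_congr_scale c x x' :
    lie_eq rel x x' -> lie_eq rel (LScale c x) (LScale c x')
| lie_congr_br x x' y y' :
    lie_eq rel x x' -> lie_eq rel y y' -> lie_eq rel (LBr x y) (LBr x' y')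
| lie_addA x y z : lie_eq rel (LAdd x (LAdd y z)) (LAdd (LAdd x y) z)
| lie_addC x y : lie_eq rel (LAdd x y) (LAdd y x)
| lie_add0 x : lie_eq rel (LAdd LZero x) x
| lie_addN x : lie_eq rel (LSub x x) LZero
| lie_scale1 x : lie_eq rel (LScale 1 x) x
| lie_scaleA c d x : lie_eq rel (LScale c (LScale d x)) (LScale (c * d) x)
| lie_scaleDr c x y :
    lie_eq rel (LScale c (LAdd x y)) (LAdd (LScale c x) (LScale c y))
| lie_scaleDl c d x :
    lie_eq rel (LScale (c + d) x) (LAdd (LScale c x) (LScale d x))
| lie_brDl x y z : lie_eq rel (LBr (LAdd x y) z) (LAdd (LBr x z) (LBr y z))
| lie_brDr x y z : lie_eq rel (LBr x (LAdd y z)) (LAdd (LBr x y) (LBr x z))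
| lie_brZl c x y : lie_eq rel (LBr (LScale c x) y) (LScale c (LBr x y))
| lie_brZr c x y : lie_eq rel (LBr x (LScale c y)) (LScale c (LBr x y))
| lie_alt x : lie_eq rel (LBr x x) LZero
| lie_jacobi x y z :
    lie_eq rel
      (LAdd (LBr x (LBr y z)) (LAdd (LBr y (LBr z x)) (LBr z (LBr x y))))
      LZero
| lie_relator r : rel r -> lie_eq rel r LZero.

(* The value of a Lie expression in K<<X>>, brackets being commutators. *)
Fixpoint lie_eval (X : eqType) (e : lie_expr K X) : ncseries K X :=
  match e with
  | LVar x => ncmonom K [:: x]
  | LZero => 0
  | LAdd e1 e2 => lie_eval e1 + lie_eval e2
  | LScale c e1 => c *: lie_eval e1
  | LBr e1 e2 =>
      lie_eval e1 * lie_eval e2 - lie_eval e2 * lie_eval e1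
  end.

(* An element of the degree completion of a graded Lie algebra is given by its
   components phi d, represented by homogeneous expressions of degree d. *)
Definition lie_graded X (phi : nat -> lie_expr K X) : Prop :=
  forall d, lie_homog d (phi d).

Definition lie_series (X : eqType) (phi : nat -> lie_expr K X) :
    ncseries K X :=
  ncsum (fun d => lie_eval (phi d)).

(* The pair (i, j) with 1 <= i < j <= n stands for t^{ij} = t^{ji}. *)
Definition tgen (n : nat) : eqType :=
  {p : nat * nat | (1 <= p.1)%N && (p.1 < p.2)%N && (p.2 <= n)%N}.

(* t^{ij} for 1 <= i != j <= n; junk value 0 otherwise. *)
Definition tL (n i j : nat) : lie_expr K (tgen n) :=
  oapp LVar LZero (insub (minn i j, maxn i j)).

Inductive L_relator (n : nat) : lie_expr K (tgen n) -> Prop :=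
| L_rel_comm i j k l :
    uniq [:: i; j; k; l] ->
    all (fun m => (1 <= m)%N && (m <= n)%N) [:: i; j; k; l] ->
    L_relator (LBr (tL n i j) (tL n k l))
| L_rel_cyc i j k :
    uniq [:: i; j; k] ->
    all (fun m => (1 <= m)%N && (m <= n)%N) [:: i; j; k] ->
    L_relator (LSub (LBr (tL n i j) (tL n j k))
                    (LBr (tL n j k) (tL n k i))).

(* The relations of L_3 / [[L_3, L_3], [L_3, L_3]]. *)
Inductive Lbar3_relator : lie_expr K (tgen 3) -> Prop :=
| Lbar_rel_L r : L_relator r -> Lbar3_relator r
| Lbar_rel_metab x y z w : Lbar3_relator (LBr (LBr x y) (LBr z w)).

(* The two-sided ideal defining A_n, in the free algebra on the t^{ij}. *)
Inductive A_ideal (n : nat) : ncseries K (tgen n) -> Prop :=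
| A_ideal0 : A_ideal 0
| A_idealD c u r v F : L_relator r -> A_ideal F ->
    A_ideal (c *: (ncmonom K u * lie_eval r * ncmonom K v) + F).

(* Equality in the degree completion of A_n; the relators being homogeneous, it
   is equality in A_n of the homogeneous components of each degree. *)
Definition A_eq (n : nat) (F G : ncseries K (tgen n)) : Prop :=
  forall d, A_ideal (ncdegpart d (F - G)).

Definition tA (n i j : nat) : ncseries K (tgen n) := lie_eval (tL n i j).
Arguments tA : clear implicits.

Record drinfeld_associator (Phi : ncseries K bool) : Prop := {
  associator_sym :
    let a := tA 3 1 2 in let b := tA 3 2 3 in
    A_eq (ncsubst2 Phi a b * ncsubst2 Phi b a) 1;
  associator_hexagon :
    let a := tA 3 1 2 in let b := tA 3 2 3 in let c := tA 3 1 3 in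
    A_eq (ncexp (b + c))
         (ncsubst2 Phi c a * ncexp c * ncinv (ncsubst2 Phi c b)
          * ncexp b * ncsubst2 Phi a b);
  associator_pentagon :
    let t := tA 4 in
    A_eq (ncsubst2 Phi (t 2 3) (t 3 4)
          * ncsubst2 Phi (t 1 2 + t 1 3) (t 2 4 + t 3 4)
          * ncsubst2 Phi (t 1 2) (t 2 3))
         (ncsubst2 Phi (t 1 2) (t 2 3 + t 2 4)
          * ncsubst2 Phi (t 1 3 + t 2 3) (t 3 4));
  associator_unit :
    let a := tA 3 1 2 in let b := tA 3 2 3 in
    A_eq (ncsubst2 Phi a 0) 1 /\ A_eq (ncsubst2 Phi 0 b) 1;
  associator_exp_lie :
    let la := tL 3 1 2 in let lb := tL 3 2 3 in
    exists psi : nat -> lie_expr K bool, lie_graded psi /\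
      A_eq (ncsubst2 Phi (tA 3 1 2) (tA 3 2 3))
        (ncexp (lie_series
          (fun d => lie_subst (fun e : bool => if e then lb else la) (psi d))))
}.

Definition lie_akblab (k l : nat) : lie_expr K (tgen 3) :=
  let a := tL 3 1 2 in let b := tL 3 2 3 in
  iter k (LBr a) (iter l (LBr b) (LBr a b)).

(* The degree d part of the sum of all alpha_kl [a^k b^l a b], k, l >= 0. *)
Definition metabelian_part (alpha : series2 K) (d : nat) :
    lie_expr K (tgen 3) :=
  if d is m.+2 then
    \big[@LAdd K _/LZero]_(k < m.+1)
      LScale (alpha k (m - k)%N) (lie_akblab k (m - k))
  else LZero.

Definition Lbar3_image (phi : nat -> lie_expr K (tgen 3)) (alpha : series2 K) :
    Prop :=
  forall d, lie_eq Lbar3_relator (phi d) (metabelian_part alpha d).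

End LieAlgebras.
Arguments tA K n i j : clear implicits.

(* Main.v *)
From HB Require Import structures.
From mathcomp Require Import boolp classical_sets.
From mathcomp Require Import zify ring.
Require Import Defs.

Set Implicit Arguments.
Unset Strict Implicit.
Unset Printing Implicit Defensive.

Import GRing.Theory Num.Theory.
Local Open Scope ring_scope.

(* Put nu = - lambda - mu. The symmetric group S_3 permutes lambda, mu, nu, and
   for symmetric f the left-hand side of the equation is
     f(lambda, mu) + e^mu f(mu, nu) + e^(-lambda) f(nu, lambda).
   For U = Odd f, and also for U = nu (1 + lambda mu Even f), the equation says
   that U(lambda, mu) + e^mu U(mu, nu) + e^(-lambda) U(nu, lambda) = 0. Comparing
   with the image of this relation under (lambda, mu) -> (- lambda, - mu), one
   gets sinh(mu) U(mu, nu) = sinh(lambda) U(nu, lambda), so that the solutions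
   are U = sinh(lambda + mu) Q with Q even and S_3-invariant. Such a Q is a series
   in omega^2 and (lambda mu nu)^2. In the second case the restriction of Q to
   mu = 0 is prescribed, which fixes the pure powers of omega^2.

   For an associator, map A_3 to K[[lambda, mu]] by a -> lambda, b -> mu, c -> nu
   and take abelianised Fox derivatives. These vanish on the relations and on the
   second derived algebra, and send [a^k b^l a b] to lambda^k mu^l times the value
   on [a, b]. Hence (1) gives the symmetry of alpha, and the hexagon gives the
   equation; alpha_{2k,0} is then read off by setting mu = 0 and mu = - lambda. *)

(** * Power series in two variables *)

(** The equation splits by parity: on symmetric f the substitution (lambda, mu) -> (- mu, - lambda)
    fixes the right-hand side, which is a divided difference of (e^x - 1) / x at mu and - lambda,
    and turns the left-hand side for f into the one for f(- lambda, - mu). So Even f solves the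
    equation and Odd f its homogeneous version. The factor nu makes the first case homogeneous as
    well, because nu + e^mu lambda + e^(-lambda) mu is - lambda mu nu times the right-hand side; it
    also makes U odd, as the comparison of a relation with its negated image requires. Divisions
    become cancellations, K[[lambda, mu]] being a domain. What has to be produced is divisibility by
    lambda, mu or lambda + mu, and it is read off from restrictions to lines. Identities between
    substitutions are checked on monomials, since linear maps that do not lower the order are
    determined there. *)

Section Filtration.
Variable K : fieldType.
Implicit Types (f g h x y : series2 K) (F G : nat -> series2 K) (n m : nat).

Lemma s2coefD f g i j : (f + g) i j = f i j + g i j. Proof. by []. Qed.
Lemma s2coefN f i j : (- f) i j = - f i j. Proof. by []. Qed.
Lemma s2coefB f g i j : (f - g) i j = f i j - g i j. Proof. by []. Qed.
Lemma s2coefZ c f i j : (c *: f) i j = c * f i j. Proof. by []. Qed.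
Lemma s2coef0 i j : (0 : series2 K) i j = 0. Proof. by []. Qed.
Lemma s2coef1 i j : (1 : series2 K) i j = ((i == 0) && (j == 0))%N%:R.
Proof. by []. Qed.
Lemma s2coefM f g i j :
  (f * g) i j
  = \sum_(a < i.+1) \sum_(b < j.+1) f a b * g (i - a)%N (j - b)%N.
Proof. by []. Qed.
Lemma s2coef_sum I (r : seq I) (P : pred I) (F : I -> series2 K) i j :
  (\sum_(k <- r | P k) F k) i j = \sum_(k <- r | P k) F k i j.
Proof. by elim/big_rec2: _ => //= k y z _ <-. Qed.

Lemma s2mul_lam f i j : (lam K * f) i.+1 j = f i j.
Proof.
rewrite s2coefM (bigD1 (inord 1)) //= inordK // [X in _ + X]big1 ?addr0.
  rewrite big_ord_recl /= /lam /= !mul1r subn0 subSS subn0 big1 ?addr0 //.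
  by move=> b _; rewrite mul0r.
move=> a /eqP na; apply: big1 => b _; rewrite /lam.
case: eqP => [e|]; last by rewrite mul0r.
by case: na; apply: val_inj; rewrite /= inordK.
Qed.

Lemma s2mul_lam0 f j : (lam K * f) 0%N j = 0.
Proof. by rewrite s2coefM big_ord1 big1 // => b _; rewrite mul0r. Qed.

Lemma s2mul_mu f i j : (mu K * f) i j.+1 = f i j.
Proof.
rewrite s2coefM big_ord_recl [X in _ + X]big1 ?addr0; last first.
  by move=> a _; apply: big1 => b _; rewrite mul0r.
rewrite (bigD1 (inord 1)) //= inordK // [X in _ + X]big1 ?addr0.
  by rewrite /mu /= mul1r subn0 subSS subn0.
move=> a /eqP na; rewrite /mu /=.
case: eqP => [e|]; last by rewrite mul0r.
by case: na; apply: val_inj; rewrite /= inordK.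
Qed.

Lemma s2mul_mu0 f i : (mu K * f) i 0%N = 0.
Proof.
by rewrite s2coefM big1 // => a _; rewrite big_ord1 /mu andbF mul0r.
Qed.

Fact s2scaleAl c f g : c *: (f * g) = (c *: f) * g.
Proof.
apply/s2P => i j; rewrite s2coefZ !s2coefM mulr_sumr; apply: eq_bigr => a _.
by rewrite mulr_sumr; apply: eq_bigr => b _; rewrite mulrA.
Qed.

HB.instance Definition _ :=
  GRing.Lmodule_isLalgebra.Build K (series2 K) s2scaleAl.
HB.instance Definition _ := GRing.Lalgebra_isComAlgebra.Build K (series2 K).

Lemma s2coef_monom k l i j :
  (lam K ^+ k * mu K ^+ l) i j = ((i == k) && (j == l))%:R.
Proof.
elim: k i => [|k IHk] [|i].
- rewrite expr0 mul1r; elim: l j => [|l IHl] [|j] //.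
    by rewrite exprS s2mul_mu0.
  by rewrite exprS s2mul_mu IHl.
- rewrite expr0 mul1r; elim: l j => [|l IHl] [|j] //.
    by rewrite exprS s2mul_mu0.
  by rewrite exprS s2mul_mu IHl.
- by rewrite exprS -mulrA s2mul_lam0.
by rewrite exprS -mulrA s2mul_lam IHk.
Qed.

(** The (lambda, mu)-adic filtration. It gives the topology in which [s2sum] converges, and [ord_eq]
    expresses that it is separated. *)
Definition ord n f := forall i j, (i + j < n)%N -> f i j = 0.

Lemma ord_zero n : ord n 0. Proof. by []. Qed.
Lemma ordW m n f : (m <= n)%N -> ord n f -> ord m f.
Proof. by move=> mn fn i j ij; apply/fn/(leq_trans ij). Qed.
Lemma ordD n f g : ord n f -> ord n g -> ord n (f + g).
Proof. by move=> fn gn i j ij; rewrite s2coefD fn ?gn ?addr0. Qed.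
Lemma ordN n f : ord n f -> ord n (- f).
Proof. by move=> fn i j ij; rewrite s2coefN fn ?oppr0. Qed.
Lemma ordB n f g : ord n f -> ord n g -> ord n (f - g).
Proof. by move=> fn gn; apply: ordD => //; apply: ordN. Qed.
Lemma ordZ n c f : ord n f -> ord n (c *: f).
Proof. by move=> fn i j ij; rewrite s2coefZ fn ?mulr0. Qed.
Lemma ord_sum n I (r : seq I) (P : pred I) (F : I -> series2 K) :
  (forall k, P k -> ord n (F k)) -> ord n (\sum_(k <- r | P k) F k).
Proof. by move=> Fn; elim/big_rec: _ => // k x Pk xn; apply: ordD; auto. Qed.
Lemma ordM m n f g : ord m f -> ord n g -> ord (m + n) (f * g).
Proof.
move=> fm gn i j ij; rewrite s2coefM big1 // => a _; rewrite big1 // => b _.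
have [ab|ab] := ltnP (a + b) m; first by rewrite fm ?mul0r.
by rewrite gn ?mulr0 //; have := ltn_ord a; have := ltn_ord b; lia.
Qed.
Lemma ordX n f : ord 1 f -> ord n (f ^+ n).
Proof. by move=> f1; elim: n => // n IHn; rewrite exprS -add1n; apply: ordM. Qed.
Lemma ordMl n f g : ord n g -> ord n (f * g).
Proof. by move=> gn; rewrite -[n]add0n; apply: ordM. Qed.
Lemma ordMr n f g : ord n f -> ord n (f * g).
Proof. by move=> fn; rewrite mulrC; apply: ordMl. Qed.
Lemma ord_lam : ord 1 (lam K). Proof. by case=> [|i] [|j]. Qed.
Lemma ord_mu : ord 1 (mu K). Proof. by case=> [|i] [|j]. Qed.
Lemma ord1P f : f 0%N 0%N = 0 -> ord 1 f.
Proof. by move=> f0 [|i] [|j]. Qed.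

Lemma ord_eq f g : (forall n, ord n (f - g)) -> f = g.
Proof.
move=> fg; apply/s2P => i j; apply/eqP; rewrite -subr_eq0 -s2coefB.
by rewrite (fg (i + j).+1).
Qed.

(** The bound in [s2sum] varies with the bidegree; any larger bound gives the same coefficient,
    because the extra terms have too high an order. *)
Lemma s2sumE F M i j : (forall n, ord n (F n)) -> (i + j < M)%N ->
  s2sum F i j = \sum_(n < M) F n i j.
Proof.
move=> Fo ijM; rewrite /s2sum -!(big_mkord xpredT (fun n => F n i j)).
rewrite [RHS](big_cat_nat (n := (i + j).+1)) //=.
rewrite [X in _ = _ + X]big_nat_cond [X in _ = _ + X]big1 ?addr0 //.
by move=> n; rewrite andbT => /andP[ijn _]; apply: Fo.
Qed.

Lemma s2sum_approx F N : (forall n, ord n (F n)) ->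
  ord N (s2sum F - \sum_(n < N) F n).
Proof.
by move=> Fo i j ij; rewrite s2coefB (s2sumE Fo ij) s2coef_sum subrr.
Qed.

Lemma ord_s2sum F N : (forall n, ord n (F n)) -> (forall n, ord N (F n)) ->
  ord N (s2sum F).
Proof. by move=> Fo FN i j ij; rewrite /s2sum big1 // => n _; apply: FN. Qed.

Lemma eq_s2sum F G : F =1 G -> s2sum F = s2sum G.
Proof. by move=> FG; congr s2sum; apply/funext. Qed.

Lemma s2sumD F G : s2sum (fun n => F n + G n) = s2sum F + s2sum G.
Proof.
by apply/s2P => i j; rewrite s2coefD /s2sum -big_split.
Qed.

Lemma s2sumN F : s2sum (fun n => - F n) = - s2sum F.
Proof. by apply/s2P => i j; rewrite s2coefN /s2sum -sumrN. Qed.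

Lemma s2sumB F G : s2sum (fun n => F n - G n) = s2sum F - s2sum G.
Proof. by rewrite s2sumD s2sumN. Qed.

Lemma s2sumZ c F : s2sum (fun n => c *: F n) = c *: s2sum F.
Proof. by apply/s2P => i j; rewrite s2coefZ /s2sum mulr_sumr. Qed.

Lemma s2sum_recl F : (forall n, ord n (F n)) -> s2sum F = F 0%N + s2sum (fun n => F n.+1).
Proof.
move=> Fo; apply/s2P => i j; rewrite s2coefD (@s2sumE F (i + j).+2) //.
by rewrite big_ord_recl.
Qed.

Lemma s2sum_cauchy F G : (forall n, ord n (F n)) -> (forall n, ord n (G n)) ->
  s2sum (fun n => \sum_(k < n.+1) F k * G (n - k)%N) = s2sum F * s2sum G.
Proof.
move=> Fo Go; apply: ord_eq => N.
have FGo n : ord n (\sum_(k < n.+1) F k * G (n - k)%N).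
  apply: ord_sum => k _; have kn : (k <= n)%N by rewrite -ltnS.
  by rewrite -{1}(subnKC kn); apply: ordM.
(* Polynomials over [series2 K] in an auxiliary variable, evaluated at 1: [coefM] produces the
   Cauchy products, and the coefficients of index at least N have order at least N. *)
pose p := \poly_(k < N) F k; pose q := \poly_(k < N) G k.
have pE : p.[1] = \sum_(n < N) F n.
  by rewrite horner_poly; apply: eq_bigr => n _; rewrite expr1n mulr1.
have qE : q.[1] = \sum_(n < N) G n.
  by rewrite horner_poly; apply: eq_bigr => n _; rewrite expr1n mulr1.
have pqE : ord N ((p * q).[1] - \sum_(n < N) \sum_(k < n.+1) F k * G (n - k)%N).
  rewrite (@horner_coef_wide _ (N + (N + N)) (p * q)); last first.
    apply: leq_trans (size_polyMleq _ _) _.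
    have := size_poly N (fun k => F k); have := size_poly N (fun k => G k).
    rewrite -/p -/q; lia.
  rewrite big_split_ord /= addrAC -sumrB; apply: ordD.
    apply: ord_sum => n _; rewrite expr1n mulr1 coefM -sumrB.
    apply: ord_sum => k _; rewrite !coef_poly.
    have -> : (k < N)%N by have := ltn_ord n; have := ltn_ord k; lia.
    have -> : (n - k < N)%N by have := ltn_ord n; lia.
    by rewrite subrr.
  apply: ord_sum => n _; rewrite expr1n mulr1 coefM; apply: ord_sum => k _.
  apply: (@ordW _ (k + (N + n - k))); first by have := ltn_ord k; lia.
  by apply: ordM; rewrite coef_poly; case: ifP.
have -> : s2sum (fun n => \sum_(k < n.+1) F k * G (n - k)%N) - s2sum F * s2sum G
  = (s2sum (fun n => \sum_(k < n.+1) F k * G (n - k)%N)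
     - \sum_(n < N) \sum_(k < n.+1) F k * G (n - k)%N)
    - ((p * q).[1] - \sum_(n < N) \sum_(k < n.+1) F k * G (n - k)%N)
    - (s2sum F - p.[1]) * s2sum G - p.[1] * (s2sum G - q.[1]).
  rewrite hornerM; ring.
apply: ordB; first apply: ordB; first (apply: ordB => //; exact: s2sum_approx).
  by apply: ordMr; rewrite pE; apply: s2sum_approx.
by apply: ordMl; rewrite qE; apply: s2sum_approx.
Qed.

Lemma s2sumMl f F : (forall n, ord n (F n)) ->
  s2sum (fun n => f * F n) = f * s2sum F.
Proof.
move=> Fo; apply: ord_eq => N.
have -> : s2sum (fun n => f * F n) - f * s2sum F
  = (s2sum (fun n => f * F n) - \sum_(n < N) f * F n)
    - f * (s2sum F - \sum_(n < N) F n) by rewrite -mulr_sumr; ring.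
by apply: ordB; [apply: s2sum_approx => n | ]; apply: ordMl => //; apply: s2sum_approx.
Qed.

(** The lexicographically first nonzero coefficients of f and g multiply to the coefficient of f g
    at the sum of their bidegrees: every other product occurring there has a zero factor. *)
Lemma s2_mulf_eq0 f g : f * g = 0 -> f = 0 \/ g = 0.
Proof.
have low h : h <> 0 -> exists i j, [/\ h i j <> 0,
    forall a b, (a < i)%N -> h a b = 0 & forall b, (b < j)%N -> h i b = 0].
  move=> h0.
  have exi : exists i, `[< exists j, h i j <> 0 >].
    apply: contrapT => nex; apply: h0; apply/s2P => i j; apply: contrapT => hij.
    by apply: nex; exists i; apply/asboolP; exists j.
  case: (ex_minnP exi) => i /asboolP[j0 hij0] mini.
  have exj : exists j, `[< h i j <> 0 >] by exists j0; apply/asboolP.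
  case: (ex_minnP exj) => j /asboolP hij minj; exists i, j; split=> // [a b ai|b bj].
    apply: contrapT => hab; suff: (i <= a)%N by rewrite leqNgt ai.
    by apply: mini; apply/asboolP; exists b.
  apply: contrapT => hib; suff: (j <= b)%N by rewrite leqNgt bj.
  by apply: minj; apply/asboolP.
move=> fg0; have [->|/low[i [j [fij fl fm]]]] := pselect (f = 0); first by left.
have [->|/low[k [l [gkl gl gm]]]] := pselect (g = 0); first by right.
move: (congr1 (fun u : series2 K => u (i + k)%N (j + l)%N) fg0).
rewrite s2coefM s2coef0.
have ik : (i < (i + k).+1)%N by lia.
have jl : (j < (j + l).+1)%N by lia.
rewrite (bigD1 (Ordinal ik)) //= (bigD1 (Ordinal jl)) //= !addKn.
rewrite big1 => [|b /eqP bj]; last first.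
  have [bj'|bj'] := ltnP b j; first by rewrite fm ?mul0r.
  rewrite gm ?mulr0 //; have : (nat_of_ord b <> j) by move=> e; apply: bj; apply: val_inj.
  by have := ltn_ord b; lia.
rewrite addr0 big1 => [|a /eqP ai]; last first.
  apply: big1 => b _; have [ai'|ai'] := ltnP a i; first by rewrite fl ?mul0r.
  rewrite gl ?mulr0 //; have : (nat_of_ord a <> i) by move=> e; apply: ai; apply: val_inj.
  by have := ltn_ord a; lia.
by rewrite addr0 => /eqP; rewrite mulf_eq0 => /orP[] /eqP.
Qed.

Lemma s2_mulI f g h : f <> 0 -> f * g = f * h -> g = h.
Proof.
move=> f0 /eqP; rewrite -subr_eq0 -mulrBr => /eqP/s2_mulf_eq0[//|/eqP].
by rewrite subr_eq0 => /eqP.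
Qed.

Lemma s2_mulf_neq0 f g : f <> 0 -> g <> 0 -> f * g <> 0.
Proof. by move=> f0 g0 /s2_mulf_eq0[]. Qed.

Lemma s2_mul0I f g : f <> 0 -> f * g = 0 -> g = 0.
Proof. by move=> f0 /s2_mulf_eq0[]. Qed.

(** Cancellation makes the quotient unique, so the series chosen by [xget] can only be h. *)
Lemma s2divE f g h : g <> 0 -> h * g = f -> s2div f g = h.
Proof.
move=> g0 hg; rewrite /s2div.
apply: (@s2_mulI g) => //; rewrite !(mulrC g) hg.
by rewrite (@xgetPex _ 0 [set h | h * g = f]%classic) //=; exists h.
Qed.

(** f is its constant term times 1 - u with u of positive order, and the geometric series in u
    inverts 1 - u. *)
Lemma s2_inv f : f 0%N 0%N != 0 -> exists g, g * f = 1.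
Proof.
move=> f0; pose u := 1 - (f 0%N 0%N)^-1 *: f.
have u1 : ord 1 u.
  by apply: ord1P; rewrite /u s2coefB s2coefZ mulVf // subrr.
exists ((f 0%N 0%N)^-1 *: s2sum (fun n => u ^+ n)).
rewrite -scalerAl scalerAr.
have -> : (f 0%N 0%N)^-1 *: f = 1 - u by rewrite /u; ring.
rewrite mulrBr mulr1 mulrC -s2sumMl; last by move=> n; apply: ordX.
rewrite {1}s2sum_recl; last by move=> n; apply: ordX.
under [X in _ - X]eq_s2sum => n do rewrite -exprS.
by rewrite expr0 addrK.
Qed.
End Filtration.

(** * Substitution of series without constant term *)

Section Substitution.
Variable K : fieldType.
Implicit Types (f g h x y : series2 K) (F G : nat -> series2 K) (n m : nat).

Lemma s2comp_term_ord x y f n : ord 1 x -> ord 1 y ->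
  ord n (\sum_(k < n.+1) f k (n - k)%N *: (x ^+ k * y ^+ (n - k))).
Proof.
move=> x1 y1; apply: ord_sum => k _; have kn : (k <= n)%N by rewrite -ltnS.
by apply: ordZ; rewrite -{1}(subnKC kn); apply: ordM; apply: ordX.
Qed.

(** Continuity for the filtration. A linear filtered map commutes with [s2sum], hence is determined
    by its values on monomials ([filtered_ext]). *)
Definition filtered (C : series2 K -> series2 K) :=
  forall n f, ord n f -> ord n (C f).

Lemma s2comp_lam_mu f : s2comp f (lam K) (mu K) = f.
Proof.
apply/s2P => i j; rewrite /s2comp /s2sum.
under eq_bigr => n _ do rewrite s2coef_sum.
have ij : (i + j < (i + j).+1)%N by [].
rewrite (bigD1 (Ordinal ij)) //= [X in _ + X]big1 ?addr0.
  have ii : (i < (i + j).+1)%N by lia.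
  rewrite (bigD1 (Ordinal ii)) //= [X in _ + X]big1 ?addr0.
    by rewrite s2coefZ s2coef_monom addKn !eqxx mulr1.
  move=> k /eqP ki; rewrite s2coefZ s2coef_monom.
  case: eqP => [e|]; rewrite ?mulr0 //.
  by case: ki; apply: val_inj.
move=> n /eqP nij; apply: big1 => k _; rewrite s2coefZ s2coef_monom.
case: andP => [[/eqP ei /eqP ej]|]; rewrite ?mulr0 //.
by case: nij; apply: val_inj => /=; have := ltn_ord k; lia.
Qed.

Lemma filtered_s2sum (C : {linear series2 K -> series2 K}) F :
  filtered C -> (forall n, ord n (F n)) -> C (s2sum F) = s2sum (fun n => C (F n)).
Proof.
move=> CF Fo; apply: ord_eq => N.
have -> : C (s2sum F) - s2sum (fun n => C (F n))
  = C (s2sum F - \sum_(n < N) F n)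
    - (s2sum (fun n => C (F n)) - \sum_(n < N) C (F n)).
  by rewrite linearB raddf_sum /= opprB addrC addrA subrK addrC.
apply: ordB; first exact/CF/s2sum_approx.
by apply: s2sum_approx => n; apply: CF.
Qed.

Lemma filtered_expand (C : {linear series2 K -> series2 K}) f : filtered C ->
  C f = s2sum (fun n =>
    \sum_(k < n.+1) f k (n - k)%N *: C (lam K ^+ k * mu K ^+ (n - k))).
Proof.
move=> CF; rewrite -{1}(s2comp_lam_mu f) filtered_s2sum //; last first.
  by move=> n; apply: s2comp_term_ord; [apply: ord_lam | apply: ord_mu].
by apply: eq_s2sum => n; rewrite linear_sum; apply: eq_bigr => k _; rewrite linearZ.
Qed.

Lemma filtered_ext (C D : {linear series2 K -> series2 K}) :
  filtered C -> filtered D ->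
  (forall k l, C (lam K ^+ k * mu K ^+ l) = D (lam K ^+ k * mu K ^+ l)) ->
  C =1 D.
Proof.
move=> CF DF CD f; rewrite !filtered_expand //; apply: eq_s2sum => n.
by apply: eq_bigr => k _; rewrite CD.
Qed.

Lemma filtered_rmorph (C : {lrmorphism series2 K -> series2 K}) f :
  filtered C -> C f = s2comp f (C (lam K)) (C (mu K)).
Proof.
move=> CF; rewrite filtered_expand //; apply: eq_s2sum => n.
by apply: eq_bigr => k _; rewrite rmorphM !rmorphXn.
Qed.

(** The maximal ideal is made a type so that [subst p q] is a ring morphism without side conditions
    and can carry canonical structures. *)
Definition maxideal := {x : series2 K | x 0%N 0%N == 0}.
Implicit Types p q r s : maxideal.

Definition subst p q f := s2comp f (val p) (val q).

Lemma ord_val p : ord 1 (val p).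
Proof. by apply: ord1P; apply/eqP; case: p. Qed.
Hint Resolve ord_val : core.

Lemma subst_filtered p q : filtered (subst p q).
Proof.
move=> N f fN; apply: ord_s2sum => n; first exact: s2comp_term_ord.
have [nN|Nn] := ltnP n N; last first.
  by apply: ordW Nn _; apply: s2comp_term_ord.
rewrite big1 ?ord_zero // => k _.
by rewrite fN ?scale0r ?ord_zero // subnKC // -ltnS.
Qed.

Fact subst_linear p q : linear (subst p q).
Proof.
move=> c f g; rewrite /subst /s2comp -s2sumZ -s2sumD; apply: eq_s2sum => n.
rewrite scaler_sumr -big_split; apply: eq_bigr => k _ /=.
by rewrite s2coefD s2coefZ scalerDl scalerA.
Qed.

HB.instance Definition _ p q := GRing.isLinear.Build K (series2 K) (series2 K)
  _ (subst p q) (@subst_linear p q).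

Lemma subst_monom p q k l :
  subst p q (lam K ^+ k * mu K ^+ l) = val p ^+ k * val q ^+ l.
Proof.
rewrite /subst /s2comp; apply: ord_eq => N.
set F := (fun n => _).
have Fo n : ord n (F n) by apply: s2comp_term_ord.
have FE n : n <> (k + l)%N -> F n = 0.
  move=> nkl; rewrite /F big1 // => a _; rewrite s2coef_monom.
  case: andP => [[/eqP ak /eqP nl]|]; last by rewrite scale0r.
  by case: nkl; rewrite -ak -nl subnKC // -ltnS.
have FklE : F (k + l)%N = val p ^+ k * val q ^+ l.
  have kk : (k < (k + l).+1)%N by lia.
  rewrite /F (bigD1 (Ordinal kk)) //= [X in _ + X]big1 ?addr0.
    by rewrite s2coef_monom addKn !eqxx scale1r.
  move=> a /eqP ak; rewrite s2coef_monom; case: eqP => [e|]; rewrite ?scale0r //.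
  by case: ak; apply: val_inj.
have -> : s2sum F = F (k + l)%N.
  apply/s2P => i j; rewrite (@s2sumE _ F (i + j + k + l).+1) //; last by lia.
  have klb : (k + l < (i + j + k + l).+1)%N by lia.
  rewrite (bigD1 (Ordinal klb)) //= [X in _ + X]big1 ?addr0 //.
  move=> n /eqP nn; rewrite FE //; move=> e; apply: nn; exact: val_inj.
by rewrite FklE subrr; apply: ord_zero.
Qed.

(** Both sides are linear and filtered in each factor separately. [mono] treats a monomial times a
    series; a second use of [filtered_ext] then removes the restriction on the first factor. *)
Fact subst_multiplicative p q : {morph subst p q : f g / f * g}.
Proof.
have filtM (C : series2 K -> series2 K) h : filtered C -> filtered (fun f => h * C f).
  by move=> CF n f fn; apply/ordMl/CF.
have filtM' (C : series2 K -> series2 K) h : filtered C -> filtered (fun f => C (h * f)).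
  by move=> CF n f fn; apply/CF/ordMl.
have sF := @subst_filtered p q.
have mono k l g : subst p q (lam K ^+ k * mu K ^+ l * g)
    = subst p q (lam K ^+ k * mu K ^+ l) * subst p q g.
  move: g; apply: (@filtered_ext
    [the {linear series2 K -> series2 K} of
       subst p q \o ((lam K ^+ k * mu K ^+ l) \*o idfun)]
    [the {linear series2 K -> series2 K} of
       subst p q (lam K ^+ k * mu K ^+ l) \*o subst p q]).
  - exact: filtM'.
  - exact: filtM.
  move=> a b /=; rewrite mulrACA -!exprD !subst_monom !exprD.
  by rewrite mulrACA.
move=> f g; rewrite mulrC [RHS]mulrC; move: f.
apply: (@filtered_ext
    [the {linear series2 K -> series2 K} of subst p q \o (g \*o idfun)]
    [the {linear series2 K -> series2 K} of
       subst p q g \*o subst p q]).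
- exact: filtM'.
- exact: filtM.
by move=> k l /=; rewrite mulrC mono mulrC.
Qed.

Fact subst_monoid p q : monoid_morphism (subst p q).
Proof.
split; last exact: subst_multiplicative.
by have := subst_monom p q 0 0; rewrite !expr0 !mulr1.
Qed.

HB.instance Definition _ p q := GRing.isMonoidMorphism.Build
  (series2 K) (series2 K) (subst p q) (@subst_monoid p q).

Lemma subst_lam p q : subst p q (lam K) = val p.
Proof. by have := subst_monom p q 1 0; rewrite !expr0 !mulr1. Qed.
Lemma subst_mu p q : subst p q (mu K) = val q.
Proof. by have := subst_monom p q 0 1; rewrite !expr0 !mul1r. Qed.

Lemma subst_comp p q r s f :
  subst p q (subst r s f) = s2comp f (subst p q (val r)) (subst p q (val s)).
Proof.
have CF : filtered (subst p q \o subst r s).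
  by move=> n g gn; do 2!apply: subst_filtered.
have := @filtered_rmorph
  [the {lrmorphism series2 K -> series2 K} of subst p q \o subst r s] f CF.
by rewrite /= subst_lam subst_mu.
Qed.

Lemma subst_s2sum p q F : (forall n, ord n (F n)) ->
  subst p q (s2sum F) = s2sum (fun n => subst p q (F n)).
Proof. by move=> Fo; rewrite filtered_s2sum //; apply: subst_filtered. Qed.

End Substitution.

(** * Exponentials *)

Section Exponential.
Variable K : fieldType.
Hypothesis natf0 : forall n, (n%:R == 0 :> K) = (n == 0%N).
Implicit Types (f g h x y : series2 K) (n m : nat) (p q : maxideal K).

Lemma fact_neq0 n : (n`!%:R : K) != 0.
Proof. by rewrite natf0 -lt0n fact_gt0. Qed.

Lemma ordZX (c : K) x n : ord 1 x -> ord n (c *: x ^+ n).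
Proof. by move=> x1; apply/ordZ/ordX. Qed.

(* (e^x - 1) / x *)
Definition expq x : series2 K := s2sum (fun n => (n.+1`!%:R)^-1 *: x ^+ n).

(* (e^x - 1 - x) / x^2 *)
Definition expq2 x : series2 K := s2sum (fun n => (n.+2`!%:R)^-1 *: x ^+ n).

Lemma s2expE x : ord 1 x -> s2exp x = 1 + x * expq x.
Proof.
move=> x1; rewrite /s2exp s2sum_recl => [|n]; last exact: ordZX.
rewrite expr0 fact0 invr1 scale1r /expq -s2sumMl => [|n]; last exact: ordZX.
by congr (_ + _); apply: eq_s2sum => n; rewrite -scalerAr exprS.
Qed.

Lemma expqE x : ord 1 x -> expq x = 1 + x * expq2 x.
Proof.
move=> x1; rewrite /expq s2sum_recl => [|n]; last exact: ordZX.
rewrite expr0 (erefl : 1`! = 1%N) invr1 scale1r /expq2 -s2sumMl => [|n]; last exact: ordZX.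
by congr (_ + _); apply: eq_s2sum => n; rewrite -scalerAr exprS.
Qed.

Lemma s2exp0 : s2exp 0 = 1 :> series2 K.
Proof. by rewrite s2expE ?mul0r ?addr0 //; apply: ord_zero. Qed.

Lemma s2expD x y : ord 1 x -> ord 1 y -> s2exp (x + y) = s2exp x * s2exp y.
Proof.
move=> x1 y1; rewrite /s2exp -s2sum_cauchy; try by move=> n; apply: ordZX.
apply: eq_s2sum => n; rewrite addrC exprDn scaler_sumr; apply: eq_bigr => k _.
have kn : (k <= n)%N by rewrite -ltnS.
rewrite -mulr_natr -scalerAl -scalerAr scalerA mulr_natr -scaler_nat scalerA.
rewrite [y ^+ _ * _]mulrC; congr (_ *: _).
have := bin_fact kn; move/(congr1 (fun m => m%:R : K)); rewrite !natrM => e.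
rewrite -e; field.
by rewrite !fact_neq0 natf0 -lt0n bin_gt0 kn.
Qed.

Lemma s2expN x : ord 1 x -> s2exp x * s2exp (- x) = 1.
Proof. by move=> x1; rewrite -s2expD ?subrr ?s2exp0 //; apply: ordN. Qed.

Lemma subst_exp p q x : ord 1 x -> subst p q (s2exp x) = s2exp (subst p q x).
Proof.
move=> x1; rewrite subst_s2sum => [|n]; last exact: ordZX.
by apply: eq_s2sum => n; rewrite linearZ rmorphXn.
Qed.

Lemma subst_expq p q x : ord 1 x -> subst p q (expq x) = expq (subst p q x).
Proof.
move=> x1; rewrite subst_s2sum => [|n]; last exact: ordZX.
by apply: eq_s2sum => n; rewrite linearZ rmorphXn.
Qed.

(* 2 sinh x and 2 sinh x / x, locked for the same reason as the substitutions
   below. *)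
Fact Sh_key : unit. Proof. by []. Qed.
Definition Sh x : series2 K := locked_with Sh_key (s2exp x - s2exp (- x)).
Lemma ShU x : Sh x = s2exp x - s2exp (- x). Proof. exact: unlock. Qed.
Fact Shq_key : unit. Proof. by []. Qed.
Definition Shq x : series2 K := locked_with Shq_key (expq x + expq (- x)).
Lemma ShqU x : Shq x = expq x + expq (- x). Proof. exact: unlock. Qed.

Lemma ShE x : ord 1 x -> Sh x = x * Shq x.
Proof. by move=> x1; rewrite ShU !s2expE //; [rewrite ShqU; ring | apply: ordN]. Qed.

Lemma ShN x : Sh (- x) = - Sh x.
Proof. by rewrite !ShU opprK opprB. Qed.

Lemma ShqN x : Shq (- x) = Shq x.
Proof. by rewrite !ShqU opprK addrC. Qed.

Lemma subst_Sh p q x : ord 1 x -> subst p q (Sh x) = Sh (subst p q x).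
Proof. by move=> x1; rewrite !ShU rmorphB /= !subst_exp ?rmorphN //; apply: ordN. Qed.

Lemma subst_Shq p q x : ord 1 x -> subst p q (Shq x) = Shq (subst p q x).
Proof. by move=> x1; rewrite !ShqU rmorphD /= !subst_expq ?rmorphN //; apply: ordN. Qed.

Lemma expq00 x : expq x 0%N 0%N = 1.
Proof. by rewrite /expq /s2sum big_ord1 s2coefZ expr0 s2coef1 (erefl : 1`! = 1%N) invr1 mulr1. Qed.

Lemma Shq00 x : Shq x 0%N 0%N = 2.
Proof. by rewrite ShqU s2coefD !expq00. Qed.

Lemma s2neq0 f i j : f i j != 0 -> f <> 0.
Proof. by move=> + f0; rewrite f0 eqxx. Qed.

Lemma Shq_neq0 x : Shq x <> 0.
Proof. by apply: (@s2neq0 _ 0 0); rewrite Shq00 natf0. Qed.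

Lemma Sh_neq0 x : ord 1 x -> x <> 0 -> Sh x <> 0.
Proof. by move=> x1 x0; rewrite ShE // => /s2_mulf_eq0[//|]; apply: Shq_neq0. Qed.

Lemma Shq_inv x : exists g, g * Shq x = 1.
Proof. by apply: s2_inv; rewrite Shq00 natf0. Qed.

End Exponential.

(** * Linear substitutions *)

Section LinearForms.
Variable K : fieldType.
Implicit Types (f g h x y : series2 K) (n m d : nat) (p q : maxideal K).

Local Notation lam := (lam K).
Local Notation mu := (mu K).
Fact nu_key : unit. Proof. by []. Qed.
Definition nu : series2 K := locked_with nu_key (- lam - mu).
Lemma nuU : nu = - lam - mu. Proof. exact: unlock. Qed.

Lemma lam_neq0 : lam <> 0. Proof. by apply: (@s2neq0 _ _ 1 0); rewrite oner_eq0. Qed.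
Lemma mu_neq0 : mu <> 0. Proof. by apply: (@s2neq0 _ _ 0 1); rewrite oner_eq0. Qed.
Lemma nu_neq0 : nu <> 0.
Proof.
by apply: (@s2neq0 _ _ 0 1); rewrite nuU s2coefB s2coefN oppr0 add0r oppr_eq0 oner_eq0.
Qed.
Lemma lamD_neq0 : lam + mu <> 0.
Proof. by apply: (@s2neq0 _ _ 0 1); rewrite s2coefD add0r oner_eq0. Qed.

Lemma ord_nu : ord 1 nu.
Proof. by rewrite nuU; apply: ordB; [apply/ordN/ord_lam | apply: ord_mu]. Qed.
Lemma ord_lamN : ord 1 (- lam). Proof. exact/ordN/ord_lam. Qed.
Lemma ord_muN : ord 1 (- mu). Proof. exact/ordN/ord_mu. Qed.
Lemma ord_lamD : ord 1 (lam + mu).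
Proof. by apply: ordD; [apply: ord_lam | apply: ord_mu]. Qed.

Definition mkmax x (x1 : ord 1 x) : maxideal K :=
  exist (fun x : series2 K => x 0%N 0%N == 0) x (introT eqP (x1 0%N 0%N isT)).

Definition plam := mkmax (@ord_lam K).
Definition pmu := mkmax (@ord_mu K).
Definition pnu := mkmax ord_nu.
Definition plamN := mkmax ord_lamN.
Definition pmuN := mkmax ord_muN.
Definition p0 := mkmax (@ord_zero K 1).

(* These substitutions are locked: unification would otherwise unfold them down to
   coefficient sums when comparing two of them. *)
Fact swp_key : unit. Proof. by []. Qed.
Definition swp := locked_with swp_key (subst pmu plam).
Lemma swpU : swp = subst pmu plam. Proof. exact: unlock. Qed.
Fact swp_linear : linear swp. Proof. rewrite swpU; exact: subst_linear. Qed.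
Fact swp_monoid : monoid_morphism swp. Proof. rewrite swpU; exact: subst_monoid. Qed.
HB.instance Definition _ :=
  GRing.isLinear.Build K (series2 K) (series2 K) _ swp swp_linear.
HB.instance Definition _ :=
  GRing.isMonoidMorphism.Build (series2 K) (series2 K) swp swp_monoid.
Lemma swpD f g : swp (f + g) = swp f + swp g. Proof. exact: rmorphD. Qed.
Lemma swpN f : swp (- f) = - swp f. Proof. exact: rmorphN. Qed.
Lemma swpM f g : swp (f * g) = swp f * swp g. Proof. exact: rmorphM. Qed.
Lemma swpZ c f : swp (c *: f) = c *: swp f. Proof. exact: linearZ. Qed.
Lemma swpX n f : swp (f ^+ n) = swp f ^+ n. Proof. exact: rmorphXn. Qed.
Lemma swp_lam : swp lam = mu. Proof. rewrite swpU; exact: subst_lam. Qed.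
Lemma swp_mu : swp mu = lam. Proof. rewrite swpU; exact: subst_mu. Qed.
Lemma swp_filtered : filtered swp. Proof. rewrite swpU; exact: subst_filtered. Qed.
Lemma swp_comp p q f : swp (s2comp f (val p) (val q)) = s2comp f (swp (val p)) (swp (val q)).
Proof. rewrite swpU; exact: subst_comp. Qed.
Lemma swp_s2sum (F : nat -> series2 K) : (forall n, ord n (F n)) ->
  swp (s2sum F) = s2sum (fun n => swp (F n)).
Proof. rewrite swpU; exact: subst_s2sum. Qed.
Lemma swp_exp x : ord 1 x -> swp (s2exp x) = s2exp (swp x).
Proof. rewrite swpU; exact: subst_exp. Qed.
Lemma swp_expq x : ord 1 x -> swp (expq x) = expq (swp x).
Proof. rewrite swpU; exact: subst_expq. Qed.
Lemma swp_Sh x : ord 1 x -> swp (Sh x) = Sh (swp x).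
Proof. rewrite swpU; exact: subst_Sh. Qed.
Lemma swp_Shq x : ord 1 x -> swp (Shq x) = Shq (swp x).
Proof. rewrite swpU; exact: subst_Shq. Qed.
Definition swp_morphE := (swpD, swpN, swpM, swpX).

Fact cyc_key : unit. Proof. by []. Qed.
Definition cyc := locked_with cyc_key (subst pmu pnu).
Lemma cycU : cyc = subst pmu pnu. Proof. exact: unlock. Qed.
Fact cyc_linear : linear cyc. Proof. rewrite cycU; exact: subst_linear. Qed.
Fact cyc_monoid : monoid_morphism cyc. Proof. rewrite cycU; exact: subst_monoid. Qed.
HB.instance Definition _ :=
  GRing.isLinear.Build K (series2 K) (series2 K) _ cyc cyc_linear.
HB.instance Definition _ :=
  GRing.isMonoidMorphism.Build (series2 K) (series2 K) cyc cyc_monoid.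
Lemma cycD f g : cyc (f + g) = cyc f + cyc g. Proof. exact: rmorphD. Qed.
Lemma cycN f : cyc (- f) = - cyc f. Proof. exact: rmorphN. Qed.
Lemma cycM f g : cyc (f * g) = cyc f * cyc g. Proof. exact: rmorphM. Qed.
Lemma cycZ c f : cyc (c *: f) = c *: cyc f. Proof. exact: linearZ. Qed.
Lemma cycX n f : cyc (f ^+ n) = cyc f ^+ n. Proof. exact: rmorphXn. Qed.
Lemma cyc_lam : cyc lam = mu. Proof. rewrite cycU; exact: subst_lam. Qed.
Lemma cyc_mu : cyc mu = nu. Proof. rewrite cycU; exact: subst_mu. Qed.
Lemma cyc_comp p q f : cyc (s2comp f (val p) (val q)) = s2comp f (cyc (val p)) (cyc (val q)).
Proof. rewrite cycU; exact: subst_comp. Qed.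
Lemma cyc_s2sum (F : nat -> series2 K) : (forall n, ord n (F n)) ->
  cyc (s2sum F) = s2sum (fun n => cyc (F n)).
Proof. rewrite cycU; exact: subst_s2sum. Qed.
Lemma cyc_Sh x : ord 1 x -> cyc (Sh x) = Sh (cyc x).
Proof. rewrite cycU; exact: subst_Sh. Qed.
Definition cyc_morphE := (cycD, cycN, cycM, cycX).

Fact neg_key : unit. Proof. by []. Qed.
Definition neg := locked_with neg_key (subst plamN pmuN).
Lemma negU : neg = subst plamN pmuN. Proof. exact: unlock. Qed.
Fact neg_linear : linear neg. Proof. rewrite negU; exact: subst_linear. Qed.
Fact neg_monoid : monoid_morphism neg. Proof. rewrite negU; exact: subst_monoid. Qed.
HB.instance Definition _ :=
  GRing.isLinear.Build K (series2 K) (series2 K) _ neg neg_linear.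
HB.instance Definition _ :=
  GRing.isMonoidMorphism.Build (series2 K) (series2 K) neg neg_monoid.
Lemma negD f g : neg (f + g) = neg f + neg g. Proof. exact: rmorphD. Qed.
Lemma negN f : neg (- f) = - neg f. Proof. exact: rmorphN. Qed.
Lemma negM f g : neg (f * g) = neg f * neg g. Proof. exact: rmorphM. Qed.
Lemma negZ c f : neg (c *: f) = c *: neg f. Proof. exact: linearZ. Qed.
Lemma negX n f : neg (f ^+ n) = neg f ^+ n. Proof. exact: rmorphXn. Qed.
Lemma neg_lam : neg lam = - lam. Proof. rewrite negU; exact: subst_lam. Qed.
Lemma neg_mu : neg mu = - mu. Proof. rewrite negU; exact: subst_mu. Qed.
Lemma neg_comp p q f : neg (s2comp f (val p) (val q)) = s2comp f (neg (val p)) (neg (val q)).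
Proof. rewrite negU; exact: subst_comp. Qed.
Lemma neg_s2sum (F : nat -> series2 K) : (forall n, ord n (F n)) ->
  neg (s2sum F) = s2sum (fun n => neg (F n)).
Proof. rewrite negU; exact: subst_s2sum. Qed.
Lemma neg_exp x : ord 1 x -> neg (s2exp x) = s2exp (neg x).
Proof. rewrite negU; exact: subst_exp. Qed.
Lemma neg_expq x : ord 1 x -> neg (expq x) = expq (neg x).
Proof. rewrite negU; exact: subst_expq. Qed.
Lemma neg_Sh x : ord 1 x -> neg (Sh x) = Sh (neg x).
Proof. rewrite negU; exact: subst_Sh. Qed.
Lemma neg_Shq x : ord 1 x -> neg (Shq x) = Shq (neg x).
Proof. rewrite negU; exact: subst_Shq. Qed.
Definition neg_morphE := (negD, negN, negM, negX).

(** [res0] and, below, [resd] restrict to the lines mu = 0 and lambda + mu = 0; their vanishing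
    gives divisibility by mu ([dvd_mu]) and by lambda + mu ([dvd_lamD]). *)
Fact res0_key : unit. Proof. by []. Qed.
Definition res0 := locked_with res0_key (subst plam p0).
Lemma res0U : res0 = subst plam p0. Proof. exact: unlock. Qed.
Fact res0_linear : linear res0. Proof. rewrite res0U; exact: subst_linear. Qed.
Fact res0_monoid : monoid_morphism res0. Proof. rewrite res0U; exact: subst_monoid. Qed.
HB.instance Definition _ :=
  GRing.isLinear.Build K (series2 K) (series2 K) _ res0 res0_linear.
HB.instance Definition _ :=
  GRing.isMonoidMorphism.Build (series2 K) (series2 K) res0 res0_monoid.
Lemma res0D f g : res0 (f + g) = res0 f + res0 g. Proof. exact: rmorphD. Qed.
Lemma res0N f : res0 (- f) = - res0 f. Proof. exact: rmorphN. Qed.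
Lemma res0M f g : res0 (f * g) = res0 f * res0 g. Proof. exact: rmorphM. Qed.
Lemma res0Z c f : res0 (c *: f) = c *: res0 f. Proof. exact: linearZ. Qed.
Lemma res0X n f : res0 (f ^+ n) = res0 f ^+ n. Proof. exact: rmorphXn. Qed.
Lemma res0_lam : res0 lam = lam. Proof. rewrite res0U; exact: subst_lam. Qed.
Lemma res0_mu : res0 mu = 0. Proof. rewrite res0U; exact: subst_mu. Qed.
Lemma res0_filtered : filtered res0. Proof. rewrite res0U; exact: subst_filtered. Qed.
Lemma res0_comp p q f : res0 (s2comp f (val p) (val q)) = s2comp f (res0 (val p)) (res0 (val q)).
Proof. rewrite res0U; exact: subst_comp. Qed.
Lemma res0_s2sum (F : nat -> series2 K) : (forall n, ord n (F n)) ->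
  res0 (s2sum F) = s2sum (fun n => res0 (F n)).
Proof. rewrite res0U; exact: subst_s2sum. Qed.
Lemma res0_exp x : ord 1 x -> res0 (s2exp x) = s2exp (res0 x).
Proof. rewrite res0U; exact: subst_exp. Qed.
Lemma res0_expq x : ord 1 x -> res0 (expq x) = expq (res0 x).
Proof. rewrite res0U; exact: subst_expq. Qed.
Lemma res0_Shq x : ord 1 x -> res0 (Shq x) = Shq (res0 x).
Proof. rewrite res0U; exact: subst_Shq. Qed.
Definition res0_morphE := (res0D, res0N, res0M, res0X).

Fact resd_key : unit. Proof. by []. Qed.
Definition resd := locked_with resd_key (subst plam plamN).
Lemma resdU : resd = subst plam plamN. Proof. exact: unlock. Qed.
Fact resd_linear : linear resd. Proof. rewrite resdU; exact: subst_linear. Qed.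
Fact resd_monoid : monoid_morphism resd. Proof. rewrite resdU; exact: subst_monoid. Qed.
HB.instance Definition _ :=
  GRing.isLinear.Build K (series2 K) (series2 K) _ resd resd_linear.
HB.instance Definition _ :=
  GRing.isMonoidMorphism.Build (series2 K) (series2 K) resd resd_monoid.
Lemma resdD f g : resd (f + g) = resd f + resd g. Proof. exact: rmorphD. Qed.
Lemma resdN f : resd (- f) = - resd f. Proof. exact: rmorphN. Qed.
Lemma resdM f g : resd (f * g) = resd f * resd g. Proof. exact: rmorphM. Qed.
Lemma resdZ c f : resd (c *: f) = c *: resd f. Proof. exact: linearZ. Qed.
Lemma resdX n f : resd (f ^+ n) = resd f ^+ n. Proof. exact: rmorphXn. Qed.
Lemma resd_lam : resd lam = lam. Proof. rewrite resdU; exact: subst_lam. Qed.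
Lemma resd_mu : resd mu = - lam. Proof. rewrite resdU; exact: subst_mu. Qed.
Lemma resd_comp p q f : resd (s2comp f (val p) (val q)) = s2comp f (resd (val p)) (resd (val q)).
Proof. rewrite resdU; exact: subst_comp. Qed.
Lemma resd_s2sum (F : nat -> series2 K) : (forall n, ord n (F n)) ->
  resd (s2sum F) = s2sum (fun n => resd (F n)).
Proof. rewrite resdU; exact: subst_s2sum. Qed.
Lemma resd_exp x : ord 1 x -> resd (s2exp x) = s2exp (resd x).
Proof. rewrite resdU; exact: subst_exp. Qed.
Lemma resd_Shq x : ord 1 x -> resd (Shq x) = Shq (resd x).
Proof. rewrite resdU; exact: subst_Shq. Qed.
Definition resd_morphE := (resdD, resdN, resdM, resdX).

Lemma swpS f : swp f = s2comp f mu lam. Proof. by rewrite swpU. Qed.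
Lemma cycS f : cyc f = s2comp f mu nu. Proof. by rewrite cycU. Qed.
Lemma negS f : neg f = s2comp f (- lam) (- mu). Proof. by rewrite negU. Qed.
Lemma res0S f : res0 f = s2comp f lam 0. Proof. by rewrite res0U. Qed.
Lemma resdS f : resd f = s2comp f lam (- lam). Proof. by rewrite resdU. Qed.

Lemma swp_nu : swp nu = nu.
Proof. by rewrite nuU !swp_morphE swp_lam swp_mu addrC. Qed.
Lemma cyc_nu : cyc nu = lam.
Proof. by rewrite [in LHS]nuU !cyc_morphE cyc_lam cyc_mu nuU opprD !opprK addrC addrK. Qed.
Lemma neg_nu : neg nu = - nu.
Proof. by rewrite nuU !neg_morphE neg_lam neg_mu opprD. Qed.
Lemma res0_nu : res0 nu = - lam.
Proof. by rewrite nuU !res0_morphE res0_lam res0_mu subr0. Qed.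
Lemma resd_nu : resd nu = 0.
Proof. by rewrite nuU !resd_morphE resd_lam resd_mu subrr. Qed.

Definition formE := (swp_lam, swp_mu, cyc_lam, cyc_mu, neg_lam, neg_mu, res0_lam,
  res0_mu, resd_lam, resd_mu, swp_nu, cyc_nu, neg_nu, res0_nu, resd_nu).

Lemma swpK f : swp (swp f) = f.
Proof. by rewrite [swp f]swpS (swp_comp pmu plam) /= !formE s2comp_lam_mu. Qed.

Lemma negK f : neg (neg f) = f.
Proof.
by rewrite [neg f]negS (neg_comp plamN pmuN) /= !negN !formE !opprK s2comp_lam_mu.
Qed.

Lemma cyc2E f : cyc (cyc f) = s2comp f nu lam.
Proof. by rewrite [cyc f]cycS (cyc_comp pmu pnu) /= !formE. Qed.

Lemma cycK3 f : cyc (cyc (cyc f)) = f.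
Proof. by rewrite [cyc (cyc f)]cyc2E (cyc_comp pnu plam) /= !formE s2comp_lam_mu. Qed.

Lemma flipE f : s2comp f lam nu = swp (cyc f).
Proof. by rewrite cycS (swp_comp pmu pnu) /= !formE. Qed.

(** The dihedral relation of S_3. On symmetric f it turns the third term f(lambda, nu) of the
    equation into [cyc (cyc f)]. *)
Lemma swp_cyc f : swp (cyc f) = cyc (cyc (swp f)).
Proof.
by rewrite -flipE swpS (cyc_comp pmu plam) /= !formE (cyc_comp pnu pmu) /= !formE.
Qed.

(** The triple (lambda, mu, nu) becomes (lambda, 0, - lambda) on mu = 0 and (lambda, - lambda, 0) on
    nu = 0. This lemma, [res0_flip], [resd_cyc] and [resd_flip] therefore only involve f(lambda, 0),
    f(- lambda, 0) and f(lambda, - lambda). *)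
Lemma res0_cyc f : res0 (cyc (swp f)) = res0 (neg f).
Proof.
rewrite swpS (cyc_comp pmu plam) /= cyc_mu cyc_lam (res0_comp pnu pmu) negS.
by rewrite (res0_comp plamN pmuN) /= !res0N !formE oppr0.
Qed.

Lemma neg_cyc f : neg (cyc f) = cyc (neg f).
Proof.
by rewrite cycS (neg_comp pmu pnu) [neg f]negS (cyc_comp plamN pmuN) /= !cycN !formE.
Qed.

Lemma res0_flip f : res0 (swp (cyc f)) = resd f.
Proof. by rewrite -flipE (res0_comp plam pnu) /= !formE resdS. Qed.

Lemma resd_cyc f : resd (cyc f) = res0 (neg f).
Proof.
by rewrite cycS (resd_comp pmu pnu) [neg f]negS (res0_comp plamN pmuN) /= !res0N !formE oppr0.
Qed.

Lemma resd_flip f : resd (swp (cyc f)) = res0 f.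
Proof. by rewrite -flipE (resd_comp plam pnu) /= !formE res0S. Qed.

(** [s2tr], [s2dil] and [s2row] describe [swp], the dilations and [res0] on coefficients. They are
    made linear maps so that [filtered_ext] can identify them with the substitutions. *)
Definition s2tr f : series2 K := fun i j => f j i.
Definition s2dil (c : K) f : series2 K := fun i j => c ^+ (i + j) * f i j.
Definition s2row f : series2 K := fun i j => if j == 0%N then f i 0%N else 0.
Definition hcomp (d : nat) f : series2 K := fun i j => if (i + j == d)%N then f i j else 0.

Fact s2tr_linear : linear s2tr.
Proof. by move=> c f g; apply/s2P => i j; rewrite /s2tr !(s2coefD, s2coefZ). Qed.
Fact s2dil_linear c : linear (s2dil c).
Proof.
move=> d f g; apply/s2P => i j; rewrite s2coefD s2coefZ /s2dil !(s2coefD, s2coefZ).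
by rewrite mulrDr mulrCA.
Qed.
Fact s2row_linear : linear s2row.
Proof.
move=> c f g; apply/s2P => i j; rewrite s2coefD s2coefZ /s2row !(s2coefD, s2coefZ).
by case: ifP; rewrite ?mulr0 ?addr0.
Qed.
Fact hcomp_linear d : linear (hcomp d).
Proof.
move=> c f g; apply/s2P => i j; rewrite s2coefD s2coefZ /hcomp !(s2coefD, s2coefZ).
by case: ifP; rewrite ?mulr0 ?addr0.
Qed.
HB.instance Definition _ :=
  GRing.isLinear.Build K (series2 K) (series2 K) _ s2tr s2tr_linear.
HB.instance Definition _ c :=
  GRing.isLinear.Build K (series2 K) (series2 K) _ (s2dil c) (s2dil_linear c).
HB.instance Definition _ :=
  GRing.isLinear.Build K (series2 K) (series2 K) _ s2row s2row_linear.
HB.instance Definition _ d :=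
  GRing.isLinear.Build K (series2 K) (series2 K) _ (hcomp d) (hcomp_linear d).

Lemma hcomp_filtered d : filtered (hcomp d).
Proof. by move=> n f fn i j ij; rewrite /hcomp fn // if_same. Qed.

Lemma swpE f i j : swp f i j = f j i.
Proof.
suff -> : swp f = s2tr f by [].
move: f; apply: filtered_ext => /=.
- exact: swp_filtered.
- by move=> n f fn i' j' ij; apply: fn; rewrite addnC.
move=> k l; rewrite swpU subst_monom /= mulrC; apply/s2P => a b.
by rewrite s2coef_monom /s2tr s2coef_monom andbC.
Qed.

Definition pdil c x (x1 : ord 1 x) := mkmax (ordZ c x1).

(** Used with c = - 1 for [neg], and with c = 2 in [solution_row], where it produces the power of 2
    in front of the Bernoulli number. *)
Lemma dilE c f i j : subst (pdil c (@ord_lam K)) (pdil c (@ord_mu K)) f i j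
  = c ^+ (i + j) * f i j.
Proof.
suff -> : subst (pdil c (@ord_lam K)) (pdil c (@ord_mu K)) f = s2dil c f by [].
move: f; apply: filtered_ext => /=.
- exact: subst_filtered.
- by move=> n f fn i' j' ij; rewrite /s2dil fn ?mulr0.
move=> k l; rewrite subst_monom /= !exprZn -scalerAl -scalerAr scalerA -exprD.
apply/s2P => a b; rewrite s2coefZ /s2dil s2coef_monom.
by case: andP => [[/eqP-> /eqP->]|]; rewrite ?mulr0.
Qed.

Lemma negE f i j : neg f i j = (-1) ^+ (i + j) * f i j.
Proof. by rewrite -dilE negS /subst /= !scaleN1r. Qed.

Lemma neg_swp f : neg (swp f) = swp (neg f).
Proof. by apply/s2P => i j; rewrite negE !swpE negE addnC. Qed.

Lemma res0E f i j : res0 f i j = if j == 0%N then f i 0%N else 0.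
Proof.
suff -> : res0 f = s2row f by [].
move: f; apply: filtered_ext => /=.
- exact: res0_filtered.
- by move=> n f fn i' j' ij; rewrite /s2row fn ?if_same //; lia.
move=> k l; rewrite res0U subst_monom /=; apply/s2P => a b.
rewrite /s2row s2coef_monom; case: l => [|l].
  rewrite expr0 -[1](expr0 mu) s2coef_monom.
  by case: (a == k); case: (b == 0%N).
by rewrite exprS mul0r mulr0 s2coef0 andbF if_same.
Qed.

Definition hom (d : nat) f := forall i j, (i + j <> d)%N -> f i j = 0.

Lemma homM a b f g : hom a f -> hom b g -> hom (a + b) (f * g).
Proof.
move=> fa gb i j ij; rewrite s2coefM big1 // => k _; rewrite big1 // => l _.
have [kl|kl] := eqVneq (k + l)%N a; last by rewrite fa ?mul0r //; apply/eqP.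
by rewrite gb ?mulr0 //; have := ltn_ord k; have := ltn_ord l; lia.
Qed.
Lemma homD d f g : hom d f -> hom d g -> hom d (f + g).
Proof. by move=> fd gd i j ij; rewrite s2coefD fd ?gd ?addr0. Qed.
Lemma homN d f : hom d f -> hom d (- f).
Proof. by move=> fd i j ij; rewrite s2coefN fd ?oppr0. Qed.
Lemma homZ d c f : hom d f -> hom d (c *: f).
Proof. by move=> fd i j ij; rewrite s2coefZ fd ?mulr0. Qed.
Lemma hom1 : hom 0 1.
Proof. by move=> [|i] [|j] // []. Qed.
Lemma homX d n f : hom d f -> hom (n * d) (f ^+ n).
Proof.
move=> fd; elim: n => [|n IHn]; first exact: hom1.
by rewrite exprS mulSn; apply: homM.
Qed.
Lemma hom_lam : hom 1 lam. Proof. by case=> [|[|i]] [|j] // []. Qed.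
Lemma hom_mu : hom 1 mu. Proof. by case=> [|i] [|[|j]] // []. Qed.
Lemma hom_nu : hom 1 nu.
Proof. by rewrite nuU; apply: homD; apply: homN; [apply: hom_lam|apply: hom_mu]. Qed.

Lemma hom_ord d f : hom d f -> ord d f.
Proof. by move=> fd i j ij; apply: fd; lia. Qed.

Lemma hom_hcomp d f : hom d (hcomp d f).
Proof. by move=> i j /eqP/negbTE ij; rewrite /hcomp ij. Qed.

Lemma hcomp_hom d e f : hom d f -> hcomp e f = if d == e then f else 0.
Proof.
move=> fd; apply/s2P => i j; rewrite /hcomp.
have [<-|de] := eqVneq d e; first by case: eqP => // /fd ->.
case: eqP => // ije; apply: fd; rewrite ije; apply/eqP; by rewrite eq_sym.
Qed.

Lemma hcompM (a d : nat) f g : hom a f -> hcomp (a + d) (f * g) = f * hcomp d g.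
Proof.
move=> fa; apply/s2P => i j; rewrite /hcomp; case: eqP => [ij|ij]; last first.
  by rewrite (homM fa (@hom_hcomp d g)).
rewrite !s2coefM; apply: eq_bigr => k _; apply: eq_bigr => l _.
have [kl|kl] := eqVneq (k + l)%N a; last by rewrite fa ?mul0r //; apply/eqP.
suff -> : (i - k + (j - l) == d)%N by [].
by apply/eqP; have := ltn_ord k; have := ltn_ord l; lia.
Qed.

Lemma hcomp_subst d p q f : hom 1 (val p) -> hom 1 (val q) ->
  hcomp d (subst p q f) = subst p q (hcomp d f).
Proof.
move=> hp hq; move: f; apply: (@filtered_ext _
  [the {linear _ -> _} of hcomp d \o subst p q]
  [the {linear _ -> _} of subst p q \o hcomp d]) => /=.
- by move=> n f fn; apply/hcomp_filtered/subst_filtered.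
- by move=> n f fn; apply/subst_filtered/hcomp_filtered.
move=> k l; rewrite subst_monom.
have E x y : hom 1 x -> hom 1 y ->
    hcomp d (x ^+ k * y ^+ l) = if (k + l == d)%N then x ^+ k * y ^+ l else 0.
  move=> hx hy; apply: hcomp_hom.
  by have := homM (@homX 1 k x hx) (@homX 1 l y hy); rewrite !muln1.
rewrite (E _ _ hp hq) (E _ _ hom_lam hom_mu).
by rewrite (fun_if (subst p q)) subst_monom linear0.
Qed.

Lemma dvd_mu f : res0 f = 0 -> exists g, f = mu * g.
Proof.
move=> f0; exists (fun i j => f i j.+1); apply/s2P => i [|j].
  by have := congr1 (fun h : series2 K => h i 0%N) f0; rewrite res0E s2mul_mu0.
by rewrite s2mul_mu.
Qed.

(** The automorphism mu -> mu - lambda reduces the restriction to mu = - lambda to the one to mu =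
    0, where [dvd_mu] applies; [D] is the inverse automorphism. *)
Lemma dvd_lamD f : resd f = 0 -> exists g, f = (lam + mu) * g.
Proof.
move=> f0.
have o1 : ord 1 (mu - lam) by apply: ordB; [apply: ord_mu | apply: ord_lam].
pose C := subst plam (mkmax o1); pose D := subst plam (mkmax ord_lamD).
have [|g Cf] := @dvd_mu (C f).
  by rewrite res0U /C subst_comp /= rmorphB /= subst_lam subst_mu sub0r -resdS.
exists (D g); have : D (C f) = f.
  rewrite /D /C subst_comp /= rmorphB /= subst_mu subst_lam /= [lam + mu]addrC addrK.
  exact: s2comp_lam_mu.
by move=> <-; rewrite Cf /D rmorphM /= subst_mu.
Qed.

End LinearForms.

(** * Invariants of the symmetric group *)

Section Invariants.
Variable K : fieldType.
Hypothesis natf0 : forall n, (n%:R == 0 :> K) = (n == 0%N).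
Implicit Types (f g h x y Q U : series2 K) (n m k : nat) (b : nat -> nat -> K).

Local Notation lam := (lam K).
Local Notation mu := (mu K).
Local Notation nu := (nu K).
Local Notation omega2 := (omega2 K).

(** The transposition [swp] and the 3-cycle [cyc] generate S_3. *)
Definition S3inv f := swp f = f /\ cyc f = f.

Lemma S3invD f g : S3inv f -> S3inv g -> S3inv (f + g).
Proof. by move=> [fs fc] [gs gc]; split; rewrite ?swpD ?cycD ?fs ?fc ?gs ?gc. Qed.
Lemma S3invZ c f : S3inv f -> S3inv (c *: f).
Proof. by move=> [fs fc]; split; rewrite ?swpZ ?cycZ ?fs ?fc. Qed.
Lemma S3invM f g : S3inv f -> S3inv g -> S3inv (f * g).
Proof. by move=> [fs fc] [gs gc]; split; rewrite ?swpM ?cycM ?fs ?fc ?gs ?gc. Qed.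
Lemma S3invX n f : S3inv f -> S3inv (f ^+ n).
Proof. by move=> [fs fc]; split; rewrite ?swpX ?cycX ?fs ?fc. Qed.
Lemma S3inv0 : S3inv 0. Proof. by split; rewrite rmorph0. Qed.
Lemma S3inv_sum I (r : seq I) (P : pred I) (F : I -> series2 K) :
  (forall i, P i -> S3inv (F i)) -> S3inv (\sum_(i <- r | P i) F i).
Proof.
move=> Finv; elim/big_rec: _ => [|i x Pi]; first exact: S3inv0.
by apply: S3invD; apply: Finv.
Qed.
Lemma S3inv_s2sum (F : nat -> series2 K) :
  (forall n, ord n (F n)) -> (forall n, S3inv (F n)) -> S3inv (s2sum F).
Proof.
move=> Fo Finv; split; rewrite ?swp_s2sum ?cyc_s2sum //; apply: eq_s2sum => n.
  exact: (Finv n).1.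
exact: (Finv n).2.
Qed.

Lemma nuE : nu = - (lam + mu). Proof. by rewrite nuU opprD. Qed.

Definition lmn := lam * mu * nu.

Lemma lmn_neq0 : lmn <> 0.
Proof.
apply: s2_mulf_neq0; last exact: nu_neq0.
by apply: s2_mulf_neq0; [apply: lam_neq0 | apply: mu_neq0].
Qed.

Lemma S3inv_lmn : S3inv lmn.
Proof. by rewrite /lmn; split; rewrite ?(swpM, cycM) !formE; ring. Qed.

Lemma neg_lmn : neg lmn = - lmn.
Proof. by rewrite /lmn !negM !formE; ring. Qed.

Lemma res0_lmn : res0 lmn = 0.
Proof. by rewrite /lmn !res0M !formE; ring. Qed.

Lemma omega2E : omega2 = lam ^+ 2 + lam * mu + mu ^+ 2. Proof. by []. Qed.

Lemma S3inv_omega2 : S3inv omega2.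
Proof.
rewrite omega2E; split; rewrite ?swp_morphE ?cyc_morphE !formE.
  by ring.
by rewrite nuE; ring.
Qed.

Lemma neg_omega2 : neg omega2 = omega2.
Proof. by rewrite omega2E !neg_morphE !formE; ring. Qed.

Lemma res0_omega2 : res0 omega2 = lam ^+ 2.
Proof. by rewrite omega2E !res0_morphE !formE; ring. Qed.

Lemma hom_lmn : hom 3 lmn.
Proof.
apply: (@homM _ 2 1); last exact: hom_nu.
by apply: (@homM _ 1 1); [apply: hom_lam | apply: hom_mu].
Qed.

Lemma hom_omega2 : hom 2 omega2.
Proof.
rewrite omega2E; apply: homD; first apply: homD.
- by apply: (@homM _ 1 1); apply: hom_lam.
- by apply: (@homM _ 1 1); [apply: hom_lam | apply: hom_mu].
- by apply: (@homM _ 1 1); apply: hom_mu.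
Qed.

(** The summand of [h_poly]. For 3 k <= n it is homogeneous of degree 2 n, and [stermE] shows it to
    be a monomial in (lambda mu nu)^2 and omega^2. *)
Definition sterm n k : series2 K :=
  lam ^+ (2 * k) * mu ^+ (2 * k) * (lam + mu) ^+ (2 * k) * omega2 ^+ (n - 3 * k).

Lemma stermE n k : sterm n k = lmn ^+ (2 * k) * omega2 ^+ (n - 3 * k).
Proof.
by rewrite /sterm /lmn nuE !exprMn exprNn !exprM sqrrN expr1n expr1n mul1r.
Qed.

Lemma S3inv_sterm n k : S3inv (sterm n k).
Proof.
rewrite stermE; apply: S3invM; apply: S3invX; first exact: S3inv_lmn.
exact: S3inv_omega2.
Qed.

Lemma neg_sterm n k : neg (sterm n k) = sterm n k.
Proof.
by rewrite stermE negM !negX neg_lmn neg_omega2 exprM sqrrN -exprM.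
Qed.

Lemma sterm_ord n k : (3 * k <= n)%N -> ord n (sterm n k).
Proof.
move=> kn; rewrite stermE; apply: (@ordW _ n (2 * k * 3 + (n - 3 * k) * 2)); first by lia.
apply/hom_ord; apply: homM; apply: homX; [apply: hom_lmn | apply: hom_omega2].
Qed.

Lemma sterm0 n : sterm n 0 = omega2 ^+ n.
Proof. by rewrite stermE !muln0 subn0 expr0 mul1r. Qed.

Lemma res0_sterm n k : res0 (sterm n k.+1) = 0.
Proof. by rewrite stermE res0M res0X res0_lmn mulnS exprD expr2 !mul0r. Qed.

Lemma stermS n k : sterm n.+3 k.+1 = lmn ^+ 2 * sterm n k.
Proof. by rewrite !stermE mulnS exprD -mulrA; congr (_ * (_ * _ ^+ _)); lia. Qed.

(** After mu is split off, symmetry says that lambda times the swapped cofactor vanishes at mu = 0;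
    cancelling lambda, the cofactor itself is divisible by lambda. *)
Lemma dvd_lam_mu f : swp f = f -> res0 f = 0 -> exists g, f = lam * mu * g.
Proof.
move=> fs f0; have [g fg] := dvd_mu f0.
have [|h gh] := @dvd_mu K (swp g).
  have : res0 (swp f) = 0 by rewrite fs.
  rewrite fg !swpM res0M !formE; exact: s2_mul0I (@lam_neq0 K).
by exists (swp h); rewrite fg -[g]swpK gh swpM !formE; ring.
Qed.

(** Symmetry gives the factor lambda mu. On the line nu = 0, cyclic invariance turns f into f(-
    lambda, 0), and parity brings this back to f(lambda, 0) = 0, which gives the factor nu. *)
Lemma dvd_lmn f : S3inv f -> res0 f = 0 -> neg f = f \/ neg f = - f ->
  exists2 g, f = lmn * g & S3inv g.
Proof.
move=> [fs fc] f0 fn; have [g fg] := dvd_lam_mu fs f0.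
have [|h gh] := @dvd_lamD K g.
  have : resd (cyc f) = 0 by rewrite resd_cyc; case: fn => ->; rewrite ?res0N f0 ?oppr0.
  have ll := s2_mulf_neq0 (@lam_neq0 K) (@lam_neq0 K).
  rewrite fc fg !resdM !formE mulrN mulNr => /eqP; rewrite oppr_eq0 => /eqP.
  exact: s2_mul0I ll.
have flh : f = lmn * (- h) by rewrite fg gh /lmn nuE; ring.
exists (- h) => //; split; apply: (s2_mulI lmn_neq0).
  by rewrite -[RHS]flh -[RHS]fs [in RHS]flh swpM S3inv_lmn.1.
by rewrite -[RHS]flh -[RHS]fc [in RHS]flh cycM S3inv_lmn.2.
Qed.

(** Invariance makes f(lambda, - lambda) equal both to f(lambda, 0) and to f(- lambda, 0); the
    latter is - f(lambda, 0) by oddness, and 2 is invertible. *)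
Lemma S3inv_odd_res0 f : S3inv f -> neg f = - f -> res0 f = 0.
Proof.
move=> [fs fc] fn; have := res0_flip f; rewrite fc fs -{2}fc resd_cyc fn res0N.
move=> /eqP; rewrite -addr_eq0 -mulr2n -scaler_nat scaler_eq0 natf0 /=.
by move=> /eqP.
Qed.

Lemma coef_lamX n i j : (lam ^+ n) i j = ((i == n) && (j == 0%N))%:R.
Proof. by rewrite -[lam ^+ n]mulr1 -(expr0 mu) s2coef_monom. Qed.

Lemma neg_hom n f : hom (2 * n) f -> neg f = f.
Proof.
move=> fh; apply/s2P => i j; rewrite negE.
have [->|/eqP ij] := eqVneq (i + j)%N (2 * n)%N; last by rewrite fh ?mulr0.
by rewrite exprM sqrrN expr1n expr1n mul1r.
Qed.

Lemma S3inv_hcomp d f : S3inv f -> S3inv (hcomp d f).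
Proof.
move=> [fs fc]; split; [rewrite -[in RHS]fs | rewrite -[in RHS]fc];
  by rewrite ?swpU ?cycU [RHS]hcomp_subst //; [apply: hom_mu | apply: hom_lam || apply: hom_nu].
Qed.

(** Since omega^2 restricts to lambda^2 at mu = 0, subtracting a multiple of omega^(2n) makes Q
    vanish there. The remainder is then [lmn] times an odd invariant, which vanishes at mu = 0 again
    and yields a second factor [lmn]. The cofactor of [lmn ^+ 2] has degree smaller by 6, that is, n
    drops by 3. *)
Lemma S3inv_hom n Q : hom (2 * n) Q -> S3inv Q ->
  exists c : nat -> K, Q = \sum_(k < (n %/ 3).+1) c k *: sterm n k.
Proof.
elim/ltn_ind: n Q => n IHn Q Qh Qinv; pose R := Q - Q (2 * n)%N 0%N *: omega2 ^+ n.
have Rh : hom (2 * n) R.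
  apply: homD => //; apply/homN/homZ; rewrite mulnC; apply: homX; exact: hom_omega2.
have Rinv : S3inv R.
  rewrite /R -scaleNr; apply: S3invD => //; apply/S3invZ/S3invX/S3inv_omega2.
have Rneg : neg R = R by apply: neg_hom Rh.
have R0 : res0 R = 0.
  apply/s2P => i j; rewrite res0E; case: eqP => // _.
  have [->|/eqP ij] := eqVneq i (2 * n)%N; last by rewrite Rh // addn0.
  rewrite /R s2coefB s2coefZ.
  have -> : (omega2 ^+ n) (2 * n)%N 0%N = 1; last by rewrite mulr1 subrr.
  transitivity (res0 (omega2 ^+ n) (2 * n)%N 0%N); first by rewrite res0E.
  by rewrite res0X res0_omega2 -exprM coef_lamX !eqxx.
have QR : Q = Q (2 * n)%N 0%N *: sterm n 0 + R by rewrite sterm0 /R addrC subrK.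
have [R1 RR1 R1inv] := dvd_lmn Rinv R0 (or_introl Rneg).
have R1neg : neg R1 = - R1.
  apply: (s2_mulI lmn_neq0); rewrite mulrN -RR1 -[in RHS]Rneg RR1 negM neg_lmn.
  by rewrite mulNr opprK.
have [R2 R1R2 R2inv] := dvd_lmn R1inv (S3inv_odd_res0 R1inv R1neg) (or_intror R1neg).
have RR2 : R = lmn ^+ 2 * R2 by rewrite RR1 R1R2 expr2 mulrA.
have lmn2 : hom 6 (lmn ^+ 2) by apply: (@homX K 3 2); apply: hom_lmn.
(* For n < 3 the degree is below 6, so a multiple of [lmn ^+ 2] must be 0. *)
have [n3|n3] := ltnP n 3.
  exists (fun _ => Q (2 * n)%N 0%N); rewrite divn_small // big_ord1 {1}QR.
  rewrite [R](_ : _ = 0) ?addr0 //; apply/s2P => i j.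
  have [ij|/eqP ij] := eqVneq (i + j)%N (2 * n)%N; last by rewrite Rh.
  have R6 : ord 6 R by rewrite RR2; apply/ordMr/hom_ord.
  by rewrite R6 //; lia.
(* The cofactor [R2] comes from a divisibility lemma for arbitrary series; only its component of
   degree 2 (n - 3) contributes to the homogeneous R. *)
have RR3 : R = lmn ^+ 2 * hcomp (2 * (n - 3)) R2.
  rewrite -(hcompM _ _ lmn2) -RR2; have -> : (6 + 2 * (n - 3) = 2 * n)%N by lia.
  by rewrite (hcomp_hom _ Rh) eqxx.
have n3n : (n - 3 < n)%N by lia.
have [c cE] := IHn _ n3n _ (@hom_hcomp K _ R2) (S3inv_hcomp _ R2inv).
exists (fun k => if k is k'.+1 then c k' else Q (2 * n)%N 0%N).
have -> : (n %/ 3 = ((n - 3) %/ 3).+1)%N by rewrite -{1}(subnK n3) divnDr ?divnn ?addn1.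
rewrite big_ord_recl {1}QR; congr (_ + _).
rewrite RR3 cE mulr_sumr; apply: eq_bigr => k _ /=.
by rewrite -scalerAr -stermS /bump /= add1n; congr (_ *: sterm _ _); lia.
Qed.

Lemma h_polyE b n : h_poly b n = \sum_(1 <= k < (n %/ 3).+1) b n k *: sterm n k.
Proof. by []. Qed.

Lemma h_poly_ord b n : ord n (h_poly b n).
Proof.
rewrite h_polyE big_nat; apply: ord_sum => k /andP[_ kn].
apply/ordZ/sterm_ord; have := leq_trunc_div n 3.
by move: kn; rewrite ltnS => kn; lia.
Qed.

Lemma h_poly3_ord b n : ord n (h_poly b n.+3).
Proof. by apply: (@ordW _ _ n.+3); [lia | apply: h_poly_ord]. Qed.

Lemma omega2X_ord (c : K) n : ord n (c *: omega2 ^+ n).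
Proof.
by rewrite -sterm0; apply/ordZ/sterm_ord.
Qed.

(** The general even invariant: the last factor of the formula for Odd f and, with the entries
    [b n 0] prescribed, also that of the formula for Even f. *)
Definition param b : series2 K :=
  s2sum (fun n => b n 0%N *: omega2 ^+ n) + s2sum (fun n => h_poly b n.+3).

Lemma S3inv_h_poly b n : S3inv (h_poly b n).
Proof. by apply: S3inv_sum => k _; apply/S3invZ/S3inv_sterm. Qed.

Lemma neg_h_poly b n : neg (h_poly b n) = h_poly b n.
Proof.
by rewrite h_polyE linear_sum; apply: eq_bigr => k _ /=; rewrite negZ neg_sterm.
Qed.

Lemma res0_h_poly b n : res0 (h_poly b n) = 0.
Proof.
rewrite h_polyE linear_sum big_nat big1 //= => -[//|k] _.
by rewrite res0Z res0_sterm scaler0.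
Qed.

Lemma S3inv_param b : S3inv (param b).
Proof.
apply: S3invD; apply: S3inv_s2sum => n; first exact: omega2X_ord.
- exact/S3invZ/S3invX/S3inv_omega2.
- exact: h_poly3_ord.
- exact: S3inv_h_poly.
Qed.

Lemma neg_param b : neg (param b) = param b.
Proof.
rewrite negD; congr (_ + _); rewrite neg_s2sum.
- by apply: eq_s2sum => n; rewrite negZ negX neg_omega2.
- by move=> n; apply: omega2X_ord.
- by apply: eq_s2sum => n; apply: neg_h_poly.
- by move=> n; apply: h_poly3_ord.
Qed.

(** Every term with k >= 1 has a factor mu, so the restriction to mu = 0 records exactly the
    coefficients of the pure powers of omega^2. *)
Lemma res0_param b : res0 (param b) = s2sum (fun n => b n 0%N *: lam ^+ (2 * n)).
Proof.
rewrite res0D -[RHS]addr0; congr (_ + _); rewrite res0_s2sum.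
- by apply: eq_s2sum => n; rewrite res0Z res0X res0_omega2 exprM.
- by move=> n; apply: omega2X_ord.
- by apply/s2P => i j; rewrite /s2sum big1 // => n _; rewrite res0_h_poly.
- by move=> n; apply: h_poly3_ord.
Qed.

Lemma S3inv_expand Q : S3inv Q -> neg Q = Q -> exists b, Q = param b.
Proof.
move=> Qinv Qneg.
have /choice[b bE] n : exists c : nat -> K,
    hcomp (2 * n) Q = \sum_(k < (n %/ 3).+1) c k *: sterm n k.
  by apply: S3inv_hom; [apply: hom_hcomp | apply: S3inv_hcomp].
exists b.
(* Evenness under [neg] kills the components of odd degree. *)
have Qeven : Q = s2sum (fun n => hcomp (2 * n) Q).
  apply/s2P => i j; rewrite /s2sum /hcomp.
  have [odd_ij|even_ij] := boolP (odd (i + j)).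
    have : neg Q i j = Q i j by rewrite Qneg.
    rewrite negE -signr_odd odd_ij expr1 mulN1r => /eqP.
    rewrite eq_sym -addr_eq0 -mulr2n -mulr_natr mulf_eq0 natf0 orbF.
    by move=> /eqP->; rewrite big1 // => n _; rewrite if_same.
  have ij2 : ((i + j) %/ 2 < (i + j).+1)%N by rewrite ltnS leq_div.
  have e : (2 * ((i + j) %/ 2) = i + j)%N by rewrite mulnC divnK // dvdn2.
  rewrite (bigD1 (Ordinal ij2)) //= e eqxx big1 ?addr0 // => n /eqP nij.
  case: eqP => // ijn; case: nij; apply: val_inj => /=; lia.
(* For n < 3 the sum [h_poly b n] is empty, so the sum over n >= 3 in [param] may start at 0. *)
have -> : param b = s2sum (fun n => b n 0%N *: omega2 ^+ n) + s2sum (h_poly b).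
  have ho m n : ord n (h_poly b (m + n)).
    by apply: (@ordW _ _ (m + n)); [lia | apply: h_poly_ord].
  congr (_ + _); rewrite (@s2sum_recl _ (h_poly b)); last exact: (ho 0%N).
  rewrite (@s2sum_recl _ (fun n => h_poly b n.+1)); last exact: (ho 1%N).
  rewrite (@s2sum_recl _ (fun n => h_poly b n.+2)); last exact: (ho 2%N).
  have h0 m : (m < 3)%N -> h_poly b m = 0 by move=> m3; rewrite h_polyE big_geq // divn_small.
  by rewrite !h0 // !add0r.
rewrite [LHS]Qeven -s2sumD; apply: eq_s2sum => n.
rewrite bE h_polyE -(big_mkord xpredT (fun k => b n k *: sterm n k)).
by rewrite big_ltn // sterm0.
Qed.

End Invariants.

(** * Solutions of the equation *)

Section Reformulation.
Variable K : fieldType.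
Hypothesis natf0 : forall n, (n%:R == 0 :> K) = (n == 0%N).
Implicit Types (f g h x y Q U : series2 K) (n m k : nat) (b : nat -> nat -> K).

Local Notation lam := (lam K).
Local Notation mu := (mu K).
Local Notation nu := (nu K).

Lemma EvenE f : Even f = 2^-1 *: (f + neg f). Proof. by rewrite negS. Qed.
Lemma OddE f : Odd f = 2^-1 *: (f - neg f). Proof. by rewrite negS. Qed.

Lemma f_equationE f : f_equation f
  = (f + s2exp mu * cyc f + s2exp (- lam) * swp (cyc f)
     = s2div (s2div (s2exp mu - 1) mu + s2div (s2exp (- lam) - 1) lam) (lam + mu)).
Proof. by rewrite -flipE cycS nuU. Qed.

Lemma coef_lam_even (c : nat -> K) i j :
  s2sum (fun n => c n *: lam ^+ (2 * n)) i j
  = if ~~ odd i && (j == 0%N) then c i./2 else 0.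
Proof.
rewrite /s2sum; under eq_bigr => n _ do rewrite s2coefZ coef_lamX.
case: ifP => [/andP[ei /eqP->]|ij].
  have i2 : (i./2 < (i + 0).+1)%N by lia.
  rewrite (bigD1 (Ordinal i2)) //= big1 => [|n /eqP ni].
    have -> : (i == 2 * i./2)%N by lia.
    by rewrite mulr1 addr0.
  case: eqP => [ein|]; last by rewrite mulr0.
  by case: ni; apply: val_inj => /=; lia.
apply: big1 => n _; case: andP => [[/eqP ei /eqP ej]|]; last by rewrite mulr0.
by move: ij => /negbT/negP[]; lia.
Qed.

Lemma even_lamE f : res0 f = f -> neg f = f ->
  s2sum (fun n => f n.*2 0%N *: lam ^+ (2 * n)) = f.
Proof.
move=> f0 fn; apply/s2P => i j; rewrite coef_lam_even -[f in RHS]f0 res0E andbC.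
case: eqP => //= _; have [oi|ei] := boolP (odd i); last first.
  by rewrite /= even_halfK.
have : neg f i 0%N = f i 0%N by rewrite fn.
rewrite negE addn0 -signr_odd oi expr1 mulN1r => /eqP.
by rewrite eq_sym -addr_eq0 -mulr2n -mulr_natr mulf_eq0 natf0 orbF => /eqP->.
Qed.

(** At mu = 0 one has omega^2 = lambda^2, and the series becomes 2 lambda / (e^lambda -
    e^(-lambda)), while [Shq lam] is (e^lambda - e^(-lambda)) / lambda. *)
Lemma res0_omega_over_sinh : Shq lam * res0 (omega_over_sinh K) = 2%:R.
Proof.
(* The inverse [u] of [Shq lam] inherits independence of mu and evenness by cancellation, so
   [even_lamE] recovers it from its coefficients at (2n, 0). *)
have [u uE] := Shq_inv natf0 lam.
have uK := s2_mulI (@Shq_neq0 K natf0 lam).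
have uE' : Shq lam * u = 1 by rewrite mulrC.
have ol := @ord_lam K.
have u0 : res0 u = u.
  have := congr1 (@res0 K) uE'; rewrite res0M (rmorph1 (@res0 K)) res0_Shq // res0_lam -uE'.
  exact: uK.
have un : neg u = u.
  have := congr1 (@neg K) uE'; rewrite negM (rmorph1 (@neg K)) neg_Shq // neg_lam ShqN -uE'.
  exact: uK.
have divE : s2div (2 *: lam) (s2exp lam - s2exp (- lam)) = 2 *: u.
  apply: s2divE; rewrite -ShU; first by apply: Sh_neq0 => //; apply: lam_neq0.
  by rewrite (ShE ol) -scalerAl mulrCA uE mulr1.
have -> : res0 (omega_over_sinh K) = 2 *: u.
  rewrite /omega_over_sinh divE res0_s2sum => [|n]; last exact: omega2X_ord.
  rewrite -[RHS](@even_lamE (2 *: u)); [|by rewrite res0Z u0|by rewrite negZ un].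
  by apply: eq_s2sum => n; rewrite res0Z res0X res0_omega2 exprM.
by rewrite -scalerAr uE' scaler_nat.
Qed.

Lemma res0_param_inj b (c : nat -> K) :
  res0 (param b) = s2sum (fun n => c n *: lam ^+ (2 * n)) -> forall n, b n 0%N = c n.
Proof.
rewrite res0_param => e n.
have := congr1 (fun f : series2 K => f n.*2 0%N) e.
by rewrite !coef_lam_even odd_double doubleK.
Qed.

End Reformulation.

(* On series, [ring] is fast only when its atoms are variables. *)
Ltac ring_gen :=
  repeat match goal with
  | |- context [s2exp ?x] => move: (s2exp x) => ?
  | |- context [Sh ?x] => generalize (Sh x) => ?
  | |- context [Shq ?x] => generalize (Shq x) => ?
  | |- context [expq ?x] => generalize (expq x) => ?
  | |- context [swp ?x] => generalize (swp x) => ?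
  | |- context [cyc ?x] => generalize (cyc x) => ?
  | |- context [neg ?x] => generalize (neg x) => ?
  | |- context [lam ?x] => generalize (lam x) => ?
  | |- context [mu ?x] => generalize (mu x) => ?
  | |- context [nu ?x] => generalize (nu x) => ?
  end; ring.

(** * The homogeneous relation and the right-hand side *)

Section Equation.
Variable K : fieldType.
Hypothesis natf0 : forall n, (n%:R == 0 :> K) = (n == 0%N).
Implicit Types (f g h x y Q U : series2 K) (n m k : nat) (b : nat -> nat -> K).

Local Notation lam := (lam K).
Local Notation mu := (mu K).
Local Notation nu := (nu K).
Let ol : ord 1 lam := @ord_lam K.
Let om : ord 1 mu := @ord_mu K.
Let on : ord 1 nu := @ord_nu K.
Let olN : ord 1 (- lam) := @ord_lamN K.
Let omN : ord 1 (- mu) := @ord_muN K.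
Let olm : ord 1 (lam + mu) := @ord_lamD K.
Hint Resolve ol om on olN omN olm : core.

(** With [cyc (cyc f)] as third term this is a twisted sum over a cyclic orbit, meaningful also for
    series other than f; [f_equationP] compares it with the equation on symmetric f. *)
Definition hexsum f := f + s2exp mu * cyc f + s2exp (- lam) * cyc (cyc f).

Lemma hexsumD f g : hexsum (f + g) = hexsum f + hexsum g.
Proof. by rewrite /hexsum !cycD; ring_gen. Qed.
Lemma hexsumN f : hexsum (- f) = - hexsum f.
Proof. by rewrite /hexsum !cycN; ring_gen. Qed.
Lemma hexsumZ c f : hexsum (c *: f) = c *: hexsum f.
Proof.
rewrite /hexsum !cycZ; move: (s2exp _) (s2exp _) (cyc (cyc f)) (cyc f) => *.
by rewrite -!scalerAr -!scalerDr.
Qed.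

(** (lambda, mu) -> (- mu, - lambda) exchanges the weights e^mu and e^(-lambda), and symmetry of f
    makes it exchange the two weighted terms up to [neg]. *)
Lemma neg_swp_hexsum f : swp f = f -> neg (swp (hexsum f)) = hexsum (neg f).
Proof.
move=> fs; have cs : swp (cyc f) = cyc (cyc f) by rewrite swp_cyc fs.
have ccs : swp (cyc (cyc f)) = cyc f by rewrite -cs swpK.
rewrite /hexsum -!neg_cyc !swp_morphE fs cs ccs !swp_exp // swpN !formE.
rewrite !neg_morphE !neg_exp // negN !formE opprK. by ring_gen.
Qed.

(** 2 sinh(nu) is a solution of the homogeneous relation, its cyclic images being 2 sinh(lambda) and
    2 sinh(mu). A cyclically invariant factor Q then comes out of the sum in [hexsum_Sh]. *)
Lemma Sh_sum : Sh nu + s2exp mu * Sh lam + s2exp (- lam) * Sh mu = 0.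
Proof. rewrite !ShU nuE opprK opprD !s2expD //; ring_gen. Qed.

Lemma Sh_lamD : Sh (lam + mu) = - Sh nu.
Proof. by rewrite nuE ShN opprK. Qed.

Lemma hexsum_Sh Q : S3inv Q -> hexsum (Sh (lam + mu) * Q) = 0.
Proof.
move=> [Qs Qc]; rewrite Sh_lamD /hexsum mulNr !cyc_morphE !Qc.
rewrite (cyc_Sh on) !formE (cyc_Sh ol) !formE.
by rewrite -(mulr0 (- Q)) -Sh_sum; move: Q {Qs Qc} => *; ring_gen.
Qed.

Lemma hexsum0_Sh U : swp U = U -> neg U = - U -> hexsum U = 0 ->
  exists2 Q, U = Sh (lam + mu) * Q & S3inv Q /\ neg Q = Q.
Proof.
move=> Us Un HU.
have HU' : U + s2exp (- mu) * cyc U + s2exp lam * cyc (cyc U) = 0.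
  have := congr1 (@neg K) HU; rewrite (rmorph0 (@neg K)) /hexsum !neg_morphE.
  rewrite (neg_exp om) (neg_exp olN) negN neg_lam neg_mu opprK !neg_cyc Un !cycN => E.
  by apply: oppr_inj; rewrite oppr0 -E; ring_gen.
(* The difference of [HU] and [HU'] loses the term U, and the weights become e^mu - e^(-mu) and
   e^(-lambda) - e^lambda. *)
have E1 : Sh mu * cyc U = Sh lam * cyc (cyc U).
  apply/eqP; rewrite -subr_eq0; apply/eqP.
  transitivity (hexsum U - (U + s2exp (- mu) * cyc U + s2exp lam * cyc (cyc U))).
    by rewrite /hexsum !ShU; ring_gen.
  by rewrite HU HU' subrr.
have E2 : Sh nu * cyc (cyc U) = Sh mu * U.
  by have := congr1 (@cyc K) E1; rewrite !cycM (cyc_Sh om) (cyc_Sh ol) cycK3 cyc_mu cyc_lam.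
(* On the line nu = 0 the left side of [E2] vanishes while sinh(mu) = sinh(- lambda) does not; hence
   U vanishes there and has the factor lambda + mu. The cofactor of lambda + mu in its hyperbolic
   sine is a unit. *)
have Ud : resd U = 0.
  have := congr1 (@resd K) E2; rewrite !ShE // !resdM resd_nu !mul0r.
  rewrite resd_Shq // resd_mu => /esym; apply: s2_mul0I.
  apply: s2_mulf_neq0; last exact: Shq_neq0.
  by move=> /eqP; rewrite oppr_eq0 => /eqP; apply: lam_neq0.
have [g Ug] := dvd_lamD Ud; have [u uE] := Shq_inv natf0 (lam + mu).
have Sn0 : Sh (lam + mu) <> 0 by apply: Sh_neq0 => //; apply: lamD_neq0.
have UQ : U = Sh (lam + mu) * (u * g).
  rewrite ShE // -mulrA [Shq _ * _]mulrA [Shq _ * _]mulrC uE mul1r; exact: Ug.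
exists (u * g) => //; move: (u * g) UQ => Q UQ.
(* Substituting U = [Sh (lam + mu) * Q] into [E2] puts the same factor sinh(nu) sinh(mu) on both
   sides. *)
have Qc2 : cyc (cyc Q) = Q.
  have n0 : Sh nu * Sh mu <> 0.
    by apply: s2_mulf_neq0; apply: Sh_neq0 => //; [apply: nu_neq0 | apply: mu_neq0].
  apply: (s2_mulI n0); apply: oppr_inj.
  have ccU : cyc (cyc U) = - (Sh mu * cyc (cyc Q)).
    by rewrite UQ Sh_lamD mulNr !cyc_morphE (cyc_Sh on) !formE (cyc_Sh ol) !formE.
  move: E2; rewrite ccU {1}UQ Sh_lamD => E.
  transitivity (Sh nu * (- (Sh mu * cyc (cyc Q)))); first by ring_gen.
  by rewrite E; move: Q {UQ ccU E} => Q; ring_gen.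
split; first split.
- have SS : swp (Sh (lam + mu)) = Sh (lam + mu).
    by rewrite (swp_Sh olm) swpD swp_lam swp_mu addrC.
  by apply: (s2_mulI Sn0); move: Us; rewrite UQ swpM SS.
- by rewrite -{1}Qc2 cycK3.
have SN : neg (Sh (lam + mu)) = - Sh (lam + mu).
  by rewrite (neg_Sh olm) negD neg_lam neg_mu -opprD ShN.
by apply: (s2_mulI Sn0); apply: oppr_inj; move: Un; rewrite UQ negM SN mulNr.
Qed.

(** With g(x) = (e^x - 1) / x this is the divided difference (g(mu) - g(- lambda)) / (mu + lambda),
    expanded power by power. It is an explicit value for the nested quotients of [f_equation], and
    it can be restricted to mu = - lambda. *)
Definition hexrhs : series2 K := s2sum (fun n =>
  (n.+2`!%:R)^-1 *: \sum_(i < n.+1) mu ^+ (n.+1.-1 - i) * (- lam) ^+ i).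

Lemma hexrhs_ord n :
  ord n ((n.+2`!%:R)^-1 *: (\sum_(i < n.+1) mu ^+ (n.+1.-1 - i) * (- lam) ^+ i)).
Proof.
apply/ordZ/ord_sum => i _; have ni : (i <= n)%N by rewrite -ltnS.
by rewrite -{1}(subnK ni); apply: ordM; apply: ordX.
Qed.

Lemma hexrhsE : (lam + mu) * hexrhs = expq mu - expq (- lam).
Proof.
rewrite /expq -s2sumB s2sum_recl => [|n]; last by apply: ordB; apply: ordZX.
rewrite !expr0 subrr add0r -s2sumMl; last exact: hexrhs_ord.
by apply: eq_s2sum => n; rewrite -scalerBr -scalerAr subrXX opprK [mu + lam]addrC.
Qed.

Lemma f_equationP f : swp f = f -> f_equation f <-> hexsum f = hexrhs.
Proof.
move=> fs; rewrite f_equationE.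
have -> : s2div (s2exp mu - 1) mu = expq mu.
  by apply: s2divE; [apply: mu_neq0 | rewrite s2expE // addrC addKr mulrC].
have -> : s2div (s2exp (- lam) - 1) lam = - expq (- lam).
  apply: s2divE; first exact: lam_neq0.
  by rewrite s2expE // addrC addKr mulrC mulNr mulrN.
rewrite -hexrhsE (s2divE (@lamD_neq0 K) (mulrC _ _)).
by rewrite swp_cyc fs.
Qed.

(** A divided difference is symmetric in its two arguments, and mu and - lambda are the ones
    exchanged here. *)
Lemma neg_swp_hexrhs : neg (swp hexrhs) = hexrhs.
Proof.
apply: (s2_mulI (@lamD_neq0 K)); apply: oppr_inj.
have := congr1 (fun x => neg (swp x)) hexrhsE.
rewrite /= !swpM !swpD !swpN (swp_expq om) (swp_expq olN) swpN swp_lam swp_mu.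
rewrite !negM !negD !negN (neg_expq ol) (neg_expq omN) negN neg_lam neg_mu opprK.
rewrite hexrhsE opprB => <-; by ring_gen.
Qed.

End Equation.

(* Used with A = e^l, a = e^(-l), q1 = (a - 1) / (- l), s = f(l, 0) + f(- l, 0),
   t = f(l, - l) and D = 2l / (e^(2l) - 1). *)
Lemma row_identity (R : comNzRingType) (l A a s t q1 q2 D : R) :
  s + a * t = q2 -> t + a * s = q1 - q2 -> q1 = 1 - l * q2 -> a = 1 - l * q1 ->
  A * a = 1 -> D * (A ^+ 2 - 1) = l + l ->
  (1 - a ^+ 2) * (l ^+ 2 * s) = (1 - a ^+ 2) * (D + l - 1).
Proof.
move=> e1 e2 e3 e4 aA DE.
(* Elimination of t: the first equation minus a times the second. *)
have -> : (1 - a ^+ 2) * (l ^+ 2 * s)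
  = l ^+ 2 * (s + a * t) - a * l ^+ 2 * (t + a * s) by ring.
have -> : (1 - a ^+ 2) * (D + l - 1)
  = a ^+ 2 * (D * (A ^+ 2 - 1)) + (1 - (A * a) ^+ 2) * D + (1 - a ^+ 2) * (l - 1).
  by ring.
have lq2 : l * q2 = 1 - q1 by rewrite [in RHS]e3; ring.
have lq1 : l * q1 = 1 - a by rewrite [in RHS]e4; ring.
rewrite e1 e2 DE aA.
have -> : l ^+ 2 * q2 - a * l ^+ 2 * (q1 - q2)
  = (1 + a) * l * (l * q2) - a * l * (l * q1) by ring.
rewrite lq2 lq1.
have -> : (1 + a) * l * (1 - q1) = (1 + a) * (l - l * q1) by ring.
by rewrite lq1; ring.
Qed.

(** * Parametrisation of the solutions and the coefficients at mu = 0 *)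

Section Solutions.
Variable K : fieldType.
Hypothesis natf0 : forall n, (n%:R == 0 :> K) = (n == 0%N).
Implicit Types (f g h x y Q U : series2 K) (n m k : nat) (b : nat -> nat -> K).

Local Notation lam := (lam K).
Local Notation mu := (mu K).
Local Notation nu := (nu K).
Let ol : ord 1 lam := @ord_lam K.
Let om : ord 1 mu := @ord_mu K.
Let on : ord 1 nu := @ord_nu K.
Let olN : ord 1 (- lam) := @ord_lamN K.
Let omN : ord 1 (- mu) := @ord_muN K.
Let olm : ord 1 (lam + mu) := @ord_lamD K.
Hint Resolve ol om on olN omN olm : core.

Let two_neq0 : (2 : K) != 0. Proof. by rewrite natf0. Qed.

Lemma half_double f : 2^-1 *: (f + f) = f.
Proof. by rewrite -mulr2n -scaler_nat scalerA mulVf // scale1r. Qed.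

Lemma Even_Odd f : f = Even f + Odd f.
Proof.
rewrite EvenE OddE -scalerDr -[LHS]half_double; congr (_ *: _).
by move: (neg f) => g; ring.
Qed.

Lemma EvenP f g : neg f = f -> neg g = - g -> Even (f + g) = f /\ Odd (f + g) = g.
Proof.
move=> fn gn; rewrite EvenE OddE negD fn gn; split.
  by rewrite addrACA subrr addr0 half_double.
by rewrite opprD opprK addrACA subrr add0r half_double.
Qed.

Lemma neg_Even f : neg (Even f) = Even f.
Proof. by rewrite EvenE negZ negD negK addrC. Qed.
Lemma neg_Odd f : neg (Odd f) = - Odd f.
Proof. by rewrite OddE negZ negD negN negK -scalerN opprB addrC. Qed.
Lemma swp_Even f : swp f = f -> swp (Even f) = Even f.
Proof. by move=> fs; rewrite EvenE swpZ swpD -neg_swp fs. Qed.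
Lemma swp_Odd f : swp f = f -> swp (Odd f) = Odd f.
Proof. by move=> fs; rewrite OddE swpZ swpD swpN -neg_swp fs. Qed.

(* The coefficients of omega / sinh omega as a series in omega^2. *)
Definition sinh_coef n := s2div (2 *: lam) (s2exp lam - s2exp (- lam)) n.*2 0%N.

(** Overwriting the entries with k = 0 makes omega / sinh(omega) plus the sum of the h_n an instance
    of [param]. *)
Definition with_sinh_coef b n k := if k is 0%N then sinh_coef n else b n k.

Lemma param_with_sinh_coef b :
  param (with_sinh_coef b) = omega_over_sinh K + s2sum (fun n => h_poly b n.+3).
Proof.
congr (_ + _); apply: eq_s2sum => n.
by apply: eq_big_nat => -[|k].
Qed.

Lemma res0_omega_over_sinhE :
  res0 (omega_over_sinh K) = s2sum (fun n => sinh_coef n *: lam ^+ (2 * n)).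
Proof.
rewrite res0_s2sum => [|n]; last exact: omega2X_ord.
by apply: eq_s2sum => n; rewrite res0Z res0X res0_omega2 exprM.
Qed.

Lemma Shq_res0_param b : Shq lam * res0 (param (with_sinh_coef b)) = 2%:R.
Proof. by rewrite res0_param -res0_omega_over_sinhE res0_omega_over_sinh. Qed.

(** The hypothesis determines the restriction to mu = 0, hence the entries [b n 0]; they already are
    the coefficients of omega / sinh(omega). *)
Lemma param_with_sinh_coef_id b : Shq lam * res0 (param b) = 2%:R ->
  param (with_sinh_coef b) = param b.
Proof.
rewrite -(res0_omega_over_sinh natf0) => /(s2_mulI (@Shq_neq0 K natf0 lam)).
rewrite res0_omega_over_sinhE => /res0_param_inj b0.
by congr param; apply/funext => n; apply/funext => -[|k] //=; rewrite b0.
Qed.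

Lemma general_solutionE b bt f : general_solution b bt f <->
  1 + lam * mu * Even f = 2^-1 *: (Shq (lam + mu) * param (with_sinh_coef b))
  /\ Odd f = 2^-1 *: (Sh (lam + mu) * param bt).
Proof.
rewrite /general_solution -opprD -ShU param_with_sinh_coef.
have -> : s2div (Sh (lam + mu)) (2 *: (lam + mu)) = 2^-1 *: Shq (lam + mu).
  apply: s2divE.
    move=> /eqP; rewrite scaler_eq0 (negPf two_neq0) /= => /eqP; exact: lamD_neq0.
  by rewrite -scalerAl -scalerAr scalerA mulVf // scale1r mulrC -ShE.
by rewrite -!scalerAl.
Qed.

Lemma lmn_hexrhs :
  lmn K * hexrhs K = nu * - 1 - s2exp mu * lam - s2exp (- lam) * mu.
Proof.
have -> : lmn K * hexrhs K = - (lam * mu * ((lam + mu) * hexrhs K)).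
  by rewrite /lmn nuE; move: (hexrhs K) => *; ring.
rewrite hexrhsE !s2expE // nuE.
by move: lam mu (expq _) (expq _) => *; ring.
Qed.

(** The reason for the choice U = nu (1 + lambda mu f): the invariant factor [lmn] of the second
    part comes out of the sum, and the part nu contributes - [lmn] times the right-hand side by
    [lmn_hexrhs]. *)
Lemma hexsum_lmn f :
  hexsum (nu * (1 + lam * mu * f)) = lmn K * (hexsum f - hexrhs K).
Proof.
have c1 : cyc (nu * (1 + lam * mu * f)) = lam * (1 + mu * nu * cyc f).
  by rewrite cycM cycD !cycM (rmorph1 (@cyc K)) cyc_lam cyc_mu cyc_nu.
have c2 : cyc (lam * (1 + mu * nu * cyc f)) = mu * (1 + nu * lam * cyc (cyc f)).
  by rewrite cycM cycD !cycM (rmorph1 (@cyc K)) cyc_lam cyc_mu cyc_nu.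
rewrite mulrBr lmn_hexrhs /hexsum c1 c2 /lmn.
by move: lam mu nu (s2exp _) (s2exp _) (cyc (cyc f)) (cyc f) => *; ring.
Qed.

Lemma hexsum_Even_Odd f : swp f = f -> hexsum f = hexrhs K ->
  hexsum (Even f) = hexrhs K /\ hexsum (Odd f) = 0.
Proof.
move=> fs fE; have nE : hexsum (neg f) = hexrhs K.
  by rewrite -neg_swp_hexsum // fE neg_swp_hexrhs.
rewrite EvenE OddE !hexsumZ !hexsumD hexsumN fE nE.
by rewrite half_double subrr scaler0.
Qed.

Lemma general_solution_of_equation f : swp f = f -> hexsum f = hexrhs K ->
  exists b bt, general_solution b bt f.
Proof.
move=> fs fE; have [EE OE] := hexsum_Even_Odd fs fE.
have [Q OQ [Qi Qn]] := hexsum0_Sh natf0 (swp_Odd fs) (neg_Odd f) OE.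
(* The factor 2 compensates the 2^-1 in front of [Sh] and [Shq] in [general_solutionE]. *)
have [bt btE] : exists bt, 2 *: Q = param bt.
  by apply: S3inv_expand => //; [apply: S3invZ | rewrite negZ Qn].
have [|||R UR [Ri Rn]] := @hexsum0_Sh K natf0 (nu * (1 + lam * mu * Even f)).
- rewrite swpM swpD !swpM (rmorph1 (@swp K)) swp_lam swp_mu swp_nu swp_Even //.
  by rewrite [mu * lam]mulrC.
- rewrite negM negD !negM (rmorph1 (@neg K)) neg_lam neg_mu neg_nu neg_Even.
  by rewrite mulrNN mulNr.
- by rewrite hexsum_lmn EE subrr mulr0.
have {}UR : 1 + lam * mu * Even f = Shq (lam + mu) * (- R).
  apply: (s2_mulI (@nu_neq0 K)); rewrite UR ShE // nuE.
  by move: (Shq _) => *; ring.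
have [b bE] : exists b, 2 *: (- R) = param b.
  apply: S3inv_expand => //; last by rewrite negZ negN Rn.
  by apply: S3invZ; rewrite -scaleN1r; apply: S3invZ.
have Ub : 1 + lam * mu * Even f = 2^-1 *: (Shq (lam + mu) * param b).
  by rewrite UR -bE -scalerAr scalerA mulVf // scale1r.
exists b, bt; rewrite general_solutionE; split.
  (* At mu = 0 the term with lambda mu disappears from [Ub], leaving 1 on the left; this is the
     normalisation that forces omega / sinh(omega). *)
  rewrite param_with_sinh_coef_id //.
  have := congr1 (@res0 K) Ub; rewrite res0D (rmorph1 (@res0 K)) !res0M res0_mu mulr0 mul0r.
  rewrite addr0 res0Z res0M (res0_Shq olm) res0D res0_lam res0_mu addr0 => e.
  have := congr1 (fun x => 2 *: x) e; rewrite scalerA mulfV // scale1r => <-.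
  by rewrite scaler_nat.
by rewrite OQ -btE -scalerAr scalerA mulVf // scale1r.
Qed.

Lemma equation_of_general_solution b bt f : general_solution b bt f ->
  swp f = f /\ hexsum f = hexrhs K.
Proof.
rewrite general_solutionE => -[GE OE].
have Pi := S3inv_param (with_sinh_coef b); have Qi := S3inv_param bt.
have sShq : swp (Shq (lam + mu)) = Shq (lam + mu).
  by rewrite (swp_Shq olm) swpD swp_lam swp_mu (addrC mu).
have sSh : swp (Sh (lam + mu)) = Sh (lam + mu).
  by rewrite (swp_Sh olm) swpD swp_lam swp_mu (addrC mu).
have Es : swp (Even f) = Even f.
  apply: (s2_mulI (s2_mulf_neq0 (@lam_neq0 K) (@mu_neq0 K))).
  apply: (addrI 1); rewrite GE -[in RHS]sShq -[in RHS]Pi.1 -swpM -swpZ -GE.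
  by rewrite swpD !swpM (rmorph1 (@swp K)) swp_lam swp_mu [mu * lam]mulrC.
have Os : swp (Odd f) = Odd f by rewrite OE swpZ swpM sSh Qi.1.
have HE : hexsum (Even f) = hexrhs K.
  have : hexsum (nu * (1 + lam * mu * Even f)) = 0.
    have -> : nu * (1 + lam * mu * Even f)
        = Sh (lam + mu) * ((- 2^-1) *: param (with_sinh_coef b)).
      rewrite GE ShE // scaleNr -!scalerAr nuE.
      by rewrite mulrN -scalerAr -mulrA mulNr scalerN.
    exact: hexsum_Sh (S3invZ _ Pi).
  by rewrite hexsum_lmn => /(s2_mul0I (@lmn_neq0 K))/eqP; rewrite subr_eq0 => /eqP.
have HO : hexsum (Odd f) = 0 by rewrite OE scalerAr; exact: hexsum_Sh (S3invZ _ Qi).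
by rewrite [f]Even_Odd swpD hexsumD Es Os HE HO addr0.
Qed.

(** Even f must be obtained by dividing [R] by lambda mu. This is possible because R is symmetric
    and, thanks to the prescribed omega / sinh(omega), vanishes at mu = 0. *)
Lemma exists_general_solution b bt : exists f, general_solution b bt f.
Proof.
have Pi := S3inv_param (with_sinh_coef b).
pose R := 2^-1 *: (Shq (lam + mu) * param (with_sinh_coef b)) - 1.
have Rs : swp R = R.
  rewrite /R swpD swpN swpZ swpM (rmorph1 (@swp K)) Pi.1 (swp_Shq olm) swpD.
  by rewrite swp_lam swp_mu (addrC mu).
have Rn : neg R = R.
  rewrite /R negD negN negZ negM (rmorph1 (@neg K)) neg_param (neg_Shq olm) negD.
  by rewrite neg_lam neg_mu -opprD ShqN.
have R0 : res0 R = 0.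
  rewrite /R res0D res0N res0Z res0M (rmorph1 (@res0 K)) (res0_Shq olm) res0D.
  rewrite res0_lam res0_mu addr0 Shq_res0_param.
  by rewrite [_ *: _](half_double 1) subrr.
have [E RE] := dvd_lam_mu Rs R0.
have En : neg E = E.
  apply: (s2_mulI (s2_mulf_neq0 (@lam_neq0 K) (@mu_neq0 K))).
  by rewrite -RE -[RHS]Rn [in RHS]RE !negM neg_lam neg_mu mulrNN.
pose O := 2^-1 *: (Sh (lam + mu) * param bt).
have On : neg O = - O.
  rewrite /O negZ negM neg_param (neg_Sh olm) negD neg_lam neg_mu -opprD ShN.
  by rewrite mulNr scalerN.
exists (E + O); rewrite general_solutionE; have [-> ->] := EvenP En On.
by rewrite -RE /R addrC subrK.
Qed.

Lemma general_solutionP f : (forall k l, f k l = f l k) /\ f_equation f <->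
  exists b bt, general_solution b bt f.
Proof.
have swpP : (forall k l, f k l = f l k) <-> swp f = f.
  split=> [fs|fs k l]; last by rewrite -{1}fs swpE.
  by apply/s2P => k l; rewrite swpE.
split=> [[/swpP fs /(f_equationP fs)]|[b [bt /equation_of_general_solution[fs fE]]]].
  exact: general_solution_of_equation.
by split; [exact/swpP | exact/(f_equationP fs)].
Qed.

Lemma hexrhs_res0 : res0 (hexrhs K) = expq2 (- lam).
Proof.
apply: (s2_mulI (@lam_neq0 K)).
have := congr1 (@res0 K) (hexrhsE K).
rewrite res0M !res0D res0N (res0_expq om) (res0_expq olN) res0N res0_lam res0_mu addr0 => ->.
rewrite (expqE olN) (expqE (@ord_zero K 1)) mul0r addr0.
by move: (expq2 _) => *; ring.
Qed.

(** The two arguments of the divided difference coincide, so this is the derivative of (e^x - 1) / x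
    at - lambda; on coefficients, (n + 1) / (n + 2)! = 1 / (n + 1)! - 1 / (n + 2)!. *)
Lemma hexrhs_resd : resd (hexrhs K) = expq (- lam) - expq2 (- lam).
Proof.
rewrite resd_s2sum; last exact: hexrhs_ord.
rewrite -s2sumB; apply: eq_s2sum => n; rewrite resdZ raddf_sum /=.
rewrite (eq_bigr (fun=> (- lam) ^+ n)) => [|i _]; last first.
  by rewrite resdM !resdX resdN resd_mu resd_lam -exprD subnK // -ltnS.
rewrite sumr_const card_ord -scaler_nat scalerA -scalerBl; congr (_ *: _).
have n1 : (n.+1`!%:R : K) != 0 by apply: fact_neq0.
have n2 : (n.+2`!%:R : K) != 0 by apply: fact_neq0.
apply: (mulfI n2); rewrite mulrBr mulrA mulfV // mul1r factS natrM.
by rewrite mulfK // -[n.+2]addn1 natrD addrK.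
Qed.

Definition bern : series2 K := s2div lam (s2exp lam - 1).

Lemma bernE : bern * (s2exp lam - 1) = lam.
Proof.
have [u uE] : exists u, u * expq lam = 1 by apply: s2_inv; rewrite expq00 oner_neq0.
have e1 : s2exp lam - 1 = lam * expq lam by rewrite s2expE // addrC addKr.
have -> : bern = u; last by rewrite e1 mulrCA uE mulr1.
apply: s2divE; rewrite e1; last by rewrite mulrCA uE mulr1.
apply: s2_mulf_neq0; first exact: lam_neq0.
by apply: (@s2neq0 _ _ 0 0); rewrite expq00 oner_neq0.
Qed.

(** The restrictions to mu = 0 and to mu = - lambda are two linear equations in s = f(lambda, 0) +
    f(- lambda, 0) and f(lambda, - lambda). Eliminating the latter gives lambda^2 s = lambda
    coth(lambda) - 1, whose coefficients are Bernoulli numbers. *)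
Lemma solution_row f : swp f = f -> hexsum f = hexrhs K -> forall k,
  f (2 * k)%N 0%N = 2 ^+ (2 * k + 1) * bernoulli K (2 * k + 2) / (2 * k + 2)`!%:R.
Proof.
move=> fs fE k.
have c2 : cyc (cyc f) = swp (cyc f) by rewrite swp_cyc fs.
pose s := res0 f + res0 (neg f).
have e1 : s + s2exp (- lam) * resd f = expq2 (- lam).
  have rc : res0 (cyc f) = res0 (neg f) by rewrite -{1}fs res0_cyc.
  rewrite -hexrhs_res0 -fE /hexsum c2 !res0D !res0M (res0_exp om) (res0_exp olN) res0N res0_lam.
  by rewrite res0_mu s2exp0 mul1r res0_flip rc.
have e2 : resd f + s2exp (- lam) * s = expq (- lam) - expq2 (- lam).
  rewrite -hexrhs_resd -fE /hexsum c2 !resdD !resdM (resd_exp om) (resd_exp olN) resdN resd_lam.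
  by rewrite resd_mu resd_cyc resd_flip /s mulrDr [X in _ + X]addrC addrA.
pose q := pdil 2 ol; pose q' := pdil 2 om.
(* D is 2 lambda / (e^(2 lambda) - 1), and D + lambda is lambda coth(lambda). *)
pose D := subst q q' bern.
have DE : D * (s2exp lam ^+ 2 - 1) = 2 *: lam.
  have := congr1 (subst q q') bernE; rewrite rmorphM rmorphB rmorph1 /= subst_lam.
  rewrite subst_exp // subst_lam /= => <-.
  by rewrite scaler_nat mulr2n s2expD // expr2.
have aA := s2expN natf0 ol.
have main : lam ^+ 2 * s = D + lam - 1.
  have a0 : 1 - s2exp (- lam) ^+ 2 <> 0.
    have -> : 1 - s2exp (- lam) ^+ 2 = s2exp (- lam) * Sh lam.
      by rewrite -aA ShU; move: (s2exp _) (s2exp _) => *; ring.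
    apply: s2_mulf_neq0; last by apply: Sh_neq0 => //; apply: lam_neq0.
    by move=> e; move: aA; rewrite e mulr0 => /esym/eqP; rewrite oner_eq0.
  apply: (s2_mulI a0); apply: (row_identity e1 e2 _ _ aA).
  - by rewrite (expqE olN) mulNr.
  - by rewrite (s2expE olN) mulNr.
  by rewrite DE scaler_nat.
have coefs : s (2 * k)%N 0%N = 2 * f (2 * k)%N 0%N.
  rewrite /s s2coefD !res0E /= negE addn0 exprM sqrrN expr1n expr1n mul1r.
  by rewrite -mulr2n mulr_natl.
(* In degree 2 k + 2 >= 2 neither lambda nor 1 contributes. *)
have coefD : (D + lam - 1) (2 * k).+2 0%N = 2 ^+ (2 * k).+2 * bern (2 * k).+2 0%N.
  have l0 : lam (2 * k).+2 0%N = 0 by [].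
  rewrite s2coefB s2coefD l0 s2coef1 /= subr0 addr0.
  by rewrite /D /q /q' dilE addn0.
have := congr1 (fun g : series2 K => g (2 * k).+2 0%N) main.
rewrite coefD expr2 -mulrA !s2mul_lam coefs addn2 addn1 /bernoulli -/bern => E.
apply: (mulfI two_neq0); rewrite E (exprS _ (2 * k).+1) -!mulrA; congr (_ * (_ * _)).
by rewrite mulrC mulfVK //; apply: fact_neq0.
Qed.

End Solutions.

(** * Fox derivatives *)

Section NcSeries.
Variables (K : fieldType) (X : eqType).
Implicit Types (F G H : ncseries K X) (x : X) (w : seq X) (n : nat).

Lemma nccoefD F G w : (F + G) w = F w + G w. Proof. by []. Qed.
Lemma nccoefN F w : (- F) w = - F w. Proof. by []. Qed.
Lemma nccoefZ c F w : (c *: F) w = c * F w. Proof. by []. Qed.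
Lemma nccoef1 w : (1 : ncseries K X) w = (nilp w)%:R. Proof. by []. Qed.
Lemma nccoefM F G w :
  (F * G) w = \sum_(i < (size w).+1) F (take i w) * G (drop i w).
Proof. by []. Qed.
Lemma nccoef_sum I (r : seq I) (P : pred I) (F : I -> ncseries K X) w :
  (\sum_(k <- r | P k) F k) w = \sum_(k <- r | P k) F k w.
Proof. by elim/big_rec2: _ => //= k y z _ <-. Qed.

Lemma ncmul_nil F G : (F * G) [::] = F [::] * G [::].
Proof. by rewrite nccoefM big_ord_recl big_ord0 addr0. Qed.

(** Left and right division by a letter: [lcut] drives the recursion computing [ab], and [rcut]
    gives the partial derivatives. *)
Definition lcut x F : ncseries K X := fun w => F (x :: w).
Definition rcut x F : ncseries K X := fun w => F (rcons w x).

Lemma lcutM x F G : lcut x (F * G) = F [::] *: lcut x G + lcut x F * G.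
Proof. by apply/funext => w; rewrite /lcut nccoefD nccoefM big_ord_recl. Qed.

Lemma rcutM x F G : rcut x (F * G) = F * rcut x G + G [::] *: rcut x F.
Proof.
apply/funext => w; rewrite /rcut nccoefD !nccoefM size_rcons big_ord_recr /=.
congr (_ + _).
  apply: eq_bigr => i _; have iw : (i <= size w)%N by rewrite -ltnS.
  by rewrite -cats1 takel_cat // drop_cat ltn_neqAle iw andbT cats1;
     case: eqVneq => [->|//]; rewrite drop_size subnn.
by rewrite -(size_rcons w x) take_size drop_size mulrC.
Qed.

Definition ncord n F := forall w, (size w < n)%N -> F w = 0.

Lemma ncordM m n F G : ncord m F -> ncord n G -> ncord (m + n) (F * G).
Proof.
move=> Fm Gn w wmn; rewrite nccoefM big1 // => i _.
have iw : (i <= size w)%N by rewrite -ltnS.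
have [im|mi] := ltnP i m; first by rewrite Fm ?mul0r // size_takel.
by rewrite Gn ?mulr0 // size_drop; lia.
Qed.

Lemma ncord1P F : F [::] = 0 -> ncord 1 F.
Proof. by move=> F0 []. Qed.

Lemma ncordX n F : F [::] = 0 -> ncord n (F ^+ n).
Proof.
by move=> F0; elim: n => // n IHn; rewrite exprS -add1n; apply/ncordM/IHn/ncord1P.
Qed.

Lemma ncordZ n c F : ncord n F -> ncord n (c *: F).
Proof. by move=> Fn w wn; rewrite nccoefZ Fn ?mulr0. Qed.

Lemma ncord_sum n I (r : seq I) (P : pred I) (F : I -> ncseries K X) :
  (forall k, P k -> ncord n (F k)) -> ncord n (\sum_(k <- r | P k) F k).
Proof. by move=> Fn w wn; rewrite nccoef_sum big1 // => k Pk; apply: Fn. Qed.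

Lemma ncsum_approx (F : nat -> ncseries K X) N : (forall n, ncord n (F n)) ->
  ncord N (ncsum F - \sum_(n < N) F n).
Proof.
move=> Fo w wN; rewrite nccoefD nccoefN nccoef_sum /ncsum.
rewrite -!(big_mkord xpredT (fun n => F n w)) [in X in _ - X](big_cat_nat (n := (size w).+1)) //=.
rewrite opprD addNKr big_nat_cond big1 ?oppr0 // => n; rewrite andbT => /andP[wn _].
exact: Fo.
Qed.

Lemma ncsum_nil (F : nat -> ncseries K X) : ncsum F [::] = F 0%N [::].
Proof. by rewrite /ncsum big_ord1. Qed.

Variables (s : seq X) (rho : X -> series2 K).
Hypothesis rho1 : forall x, ord 1 (rho x).

(* The image in K[[lambda, mu]] of the part of degree n of a series, letters
   being sent to the rho x; only the letters listed in s are considered. *)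
Fixpoint abdeg n F : series2 K :=
  if n is n'.+1 then \sum_(x <- s) rho x * abdeg n' (lcut x F)
  else F [::] *: 1.

Definition ab F := s2sum (abdeg^~ F).

Lemma abdeg_ord n F : ord n (abdeg n F).
Proof.
elim: n F => [|n IHn] F //=; apply: ord_sum => x _.
by rewrite -add1n; apply: ordM.
Qed.

Lemma abdegD n F G : abdeg n (F + G) = abdeg n F + abdeg n G.
Proof.
elim: n F G => [|n IHn] F G /=; first by rewrite nccoefD scalerDl.
by rewrite -big_split; apply: eq_bigr => x _ /=; rewrite -mulrDr -IHn.
Qed.

Lemma abdegZ n c F : abdeg n (c *: F) = c *: abdeg n F.
Proof.
elim: n F => [|n IHn] F /=; first by rewrite nccoefZ scalerA.
by rewrite scaler_sumr; apply: eq_bigr => x _; rewrite -[lcut _ _]/(c *: lcut x F) IHn scalerAr.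
Qed.

Lemma eq_abdeg n F G : (forall w, size w = n -> F w = G w) -> abdeg n F = abdeg n G.
Proof.
elim: n F G => [|n IHn] F G FG /=; first by rewrite FG.
apply: eq_bigr => x _; congr (_ * _); apply: IHn => w wn.
by apply: FG; rewrite /= wn.
Qed.

Lemma abdeg0 n : abdeg n 0 = 0.
Proof. by have := abdegZ n 0 0; rewrite !scale0r. Qed.

Lemma abdeg_ncord m n F : ncord n F -> (m < n)%N -> abdeg m F = 0.
Proof.
move=> Fn mn; rewrite -(abdeg0 m); apply: eq_abdeg => w wm.
by rewrite Fn ?wm.
Qed.

Lemma abdegM n F G :
  abdeg n (F * G) = \sum_(k < n.+1) abdeg k F * abdeg (n - k) G.
Proof.
elim: n F G => [|n IHn] F G.
  by rewrite big_ord1 /= ncmul_nil -scalerAl mul1r scalerA.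
rewrite big_ord_recl /= -scalerAl mul1r.
transitivity (\sum_(x <- s) (F [::] *: (rho x * abdeg n (lcut x G))
    + \sum_(k < n.+1) (rho x * abdeg k (lcut x F)) * abdeg (n - k) G)).
  apply: eq_bigr => x _; rewrite lcutM abdegD abdegZ IHn mulrDr -scalerAr.
  by congr (_ + _); rewrite mulr_sumr; apply: eq_bigr => k _; rewrite mulrA.
rewrite big_split /= -scaler_sumr; congr (_ + _).
by rewrite exchange_big /=; apply: eq_bigr => k _; rewrite mulr_suml.
Qed.

Lemma abD F G : ab (F + G) = ab F + ab G.
Proof. by rewrite /ab -s2sumD; apply: eq_s2sum => n; rewrite abdegD. Qed.
Lemma abZ c F : ab (c *: F) = c *: ab F.
Proof. by rewrite /ab -s2sumZ; apply: eq_s2sum => n; rewrite abdegZ. Qed.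
Lemma abN F : ab (- F) = - ab F.
Proof. by rewrite -scaleN1r abZ scaleN1r. Qed.
Lemma ab0 : ab 0 = 0.
Proof. by have := abZ 0 0; rewrite !scale0r. Qed.
Lemma ab_sum I (r : seq I) (P : pred I) (F : I -> ncseries K X) :
  ab (\sum_(k <- r | P k) F k) = \sum_(k <- r | P k) ab (F k).
Proof. exact: (big_morph _ abD ab0). Qed.

Lemma abM F G : ab (F * G) = ab F * ab G.
Proof.
rewrite /ab -s2sum_cauchy; try by move=> n; apply: abdeg_ord.
by apply: eq_s2sum => n; rewrite abdegM.
Qed.

Lemma ab1 : ab 1 = 1.
Proof.
rewrite /ab s2sum_recl; last by move=> n; apply: abdeg_ord.
rewrite /= nccoef1 scale1r -[RHS]addr0; congr (_ + _).
apply/s2P => i j; rewrite /s2sum big1 // => n _.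
rewrite big1 // => x _; have -> : lcut x 1 = 0 by apply/funext.
by rewrite abdeg0 mulr0.
Qed.

Lemma abX n F : ab (F ^+ n) = ab F ^+ n.
Proof. by elim: n => [|n IHn]; rewrite ?expr0 ?ab1 // !exprS abM IHn. Qed.

Lemma ab_ord n F : ncord n F -> ord n (ab F).
Proof.
move=> Fn; apply: ord_s2sum => m; first exact: abdeg_ord.
have [mn|nm] := ltnP m n; first by rewrite (abdeg_ncord Fn mn); apply: ord_zero.
exact: ordW nm (@abdeg_ord _ _).
Qed.

Lemma ab_ncsum (F : nat -> ncseries K X) : (forall n, ncord n (F n)) ->
  ab (ncsum F) = s2sum (fun n => ab (F n)).
Proof.
move=> Fo; apply: ord_eq => N.
have -> : ab (ncsum F) - s2sum (fun n => ab (F n))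
  = ab (ncsum F - \sum_(n < N) F n)
    - (s2sum (fun n => ab (F n)) - \sum_(n < N) ab (F n)).
  by rewrite abD abN ab_sum opprB addrA subrK.
apply: ordB; first exact/ab_ord/ncsum_approx.
by apply: s2sum_approx => n; apply: ab_ord.
Qed.

Lemma ab_ncdegpart n F : ab (ncdegpart n F) = abdeg n F.
Proof.
have E m : abdeg m (ncdegpart n F) = if m == n then abdeg n F else 0.
  case: eqP => [->|mn].
    by apply: eq_abdeg => w wn; rewrite /ncdegpart wn eqxx.
  rewrite -(abdeg0 m); apply: eq_abdeg => w wm; rewrite /ncdegpart wm.
  by case: eqP.
apply/s2P => i j; rewrite /ab (@s2sumE _ _ (i + j + n).+1); first last.
- by lia.
- by move=> m; apply: abdeg_ord.
have nb : (n < (i + j + n).+1)%N by lia.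
rewrite (bigD1 (Ordinal nb)) //= E eqxx big1 ?addr0 // => m /eqP mn.
by rewrite E; case: eqP => // e; case: mn; apply: val_inj.
Qed.

(** [A_eq] only provides the parts of each degree; this lemma and [fox_eq0] reassemble them. *)
Lemma ab_eq0 F : (forall d, ab (ncdegpart d F) = 0) -> ab F = 0.
Proof.
move=> F0; apply/s2P => i j; rewrite /ab /s2sum big1 // => n _.
by rewrite -ab_ncdegpart F0.
Qed.

Variable v : X -> K.

(* The abelianised Fox derivative of F for which a letter x has derivative v x:
   only the last letter of a word is differentiated. *)
Definition fox F : series2 K := \sum_(x <- s) v x *: ab (rcut x F).

Lemma foxD F G : fox (F + G) = fox F + fox G.
Proof.
rewrite /fox -big_split; apply: eq_bigr => x _ /=.
by rewrite -scalerDr -abD.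
Qed.
Lemma foxZ c F : fox (c *: F) = c *: fox F.
Proof.
rewrite /fox scaler_sumr; apply: eq_bigr => x _.
by rewrite scalerA mulrC -scalerA -abZ.
Qed.
Lemma foxN F : fox (- F) = - fox F.
Proof. by rewrite -scaleN1r foxZ scaleN1r. Qed.
Lemma fox0 : fox 0 = 0.
Proof. by have := foxZ 0 0; rewrite !scale0r. Qed.
Lemma fox_sum I (r : seq I) (P : pred I) (F : I -> ncseries K X) :
  fox (\sum_(k <- r | P k) F k) = \sum_(k <- r | P k) fox (F k).
Proof. exact: (big_morph _ foxD fox0). Qed.

Lemma fox1 : fox 1 = 0.
Proof.
rewrite /fox big1 // => x _; have -> : rcut x 1 = 0.
  by apply/funext => w; rewrite /rcut nccoef1 /nilp size_rcons.
by rewrite ab0 scaler0.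
Qed.

(** The Fox product rule, with the constant term as augmentation: the last letter of a product of
    two words comes from the second one unless that is empty. *)
Lemma foxM F G : fox (F * G) = ab F * fox G + G [::] *: fox F.
Proof.
rewrite /fox mulr_sumr scaler_sumr -big_split; apply: eq_bigr => x _ /=.
by rewrite rcutM abD abM abZ scalerDr scalerAr [in LHS]scalerA [v x * _]mulrC -scalerA.
Qed.

Lemma fox_ord n F : ncord n.+1 F -> ord n (fox F).
Proof.
move=> Fn; apply: ord_sum => x _; apply/ordZ/ab_ord => w wn.
by rewrite /rcut Fn // size_rcons.
Qed.

(** [fox] lowers the degree by one, so the family has to be shifted before [s2sum] applies. *)
Lemma fox_ncsum (F : nat -> ncseries K X) : (forall n, ncord n (F n)) ->
  fox (ncsum F) = fox (F 0%N) + s2sum (fun n => fox (F n.+1)).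
Proof.
move=> Fo; apply: ord_eq => N.
have -> : fox (ncsum F) - (fox (F 0%N) + s2sum (fun n => fox (F n.+1)))
  = fox (ncsum F - \sum_(n < N.+1) F n)
    - (s2sum (fun n => fox (F n.+1)) - \sum_(n < N) fox (F n.+1)).
  rewrite foxD foxN fox_sum big_ord_recl /=.
  move: (fox (ncsum F)) (fox (F 0%N)) (s2sum _) (\sum_(_ < _) _) => *; ring.
apply: ordB; first exact/fox_ord/ncsum_approx.
by apply: s2sum_approx => n; apply: fox_ord.
Qed.

Lemma fox_ncdegpart n F :
  fox (ncdegpart n.+1 F) = \sum_(x <- s) v x *: abdeg n (rcut x F).
Proof.
apply: eq_bigr => x _; rewrite -ab_ncdegpart; congr (_ *: ab _).
by apply/funext => w; rewrite /rcut /ncdegpart size_rcons eqSS.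
Qed.

Lemma fox_eq0 F : (forall d, fox (ncdegpart d F) = 0) -> fox F = 0.
Proof.
move=> F0; apply/s2P => i j; rewrite /fox s2coef_sum.
under eq_bigr => x _ do rewrite s2coefZ /ab /s2sum mulr_sumr.
rewrite exchange_big big1 // => n _ /=.
have := congr1 (fun f : series2 K => f i j) (F0 n.+1).
rewrite /= fox_ncdegpart s2coef_sum => E.
by transitivity ((0 : series2 K) i j) => //; rewrite -E; apply: eq_bigr.
Qed.

Lemma ab_exp F : F [::] = 0 -> ab (ncexp F) = s2exp (ab F).
Proof.
move=> F0; rewrite ab_ncsum => [|n]; last exact/ncordZ/ncordX.
by apply: eq_s2sum => n; rewrite abZ abX.
Qed.

(** As F has no constant term, the derivative of F^(n+1) is [ab F ^+ n * fox F]; division by (n +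
    1)! turns these powers into [expq]. *)
Lemma fox_exp F : F [::] = 0 -> fox (ncexp F) = expq (ab F) * fox F.
Proof.
move=> F0; have a1 : ord 1 (ab F) by apply/ab_ord/ncord1P.
rewrite fox_ncsum => [|n]; last exact/ncordZ/ncordX.
rewrite expr0 foxZ fox1 scaler0 add0r mulrC -s2sumMl => [|n]; last exact: ordZX.
apply: eq_s2sum => n; rewrite foxZ exprSr foxM abX F0 scale0r addr0.
by rewrite -scalerAr mulrC.
Qed.

Lemma ncexp_nil F : ncexp F [::] = 1.
Proof. by rewrite /ncexp ncsum_nil fact0 invr1 scale1r. Qed.

Lemma ncinv_nil F : ncinv F [::] = 1.
Proof. by rewrite /ncinv ncsum_nil. Qed.

Lemma ab_inv F : F [::] = 1 -> ab F = 1 -> ab (ncinv F) = 1.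
Proof.
move=> F1 aF; have F0 : (1 - F) [::] = 0 by rewrite nccoefD nccoefN F1 subrr.
rewrite ab_ncsum => [|n]; last exact: ncordX.
have -> : (fun n => ab ((1 - F) ^+ n)) = fun n => 0 ^+ n.
  by apply/funext => n; rewrite abX abD abN ab1 aF subrr.
rewrite s2sum_recl => [|n]; last by apply: ordX; apply: ord_zero.
rewrite expr0 -[RHS]addr0; congr (_ + _).
by apply/s2P => i j; rewrite /s2sum big1 // => n _; rewrite exprS mul0r.
Qed.

(** In the geometric series only the linear term 1 - F survives, since the derivatives of the higher
    powers contain the factor [ab (1 - F)] = 0. *)
Lemma fox_inv F : F [::] = 1 -> ab F = 1 -> fox (ncinv F) = - fox F.
Proof.
move=> F1 aF; have F0 : (1 - F) [::] = 0 by rewrite nccoefD nccoefN F1 subrr.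
rewrite fox_ncsum => [|n]; last exact: ncordX.
have aF0 : ab (1 - F) = 0 by rewrite abD abN ab1 aF subrr.
have E n : fox ((1 - F) ^+ n.+1) = (0 ^+ n) * (- fox F).
  by rewrite exprSr foxM abX aF0 F0 scale0r addr0 foxD foxN fox1 add0r.
rewrite expr0 fox1 add0r (eq_s2sum E).
rewrite s2sum_recl => [|n]; last by apply: ordMr; apply: ordX; apply: ord_zero.
rewrite expr0 mul1r -[RHS]addr0; congr (_ + _).
by apply/s2P => i j; rewrite /s2sum big1 // => n _; rewrite exprS !mul0r.
Qed.

End NcSeries.

Lemma big_tuple_cons (V : nmodType) (T : finType) n (F : n.+1.-tuple T -> V) :
  \sum_(w : n.+1.-tuple T) F w = \sum_x \sum_(w : n.-tuple T) F [tuple of x :: w].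
Proof.
rewrite pair_big /= (reindex (fun p : T * n.-tuple T => [tuple of p.1 :: p.2])) //=.
exists (fun w : n.+1.-tuple T => (thead w, [tuple of behead w])) => [[x w] _|w _] /=.
  by congr (_, _); apply: val_inj.
by rewrite -tuple_eta.
Qed.

(** * The chain rule for Fox derivatives *)

Section Substitution.
Variables (K : fieldType) (X : eqType).
Variables (s : seq X) (rho : X -> series2 K).
Hypothesis rho1 : forall x, ord 1 (rho x).
Variable v : X -> K.
Implicit Types (Phi : ncseries K bool) (p q : maxideal K).

Definition bvals p q (e : bool) : series2 K := if e then val q else val p.
Definition bab p q := ab [:: false; true] (bvals p q).

Lemma bvals1 p q e : ord 1 (bvals p q e).
Proof. by case: e; apply: ord_val. Qed.

Variables (Y Z : ncseries K X).
Hypotheses (Y0 : Y [::] = 0) (Z0 : Z [::] = 0).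
Let L (e : bool) := if e then Z else Y.
Let T n Phi : ncseries K X := \sum_(w : n.-tuple bool) Phi w *: \prod_(e <- w) L e.

Let T0 Phi : T 0 Phi = Phi [::] *: (1 : ncseries K X).
Proof.
rewrite /T (bigD1 [tuple]) //= big_nil [X in _ + X]big1 ?addr0 // => w /eqP ne.
by case: ne; apply: tuple0.
Qed.

Let TS n Phi : T n.+1 Phi
  = \sum_(e <- [:: false; true]) L e * T n (lcut e Phi).
Proof.
rewrite /T big_tuple_cons big_bool !big_cons big_nil addr0 addrC.
congr (_ + _); rewrite mulr_sumr; apply: eq_bigr => w _ /=; rewrite big_cons;
  by apply/funext => u; rewrite nccoefZ !nccoefM mulr_sumr;
     apply: eq_bigr => i _; rewrite nccoefZ mulrCA.
Qed.

Let L0 e : L e [::] = 0. Proof. by case: e. Qed.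

Let T_ord n Phi : ncord n (T n Phi).
Proof.
elim: n Phi => [|n IHn] Phi //; rewrite TS; apply: ncord_sum => e _.
by rewrite -add1n; apply: ncordM => //; apply: ncord1P.
Qed.

Variables p q : maxideal K.
Hypotheses (abY : ab s rho Y = val p) (abZ' : ab s rho Z = val q).

Let abL e : ab s rho (L e) = bvals p q e. Proof. by case: e. Qed.

Let abT n Phi : ab s rho (T n Phi) = abdeg [:: false; true] (bvals p q) n Phi.
Proof.
elim: n Phi => [|n IHn] Phi; first by rewrite T0 abZ ab1.
by rewrite TS ab_sum /=; apply: eq_bigr => e _; rewrite abM // abL IHn.
Qed.

Lemma ab_subst2 Phi : ab s rho (ncsubst2 Phi Y Z) = bab p q Phi.
Proof.
rewrite ab_ncsum //; first by apply: eq_s2sum => n; exact: abT.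
by move=> n; apply: T_ord.
Qed.

Lemma ncsubst2_nil Phi : ncsubst2 Phi Y Z [::] = Phi [::].
Proof. by rewrite /ncsubst2 ncsum_nil -/(T 0 Phi) T0 nccoefZ nccoef1 mulr1. Qed.

Let foxT n Phi : fox s rho v (T n.+1 Phi)
  = \sum_(e <- [:: false; true])
      abdeg [:: false; true] (bvals p q) n (rcut e Phi) * fox s rho v (L e).
Proof.
elim: n Phi => [|n IHn] Phi.
  rewrite TS fox_sum; apply: eq_bigr => e _.
  rewrite foxM // T0 foxZ fox1 !scaler0 mulr0 add0r nccoefZ nccoef1 mulr1.
  by rewrite -scalerAl mul1r.
rewrite TS fox_sum.
transitivity (\sum_(e' <- [:: false; true]) \sum_(e <- [:: false; true])
   bvals p q e' * abdeg [:: false; true] (bvals p q) n (rcut e (lcut e' Phi))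
     * fox s rho v (L e)).
  apply: eq_bigr => e' _; rewrite foxM // IHn abL mulr_sumr.
  rewrite (@T_ord n.+1 _ [::]) // scale0r addr0.
  by apply: eq_bigr => e _; rewrite mulrA.
rewrite exchange_big; apply: eq_bigr => e _.
by rewrite -mulr_suml.
Qed.

(** The chain rule: [rcut e Phi] is the partial Fox derivative of Phi in the letter e, evaluated at
    the abelianised arguments. *)
Lemma fox_subst2 Phi : fox s rho v (ncsubst2 Phi Y Z)
  = bab p q (rcut false Phi) * fox s rho v Y
    + bab p q (rcut true Phi) * fox s rho v Z.
Proof.
rewrite fox_ncsum //; last by move=> n; apply: T_ord.
rewrite -/(T 0 Phi) T0 foxZ fox1 scaler0 add0r.
have o e : forall n, ord n (abdeg [:: false; true] (bvals p q) n (rcut e Phi)).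
  by move=> n; apply: abdeg_ord; apply: bvals1.
rewrite [_ * fox _ _ _ Y]mulrC [_ * fox _ _ _ Z]mulrC /bab /ab.
rewrite -!s2sumMl // -s2sumD; apply: eq_s2sum => n.
rewrite [LHS](foxT n Phi) !big_cons big_nil addr0.
by congr (_ + _); rewrite mulrC.
Qed.

End Substitution.

Section BabSubst.
Variable K : fieldType.
Implicit Types (Phi : ncseries K bool) (p q : maxideal K).

Lemma bab_subst p q Phi : bab p q Phi = subst p q (bab (plam K) (pmu K) Phi).
Proof.
rewrite /bab /ab subst_s2sum; last by move=> n; apply: abdeg_ord; apply: bvals1.
apply: eq_s2sum => n; elim: n Phi => [|n IHn] Phi.
  by rewrite /= linearZ rmorph1.
rewrite /= raddf_sum; apply: eq_bigr => e _ /=; rewrite rmorphM /= IHn.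
by congr (_ * _); case: e; rewrite /= ?subst_lam ?subst_mu.
Qed.

Lemma bab00 p q Phi : bab p q Phi 0%N 0%N = Phi [::].
Proof. by rewrite /bab /ab /s2sum big_ord1 /= s2coefZ s2coef1 mulr1. Qed.

End BabSubst.

(** * Fox derivatives on A_3 and on the metabelian quotient of L_3 *)

Section Metabelian.
Variable K : fieldType.
Variable va vb : K.

Local Notation lam := (lam K).
Local Notation mu := (mu K).
Local Notation nu := (nu K).

Definition t12 : tgen 3 := exist _ (1, 2)%N isT.
Definition t23 : tgen 3 := exist _ (2, 3)%N isT.
Definition t13 : tgen 3 := exist _ (1, 3)%N isT.
Definition letters := [:: t12; t23; t13].

(** The element a + b + c is central in L_3. Both [rho3] and [v3] have sum 0 over the three letters,
    which is what makes the cyclic relators vanish. *)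
Definition rho3 (t : tgen 3) : series2 K :=
  if t == t12 then lam else if t == t23 then mu else nu.
Definition v3 (t : tgen 3) : K :=
  if t == t12 then va else if t == t23 then vb else - va - vb.

Lemma rho3_ord t : ord 1 (rho3 t).
Proof.
rewrite /rho3; case: ifP => _; first exact: ord_lam.
by case: ifP => _; [apply: ord_mu | apply: ord_nu].
Qed.
Hint Resolve rho3_ord : core.

Local Notation ab3 := (ab letters rho3).
Local Notation fox3 := (fox letters rho3 v3).
Local Notation ev := (@lie_eval K (tgen 3)).

Lemma lie_eval_nil (e : lie_expr K (tgen 3)) : ev e [::] = 0.
Proof.
elim: e => [x||e1 h1 e2 h2|c e1 h1|e1 h1 e2 h2] //=.
- by rewrite nccoefD h1 h2 addr0.
- by rewrite nccoefZ h1 mulr0.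
- by rewrite nccoefD nccoefN !ncmul_nil h1 h2 !mulr0 subr0.
Qed.

Lemma ab_br e1 e2 : ab3 (ev (LBr e1 e2)) = 0.
Proof. by rewrite /= abD abN !abM // mulrC subrr. Qed.

(** As [ab3] kills brackets, ad x acts on values of the derived algebra as multiplication by [ab3]
    of x, and brackets of two brackets have value 0. *)
Lemma fox_br e1 e2 : fox3 (ev (LBr e1 e2))
  = ab3 (ev e1) * fox3 (ev e2) - ab3 (ev e2) * fox3 (ev e1).
Proof. by rewrite /= foxD foxN !foxM // !lie_eval_nil !scale0r !addr0. Qed.

Lemma ab_letter t : t \in letters -> ab3 (ncmonom K [:: t]) = rho3 t.
Proof.
move=> tl.
have E n : abdeg letters rho3 n (ncmonom K [:: t]) = if n == 1%N then rho3 t else 0.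
  case: n => [|n] /=; first by rewrite /ncmonom scale0r.
  have [->|n0] := eqVneq n 0%N.
    rewrite (bigD1_seq t) //= big1 => [|x /negPf xt].
      by rewrite /lcut /ncmonom eqxx scale1r mulr1 addr0.
    by rewrite /lcut /ncmonom eqseq_cons xt scale0r mulr0.
  rewrite eqSS (negPf n0) big1 // => x _.
  rewrite -[X in _ * X](_ : 0 = _) ?mulr0 // -(abdeg0 letters rho3 n).
  apply: eq_abdeg => w wn; rewrite /lcut /ncmonom.
  by case: w wn => [wn|y w _]; [rewrite -wn in n0 | rewrite eqseq_cons andbF].
apply/s2P => i j; rewrite /ab (@s2sumE _ _ (i + j).+2) //; last first.
  by move=> n; apply: abdeg_ord.
rewrite !big_ord_recl !E add0r big1 ?addr0 // => k _.
by rewrite E.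
Qed.

Lemma fox_letter t : t \in letters -> fox3 (ncmonom K [:: t]) = v3 t *: 1.
Proof.
move=> tl; rewrite /fox (bigD1_seq t) //= big1 => [|x /negPf xt].
  rewrite addr0; congr (_ *: _); rewrite -(ab1 letters rho3_ord); congr (ab _ _ _).
  apply/funext => w; rewrite /rcut /ncmonom nccoef1 /nilp.
  by case: w => [|y w] //=; rewrite ?eqxx // eqseq_cons; case: w => [|z w]; rewrite andbF.
have -> : rcut x (ncmonom K [:: t]) = 0.
  apply/funext => w; rewrite /rcut /ncmonom.
  case: w => [|y w] /=; first by rewrite eqseq_cons xt.
  by rewrite eqseq_cons; case: w => [|z w]; rewrite andbF.
by rewrite ab0 scaler0.
Qed.

Lemma tLE i j (h : (1 <= i)%N && (i < j)%N && (j <= 3)%N) :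
  tL K 3 i j = LVar (exist _ (i, j) h).
Proof.
have ij : (i < j)%N by case/andP: h => /andP[].
by rewrite /tL (minn_idPl (ltnW ij)) (maxn_idPr (ltnW ij)) insubT //=.
Qed.

Lemma tL_sym n i j : tL K n i j = tL K n j i.
Proof. by rewrite /tL minnC maxnC. Qed.

Lemma ev12 : ev (tL K 3 1 2) = ncmonom K [:: t12]. Proof. by rewrite (@tLE 1 2 isT). Qed.
Lemma ev23 : ev (tL K 3 2 3) = ncmonom K [:: t23]. Proof. by rewrite (@tLE 2 3 isT). Qed.
Lemma ev13 : ev (tL K 3 1 3) = ncmonom K [:: t13]. Proof. by rewrite (@tLE 1 3 isT). Qed.

Lemma ab12 : ab3 (ev (tL K 3 1 2)) = lam. Proof. by rewrite ev12 ab_letter. Qed.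
Lemma ab23 : ab3 (ev (tL K 3 2 3)) = mu. Proof. by rewrite ev23 ab_letter. Qed.
Lemma ab13 : ab3 (ev (tL K 3 1 3)) = nu. Proof. by rewrite ev13 ab_letter. Qed.
Lemma fox12 : fox3 (ev (tL K 3 1 2)) = va *: 1. Proof. by rewrite ev12 fox_letter. Qed.
Lemma fox23 : fox3 (ev (tL K 3 2 3)) = vb *: 1. Proof. by rewrite ev23 fox_letter. Qed.
Lemma fox13 : fox3 (ev (tL K 3 1 3)) = (- va - vb) *: 1.
Proof. by rewrite ev13 fox_letter. Qed.

Definition tE := (ab12, ab23, ab13, fox12, fox23, fox13).

Lemma relator_val (r : lie_expr K (tgen 3)) : L_relator r ->
  ab3 (ev r) = 0 /\ fox3 (ev r) = 0.
Proof.
case=> [i j k l u a|i j k u a].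
  (* The commutation relators need four distinct indices, and only 1, 2, 3 are available. *)
  have /uniq_leq_size : uniq [:: i; j; k; l] by [].
  move=> /(_ [:: 1; 2; 3])%N; suff sub : {subset [:: i; j; k; l] <= [:: 1; 2; 3]%N}.
    by move=> /(_ sub).
  move=> m mi; have /allP/(_ m mi)/andP[] := a.
  by case: m {mi} => [|[|[|[|]]]].
have br e1 e2 e3 e4 : ev (LSub (LBr e1 e2) (LBr e3 e4))
    = ev (LBr e1 e2) - ev (LBr e3 e4) by rewrite /= scaleN1r.
rewrite br abD abN foxD foxN !ab_br subrr !fox_br; split=> //.
have nE : nu = - lam - mu by apply: nuU.
move: u a; case: i => [|[|[|[|i]]]] //; case: j => [|[|[|[|j]]]] //;
  case: k => [|[|[|[|k]]]] // _ _.
all: rewrite ?[tL K 3 2 1]tL_sym ?[tL K 3 3 1]tL_sym ?[tL K 3 3 2]tL_sym !tE nE.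
all: rewrite !scalerDl !scaleNr; move: lam mu (va *: 1) (vb *: 1) => *; ring.
Qed.

End Metabelian.

Section Metabelian.
Variable K : fieldType.
Variable va vb : K.

Local Notation lam := (lam K).
Local Notation mu := (mu K).
Local Notation nu := (nu K).
Local Notation rho3 := (rho3 K).
Let rho3_ord := @rho3_ord K.
Hint Resolve rho3_ord : core.
Local Notation ab3 := (ab letters rho3).
Local Notation fox3 := (fox letters rho3 (v3 va vb)).
Local Notation ev := (@lie_eval K (tgen 3)).

Lemma A_ideal_val (F : ncseries K (tgen 3)) : A_ideal F -> ab3 F = 0 /\ fox3 F = 0.
Proof.
elim=> [|c u r v G rr _ [aG fG]]; first by rewrite ab0 fox0.
have [ar fr] := relator_val va vb rr.
rewrite abD foxD aG fG abZ foxZ !abM // !foxM // ar fr lie_eval_nil.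
by rewrite abM // ar !(mulr0, mul0r, scale0r, scaler0, addr0).
Qed.

Lemma A_eq_val (F G : ncseries K (tgen 3)) : A_eq F G -> ab3 F = ab3 G /\ fox3 F = fox3 G.
Proof.
move=> FG; have aFG : ab3 (F - G) = 0.
  by apply: ab_eq0 => // d; case: (A_ideal_val (FG d)).
have fFG : fox3 (F - G) = 0.
  by apply: fox_eq0 => // d; case: (A_ideal_val (FG d)).
move: aFG fFG; rewrite abD abN foxD foxN => /eqP; rewrite subr_eq0 => /eqP ->.
by move=> /eqP; rewrite subr_eq0 => /eqP ->.
Qed.

Lemma lie_eq_val (e e' : lie_expr K (tgen 3)) : lie_eq (@Lbar3_relator K) e e' ->
  ab3 (ev e) = ab3 (ev e') /\ fox3 (ev e) = fox3 (ev e').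
Proof.
have aB x y : ab3 (ev x * ev y - ev y * ev x) = 0 by apply: ab_br.
have fB x y : fox3 (ev x * ev y - ev y * ev x)
    = ab3 (ev x) * fox3 (ev y) - ab3 (ev y) * fox3 (ev x) by apply: fox_br.
elim=> {e e'} /=.
- by [].
- by move=> x y _ [-> ->].
- by move=> x y z _ [-> ->] _ [-> ->].
- by move=> x x' y y' _ [h1 h2] _ [h3 h4]; rewrite !abD !foxD h1 h2 h3 h4.
- by move=> c x x' _ [h1 h2]; rewrite !abZ !foxZ h1 h2.
- by move=> x x' y y' _ [h1 h2] _ [h3 h4]; rewrite !aB !fB h1 h2 h3 h4.
- by move=> x y z; rewrite addrA.
- by move=> x y; rewrite addrC.
- by move=> x; rewrite add0r.
- by move=> x; rewrite scaleN1r subrr.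
- by move=> x; rewrite scale1r.
- by move=> c d x; rewrite scalerA.
- by move=> c x y; rewrite scalerDr.
- by move=> c d x; rewrite scalerDl.
- by move=> x y z; rewrite mulrDl mulrDr opprD addrACA.
- by move=> x y z; rewrite mulrDl mulrDr opprD addrACA.
- move=> c x y; rewrite (aB (LScale c x) y) (fB (LScale c x) y) /= !abZ !foxZ.
  by rewrite aB fB scaler0 scalerBr -scalerAl -scalerAr.
- move=> c x y; rewrite (aB x (LScale c y)) (fB x (LScale c y)) /= !abZ !foxZ.
  by rewrite aB fB scaler0 scalerBr -scalerAl -scalerAr.
- by move=> x; rewrite subrr.
(* The inner bracket has [ab3] equal to 0, so each double bracket has a two-factor value and the
   cyclic sum cancels by commutativity. *)
- move=> x y z; pose br a b := ev a * ev b - ev b * ev a.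
  have J a b c : fox3 (ev a * br b c - br b c * ev a)
     = ab3 (ev a) * (ab3 (ev b) * fox3 (ev c) - ab3 (ev c) * fox3 (ev b)).
    by rewrite -[br b c]/(ev (LBr b c)) fB /= aB fB mul0r subr0.
  have Ja a b c : ab3 (ev a * br b c - br b c * ev a) = 0.
    by rewrite -[br b c]/(ev (LBr b c)) aB.
  set A := (X in X + _); set B := (X in A + (X + _)); set C := (X in A + (B + X)).
  rewrite (abD letters rho3 A) (foxD letters rho3 _ A) (abD letters rho3 B).
  rewrite (foxD letters rho3 _ B) /A /B /C.
  rewrite (Ja x y z) (Ja y z x) (Ja z x y) (J x y z) (J y z x) (J z x y).
  rewrite ab0 fox0 !addr0; split=> //.
  move: (ab3 (ev x)) (ab3 (ev y)) (ab3 (ev z)) (fox3 (ev x)) (fox3 (ev y)) (fox3 (ev z)) => *; ring.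
move=> r [r' rr|x y z w]; first by rewrite ab0 fox0; apply: relator_val.
rewrite (aB (LBr x y) (LBr z w)) (fB (LBr x y) (LBr z w)).
by rewrite !ab_br ab0 fox0 !mul0r subrr.
Qed.

Lemma lie_homog_eval d (e : lie_expr K (tgen 3)) : lie_homog d e ->
  forall w, size w != d -> ev e w = 0.
Proof.
elim=> {d e} //=.
- by move=> x [|y [|z w]] //; rewrite /ncmonom // eqseq_cons andbF.
- by move=> d x y _ hx _ hy w wd; rewrite nccoefD hx // hy // addr0.
- by move=> d c x _ hx w wd; rewrite nccoefZ hx // mulr0.
move=> d1 d2 x y _ hx _ hy w wd.
have M F G m n : (forall u, size u != m -> F u = 0) ->
    (forall u, size u != n -> G u = 0) -> size w != (m + n)%N ->
    ((F : ncseries K (tgen 3)) * G) w = 0.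
  move=> hF hG wmn; rewrite nccoefM big1 // => i _.
  have [im|im] := eqVneq (size (take i w)) m; last by rewrite hF ?mul0r.
  rewrite hG ?mulr0 //; apply: contra wmn => /eqP <-; rewrite -im.
  by rewrite -size_cat cat_take_drop.
by rewrite nccoefD nccoefN !(M _ _ _ _ hx hy, M _ _ _ _ hy hx) ?subr0 // addnC.
Qed.

Lemma lie_homog_ncord d (e : lie_expr K (tgen 3)) : lie_homog d e -> ncord d (ev e).
Proof. by move=> he w wd; apply: (lie_homog_eval he); rewrite neq_ltn wd. Qed.

(** The Fox derivative of [a, b], by [fox_br]. *)
Definition bracket_ab : series2 K := vb *: lam - va *: mu.

Lemma fox_akblab k l : ab3 (ev (lie_akblab K k l)) = 0 /\
  fox3 (ev (lie_akblab K k l)) = lam ^+ k * mu ^+ l * bracket_ab.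
Proof.
have step t e f : ab3 (ev e) = 0 /\ fox3 (ev e) = f ->
    ab3 (ev (LBr t e)) = 0 /\ fox3 (ev (LBr t e)) = ab3 (ev t) * f.
  by case=> ae fe; rewrite ab_br fox_br ae fe mul0r subr0.
elim: k => [|k IHk]; last first.
  by have := step (tL K 3 1 2) _ _ IHk; rewrite ab12 exprS -!mulrA.
rewrite expr0 mul1r; elim: l => [|l IHl]; last first.
  by have := step (tL K 3 2 3) _ _ IHl; rewrite ab23 exprS -!mulrA.
rewrite /= expr0 mul1r (ab_br (tL K 3 1 2) (tL K 3 2 3)).
rewrite (fox_br _ _ (tL K 3 1 2) (tL K 3 2 3)) !tE; split=> //.
by rewrite /bracket_ab -!scalerAr !mulr1.
Qed.

Lemma metabelian_part_val (alpha : series2 K) m :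
  ab3 (ev (metabelian_part alpha m)) = 0 /\
  fox3 (ev (metabelian_part alpha m)) = if m is m'.+2 then
    (\sum_(k < m'.+1) alpha k (m' - k)%N *: (lam ^+ k * mu ^+ (m' - k))) * bracket_ab
    else 0.
Proof.
case: m => [|[|m]] /=; try by rewrite ab0 fox0.
rewrite (big_morph ev (id1 := 0) (op1 := +%R)) // ab_sum fox_sum /= mulr_suml.
split; first by apply: big1 => k _; rewrite abZ (fox_akblab k (m - k)).1 scaler0.
by apply: eq_bigr => k _; rewrite foxZ (fox_akblab k (m - k)).2 scalerAl.
Qed.

Lemma Lbar3_image_val (phi : nat -> lie_expr K (tgen 3)) (alpha : series2 K) :
  lie_graded phi -> Lbar3_image phi alpha ->
  ab3 (lie_series phi) = 0 /\ fox3 (lie_series phi) = alpha * bracket_ab.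
Proof.
move=> gphi im; have ho d := lie_homog_ncord (gphi d).
have aE d : ab3 (ev (phi d)) = 0.
  by rewrite (lie_eq_val (im d)).1 (metabelian_part_val alpha d).1.
split.
  rewrite ab_ncsum //; apply/s2P => i j; rewrite /s2sum big1 // => n _.
  by rewrite aE.
rewrite fox_ncsum // (lie_eq_val (im 0%N)).2 (metabelian_part_val alpha 0).2 add0r.
have fo n : ord n (fox3 (ev (phi n.+1))) by apply: fox_ord.
rewrite s2sum_recl // (lie_eq_val (im 1%N)).2 (metabelian_part_val alpha 1).2 add0r.
rewrite -[alpha in RHS]s2comp_lam_mu mulrC -s2sumMl; last first.
  by move=> n; apply: s2comp_term_ord; [apply: ord_lam | apply: ord_mu].
apply: eq_s2sum => n.
by rewrite (lie_eq_val (im n.+2)).2 (metabelian_part_val alpha n.+2).2 mulrC.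
Qed.

Lemma lie_series_nil (phi : nat -> lie_expr K (tgen 3)) :
  lie_series phi [::] = 0.
Proof. by rewrite /lie_series ncsum_nil lie_eval_nil. Qed.

End Metabelian.

(* Used with A, B, en the exponentials of l, m, - l - m and qn, qm, ql, qb the
   values of (e^x - 1) / x at x = - l - m, m, l, - m. *)
Lemma hexagon_identity (R : comNzRingType) (l m A a B b en qn qm ql qb x y z : R) :
  A * a = 1 -> B * b = 1 -> en = a * b -> en = 1 - (l + m) * qn ->
  B = 1 + m * qm -> A = 1 + l * ql -> b = 1 - m * qb ->
  en * B * (x * l) + en * qm + en * (y * l) - qn + z * l = 0 ->
  m * (l * (l + m)) * (x + A * z + b * y) = m * (l * (ql - qb)).
Proof.
move=> Aa Bb enE enq Bq Aq bq H.
have Aen : A * en = b by rewrite enE mulrA Aa mul1r.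
have AenB : A * en * B = 1 by rewrite Aen mulrC.
have E : l * (x + A * z + b * y) = A * qn - b * qm.
  (* The hypothesis [H] multiplied by A, corrected by terms that vanish because A en = b and A en B
     = 1. *)
  transitivity (A * (en * B * (x * l) + en * qm + en * (y * l) - qn + z * l)
    + (1 - A * en * B) * (x * l) + (b - A * en) * (qm + y * l) + (A * qn - b * qm)).
    by ring.
  by rewrite H AenB Aen !subrr; ring.
have e1 : (l + m) * qn = 1 - en by rewrite [in RHS]enq; ring.
have e2 : m * qm = B - 1 by rewrite Bq; ring.
have e3 : l * ql = A - 1 by rewrite Aq; ring.
have e4 : m * qb = 1 - b by rewrite [in RHS]bq; ring.
have -> : m * (l * (l + m)) * (x + A * z + b * y)
  = m * (l + m) * (l * (x + A * z + b * y)) by ring.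
rewrite E.
have -> : m * (l + m) * (A * qn - b * qm)
  = m * A * ((l + m) * qn) - (l + m) * b * (m * qm) by ring.
have -> : m * (l * (ql - qb)) = m * (l * ql) - l * (m * qb) by ring.
rewrite e1 e2 e3 e4.
have -> : m * A * (1 - en) - (l + m) * b * (B - 1)
  = m * A - m * (A * en) - (l + m) * (B * b) + (l + m) * b by ring.
by rewrite Aen Bb; ring.
Qed.

(** * The equation satisfied by an associator *)

Section Associator.
Variable K : fieldType.
Hypothesis natf0 : forall n, (n%:R == 0 :> K) = (n == 0%N).
Variables (Phi : ncseries K bool) (phi : nat -> lie_expr K (tgen 3)).
Variable alpha : series2 K.
Hypotheses (Phi_assoc : drinfeld_associator Phi) (phi_graded : lie_graded phi).
Hypothesis Phi_exp :
  A_eq (ncsubst2 Phi (tA K 3 1 2) (tA K 3 2 3)) (ncexp (lie_series phi)).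
Hypothesis phi_alpha : Lbar3_image phi alpha.

Local Notation lam := (lam K).
Local Notation mu := (mu K).
Local Notation nu := (nu K).
Local Notation rho3 := (rho3 K).
Let rho3_ord := @rho3_ord K.
Hint Resolve rho3_ord : core.
Let ol : ord 1 lam := @ord_lam K.
Let om : ord 1 mu := @ord_mu K.
Let on : ord 1 nu := @ord_nu K.
Let olN : ord 1 (- lam) := @ord_lamN K.
Let omN : ord 1 (- mu) := @ord_muN K.
Local Notation ab3 := (ab letters rho3).
Local Notation fox3 va vb := (fox letters rho3 (v3 va vb)).
Local Notation a := (tA K 3 1 2).
Local Notation b := (tA K 3 2 3).
Local Notation c := (tA K 3 1 3).

Let tA_nil i j : tA K 3 i j [::] = 0. Proof. exact: lie_eval_nil. Qed.

Let expq0 : expq (0 : series2 K) = 1.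
Proof. by rewrite (expqE (@ord_zero K 1)) mul0r addr0. Qed.

(** The exponential leaves no trace: the Lie series has [ab3] equal to 0, and [expq 0] = 1, so Phi
    has the Fox derivative of phi. *)
Let Phi_val va vb : bab (plam K) (pmu K) Phi = 1 /\
  bab (plam K) (pmu K) (rcut false Phi) * (va *: 1)
  + bab (plam K) (pmu K) (rcut true Phi) * (vb *: 1) = alpha * bracket_ab va vb.
Proof.
have [aE fE] := A_eq_val va vb Phi_exp.
have [aphi fphi] := Lbar3_image_val va vb phi_graded phi_alpha.
have phi0 := lie_series_nil phi.
move: aE fE; rewrite (ab_exp letters rho3_ord phi0) (fox_exp letters rho3_ord _ phi0).
rewrite aphi fphi s2exp0 expq0 mul1r.
rewrite (ab_subst2 rho3_ord (tA_nil 1 2) (tA_nil 2 3) (p := plam K) (q := pmu K)); first last.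
- exact: ab23.
- exact: ab12.
rewrite (fox_subst2 rho3_ord _ (tA_nil 1 2) (tA_nil 2 3) (p := plam K) (q := pmu K)); first last.
- exact: ab23.
- exact: ab12.
by rewrite [fox3 _ _ a]fox12 [fox3 _ _ b]fox23.
Qed.

Let Phi_nil : Phi [::] = 1.
Proof. by rewrite -(bab00 (plam K) (pmu K)) (Phi_val 0 0).1. Qed.

Let Phi_ab p q : bab p q Phi = 1.
Proof. by rewrite bab_subst (Phi_val 0 0).1 rmorph1. Qed.

(** The choices (0, 1) and (1, 0) of (va, vb) isolate the partial derivatives of Phi in b and in a;
    [bab_subst] carries them to other arguments. *)
Let Phi_true p q : bab p q (rcut true Phi) = subst p q alpha * val p.
Proof.
have := (Phi_val 0 1).2; rewrite /bracket_ab !scale0r !scale1r subr0 mulr0 add0r mulr1 => E.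
by rewrite bab_subst E rmorphM /= subst_lam.
Qed.

Let Phi_false p q : bab p q (rcut false Phi) = - (subst p q alpha * val q).
Proof.
have := (Phi_val 1 0).2; rewrite /bracket_ab !scale0r !scale1r sub0r mulr0 addr0 mulr1 => E.
by rewrite bab_subst E mulrN rmorphN rmorphM /= subst_mu.
Qed.

Section Values.
Variables (va vb : K) (Y Z : ncseries K (tgen 3)) (p q : maxideal K).
Hypotheses (Y0 : Y [::] = 0) (Z0 : Z [::] = 0).
Hypotheses (aY : ab3 Y = val p) (aZ : ab3 Z = val q).

Lemma ab_Phi : ab3 (ncsubst2 Phi Y Z) = 1.
Proof. by rewrite (ab_subst2 rho3_ord Y0 Z0 aY aZ) Phi_ab. Qed.

Lemma Phi_nilE : ncsubst2 Phi Y Z [::] = 1.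
Proof. by rewrite ncsubst2_nil. Qed.

(** By the product rule, the last factor is the Fox derivative of the commutator of Y and Z. *)
Lemma fox_Phi : fox3 va vb (ncsubst2 Phi Y Z)
  = subst p q alpha * (val p * fox3 va vb Z - val q * fox3 va vb Y).
Proof.
rewrite (fox_subst2 rho3_ord _ Y0 Z0 aY aZ) Phi_true Phi_false.
by move: (subst _ _ _) (val p) (val q) (fox _ _ _ Y) (fox _ _ _ Z) => *; ring.
Qed.
End Values.

Let aa : ab3 a = val (plam K). Proof. exact: ab12. Qed.
Let ab_ : ab3 b = val (pmu K). Proof. exact: ab23. Qed.
Let ac : ab3 c = val (pnu K). Proof. exact: ab13. Qed.
Let fa : fox3 0 1 a = 0. Proof. by rewrite [fox3 _ _ _]fox12 scale0r. Qed.
Let fb : fox3 0 1 b = 1. Proof. by rewrite [fox3 _ _ _]fox23 scale1r. Qed.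
Let fc : fox3 0 1 c = - 1.
Proof. by rewrite [fox3 _ _ _]fox13 oppr0 sub0r scaleN1r. Qed.

(** All factors have [ab3] and constant term equal to 1, so derivatives add up: for (va, vb) = (0,
    1), condition (1) gives lambda alpha(lambda, mu) = lambda alpha(mu, lambda). *)
Lemma associator_symmetric : swp alpha = alpha.
Proof.
have := (A_eq_val 0 1 (associator_sym Phi_assoc)).2.
rewrite fox1 // foxM // (ab_Phi (tA_nil 1 2) (tA_nil 2 3) aa ab_).
rewrite (Phi_nilE b a) scale1r mul1r.
rewrite (fox_Phi _ _ (tA_nil 1 2) (tA_nil 2 3) aa ab_).
rewrite (fox_Phi _ _ (tA_nil 2 3) (tA_nil 1 2) ab_ aa).
rewrite fa fb !mulr0 !mulr1 subr0 sub0r /= -swpU.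
rewrite -[subst (plam K) (pmu K) alpha]/(s2comp alpha lam mu) s2comp_lam_mu.
rewrite mulrN addrC => /eqP; rewrite subr_eq0 ![_ * lam]mulrC => /eqP.
by move=> /(s2_mulI (@lam_neq0 K)).
Qed.

Lemma associator_hexsum : hexsum alpha = hexrhs K.
Proof.
have alphas := associator_symmetric.
have := (A_eq_val 0 1 (associator_hexagon Phi_assoc)).2.
have bc0 : (b + c) [::] = 0 by rewrite nccoefD !tA_nil addr0.
(* For (va, vb) = (0, 1) the letters b and c have opposite derivatives, so the left side of the
   hexagon contributes 0. *)
rewrite (fox_exp letters rho3_ord _ bc0) foxD fb fc subrr mulr0.
have Ecb0 : ncsubst2 Phi c b [::] = 1 by apply: Phi_nilE.
have Ecba : ab3 (ncsubst2 Phi c b) = 1 by apply: (ab_Phi (tA_nil 1 3) (tA_nil 2 3) ac ab_).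
rewrite !foxM // !abM // (Phi_nilE a b) !ncexp_nil ncinv_nil !scale1r.
rewrite (ab_exp letters rho3_ord (tA_nil 1 3)) (ab_exp letters rho3_ord (tA_nil 2 3)).
rewrite (fox_exp letters rho3_ord _ (tA_nil 1 3)) (fox_exp letters rho3_ord _ (tA_nil 2 3)).
rewrite (ab_inv (s:=letters) rho3_ord Ecb0 Ecba) (fox_inv (s:=letters) rho3_ord _ Ecb0 Ecba).
rewrite (ab_Phi (tA_nil 1 3) (tA_nil 1 2) ac aa).
rewrite (fox_Phi _ _ (tA_nil 1 2) (tA_nil 2 3) aa ab_).
rewrite (fox_Phi _ _ (tA_nil 1 3) (tA_nil 2 3) ac ab_).
rewrite (fox_Phi _ _ (tA_nil 1 3) (tA_nil 1 2) ac aa).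
rewrite ab_ ac fa fb fc /=.
rewrite -[subst (plam K) (pmu K) alpha]/(s2comp alpha lam mu) s2comp_lam_mu.
rewrite -[subst (pnu K) (plam K) alpha]/(s2comp alpha nu lam) -cyc2E.
have -> : subst (pnu K) (pmu K) alpha = cyc alpha.
  by rewrite -{2}alphas cycU swpU subst_comp /= subst_lam subst_mu.
move=> H; have nE := nuU K.
(* Each factor contributes its derivative times the exponentials on its left. The term of the
   inverse uses nu + mu = - lambda, which leaves a common factor lambda in all terms with alpha. *)
have {}H : s2exp nu * s2exp mu * (alpha * lam) + s2exp nu * expq mu
    + s2exp nu * (cyc alpha * lam) - expq nu + cyc (cyc alpha) * lam = 0.
  rewrite [RHS]H; move: (s2exp nu) (s2exp mu) (expq nu) (expq mu) => *.
  by rewrite nE; move: (cyc (cyc alpha)) (cyc alpha) => *; ring.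
(* The hexagon yields the equation with lambda and mu exchanged, so the comparison is made after
   [swp]. *)
rewrite -[hexsum alpha]swpK -[hexrhs K]swpK; congr swp.
have swpE : swp (hexsum alpha)
    = alpha + s2exp lam * cyc (cyc alpha) + s2exp (- mu) * cyc alpha.
  have cs : swp (cyc alpha) = cyc (cyc alpha) by rewrite swp_cyc alphas.
  rewrite /hexsum !swpD !swpM (swp_exp om) (swp_exp olN) swpN swp_mu swp_lam.
  have ccs : swp (cyc (cyc alpha)) = cyc alpha by rewrite -cs swpK.
  by rewrite ccs cs alphas.
have rhsE : (lam + mu) * swp (hexrhs K) = expq lam - expq (- mu).
  have := congr1 (@swp K) (hexrhsE K).
  rewrite swpM !swpD swpN (swp_expq om) (swp_expq olN) swpN swp_mu swp_lam.
  by rewrite [mu + lam]addrC.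
have n0 := s2_mulf_neq0 (@mu_neq0 K) (s2_mulf_neq0 (@lam_neq0 K) (@lamD_neq0 K)).
apply: (s2_mulI n0); rewrite -[in RHS]mulrA -[in RHS]mulrA rhsE swpE.
apply: (hexagon_identity (s2expN natf0 ol) (s2expN natf0 om) _ _ _ _ _ H).
- by rewrite nE s2expD.
- by rewrite (s2expE on) nE; move: (expq _) => *; ring.
- exact: s2expE.
- exact: s2expE.
- by rewrite (s2expE omN) mulNr.
Qed.

End Associator.

Theorem theorem1 (R : realType) :
  [/\ forall beta betat : nat -> nat -> R[i],
        exists f : series2 R[i], general_solution beta betat f,
      forall f : series2 R[i],
        (forall k l : nat, f k l = f l k) /\ f_equation f <->
        exists beta betat : nat -> nat -> R[i], general_solution beta betat f
    & forall (Phi : ncseries R[i] bool)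
             (phi : nat -> lie_expr R[i] (tgen 3)) (alpha : series2 R[i]),
        drinfeld_associator Phi ->
        lie_graded phi ->
        A_eq (ncsubst2 Phi (tA R[i] 3 1 2) (tA R[i] 3 2 3))
             (ncexp (lie_series phi)) ->
        Lbar3_image phi alpha ->
        forall k : nat,
          alpha (2 * k)%N 0%N
          = 2 ^+ (2 * k + 1) * bernoulli R[i] (2 * k + 2) / (2 * k + 2)`!%:R].
Proof.
have natf0 n : (n%:R == 0 :> R[i]) = (n == 0%N) by rewrite pnatr_eq0.
split.
- exact: (exists_general_solution natf0).
- exact: (general_solutionP natf0).
move=> Phi phi alpha Phi_assoc phi_graded Phi_exp phi_alpha.
have alphas := associator_symmetric Phi_assoc phi_graded Phi_exp phi_alpha.
have alphaE := associator_hexsum natf0 Phi_assoc phi_graded Phi_exp phi_alpha.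
exact: (solution_row natf0 alphas alphaE).
Qed.
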